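(* Let $f\colon(\mathbb{C}^2,\mathbf{0})\to(\mathbb{C},0)$ be an irreducible analytic germ with zero locus $X$, multiplicity $m$ at $\mathbf{0}$ and Puiseux pairs $(\beta_1,e_1),\dots,(\beta_s,e_s)$; set $e_0=m$, $\beta_0=0$, $\beta_{s+1}=+\infty$. Let $\Gamma$ be a real analytic half-branch at $\mathbf{0}\in\mathbb{C}^2$ with contact $c=c(\Gamma,X)<+\infty$, and let $k\in\{0,\dots,s\}$ be the unique integer with $\beta_k\le m\cdot c<\beta_{k+1}$. Then the order of $f$ along $\Gamma$ is $$\nu_f(\Gamma)=e_k\, c+(e_0-e_1)\frac{\beta_1}{m}+\dots+(e_{k-1}-e_k)\frac{\beta_k}{m}=e_k\Big(c-\frac{\beta_k}{m}\Big)+\sum_{i=0}^{k-1}e_i\Big(\frac{\beta_{i+1}}{m}-\frac{\beta_i}{m}\Big)$$ (empty sums being $0$ when $k=0$).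
   Context: Puiseux pairs: in suitable local holomorphic coordinates $(x,y)$ the zero locus $X$ is parameterized by $x\mapsto(x^m,\Psi(x))$, $\Psi(x)=\sum_{j>m}a_jx^j$; set $e_0=m$, $\beta_{i+1}=\min\{j:a_j\ne0,\ e_i\nmid j\}$, $e_{i+1}=\gcd(e_i,\beta_{i+1})$, until $e_s=1$. A map germ $\phi\colon(\mathbb{R}_{\ge0},0)\to\mathbb{C}^N$ is ramified analytic if $\phi(t)=\tilde\phi(t^{p/q})$ for some convergent power series $\tilde\phi$ and coprime positive integers $p,q$; a ramified analytic unit if moreover $\tilde\phi(0)\neq0$. A real analytic half-branch at $\mathbf{0}$ is the germ of the image of $[0,\varepsilon)$ under a nonconstant real analytic map $\gamma$ with $\gamma(0)=\mathbf{0}$. An analytic arc is a nonconstant germ $\alpha\colon[0,\varepsilon)\to\mathbb{C}^2$ with $\alpha(0)=\mathbf{0}$, such that $t\mapsto\alpha(t^e)$ is real analytic for some positive integer $e$, and $at\le|\alpha(t)|\le bt$ for small $t$ with constants $0<a<b$. Every half-branch $\Gamma$ is parameterized by analytic arcs. Order: for an analytic arc $\alpha$, $f(\alpha(t))=t^{\nu}V(t)$ with $V$ a ramified analytic unit and $\nu\in\mathbb{Q}_{>0}\cup\{+\infty\}$; $\nu_f(\Gamma):=\nu$ for any analytic arc $\alpha$ parameterizing $\Gamma$ (independent of the choice). Contact: with $X(r)=\{p\in X:|p|=r\}$, $c(\alpha,X)=\lim_{t\to0^+}\log(\mathrm{dist}(\alpha(t),X(|\alpha(t)|)))/\log t$,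 and $c(\Gamma,X):=c(\alpha,X)$ for any analytic arc $\alpha$ parameterizing $\Gamma$ (independent of the choice). *)

(* Defs.v *)
From Stdlib Require Import Reals Arith.
From Coquelicot Require Import Coquelicot.

Open Scope R_scope.

Definition C2 := (C * C)%type.
Definition norm2 (p : C2) : R := sqrt (Cmod (fst p) ^ 2 + Cmod (snd p) ^ 2).
Definition sub2 (p q : C2) : C2 := (Cminus (fst p) (fst q), Cminus (snd p) (snd q)).
Definition zero2 : C2 := (RtoC 0, RtoC 0).

Definition ser1 (a : nat -> C) (z : C) (l : C) : Prop :=
  is_series (fun n => Cmult (a n) (Cpow z n)) l.

Definition ser2 (c : nat -> nat -> C) (x y : C) (l : C) : Prop :=
  exists g : nat -> C,
    (forall i, is_series (fun j => Cmult (c i j) (Cmult (Cpow x i) (Cpow y j))) (g i))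
    /\ is_series g l.

(* f : C^2 -> C is represented near 0 by the convergent power series c:
   the coefficients are bounded by M r^-(i+j) (so the series converges
   absolutely on the polydisc of radius r) and f is the sum there. *)
Definition ser2_rep (r : R) (c : nat -> nat -> C) (f : C2 -> C) : Prop :=
  0 < r /\
  (exists M, forall i j, Cmod (c i j) * r ^ (i + j) <= M) /\
  (forall x y, Cmod x < r -> Cmod y < r -> ser2 c x y (f (x, y))).

Definition analytic0 (f : C2 -> C) : Prop := exists r c, ser2_rep r c f.

Definition irreducible_germ (f : C2 -> C) : Prop :=
  analytic0 f /\ f zero2 = RtoC 0 /\
  (forall eps, 0 < eps -> exists p, norm2 p < eps /\ f p <> RtoC 0) /\
  (forall g h, analytic0 g -> analytic0 h ->
     (exists eps, 0 < eps /\ forall p, norm2 p < eps -> f p = Cmult (g p) (h p)) ->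
     g zero2 <> RtoC 0 \/ h zero2 <> RtoC 0).

Definition germ_mult (f : C2 -> C) (m : nat) : Prop :=
  exists r c, ser2_rep r c f /\
    (exists i j, (i + j = m)%nat /\ c i j <> RtoC 0) /\
    (forall i j, (i + j < m)%nat -> c i j = RtoC 0).

Definition local_coords (Phi : C2 -> C2) : Prop :=
  exists r c1 c2,
    ser2_rep r c1 (fun p => fst (Phi p)) /\ ser2_rep r c2 (fun p => snd (Phi p)) /\
    c1 0%nat 0%nat = RtoC 0 /\ c2 0%nat 0%nat = RtoC 0 /\
    Cminus (Cmult (c1 1%nat 0%nat) (c2 0%nat 1%nat))
           (Cmult (c1 0%nat 1%nat) (c2 1%nat 0%nat)) <> RtoC 0.

Definition puiseux_param (f : C2 -> C) (Phi : C2 -> C2) (m : nat) (a : nat -> C) : Prop :=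
  local_coords Phi /\
  (forall j, (j <= m)%nat -> a j = RtoC 0) /\
  exists rho, 0 < rho /\
    (forall x, Cmod x < rho -> exists l, ser1 a x l) /\
    exists eps, 0 < eps /\ forall p, norm2 p < eps ->
      (f p = RtoC 0 <->
       exists x, Cmod x < rho /\ fst (Phi p) = Cpow x m /\ ser1 a x (snd (Phi p))).

Definition puiseux_pairs (m : nat) (a : nat -> C) (s : nat) (beta e : nat -> nat) : Prop :=
  e 0%nat = m /\ beta 0%nat = 0%nat /\ e s = 1%nat /\
  forall i, (i < s)%nat ->
    a (beta (S i)) <> RtoC 0 /\ ~ Nat.divide (e i) (beta (S i)) /\
    (forall j, a j <> RtoC 0 -> ~ Nat.divide (e i) j -> (beta (S i) <= j)%nat) /\
    e (S i) = Nat.gcd (e i) (beta (S i)).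

Definition same_germ (A B : C2 -> Prop) : Prop :=
  exists r, 0 < r /\ forall p, norm2 p < r -> (A p <-> B p).

Definition img (g : R -> C2) (eps : R) : C2 -> Prop :=
  fun p => exists t, 0 <= t < eps /\ g t = p.

Definition real_analytic_halfbranch_map (gamma : R -> C2) : Prop :=
  exists (g1 g2 : nat -> C) rho, 0 < rho /\
    (forall t, 0 <= t < rho -> ser1 g1 (RtoC t) (fst (gamma t)) /\
                               ser1 g2 (RtoC t) (snd (gamma t))) /\
    g1 0%nat = RtoC 0 /\ g2 0%nat = RtoC 0 /\
    (exists n, (1 <= n)%nat /\ (g1 n <> RtoC 0 \/ g2 n <> RtoC 0)).

Definition analytic_arc (alpha : R -> C2) : Prop :=
  alpha 0 = zero2 /\
  (exists eps, 0 < eps /\ exists t, 0 <= t < eps /\ alpha t <> alpha 0) /\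
  (exists (e : nat) (d1 d2 : nat -> C) rho, (1 <= e)%nat /\ 0 < rho /\
     forall t, 0 <= t < rho -> ser1 d1 (RtoC t) (fst (alpha (t ^ e))) /\
                              ser1 d2 (RtoC t) (snd (alpha (t ^ e)))) /\
  (exists a b eps, 0 < a < b /\ 0 < eps /\
     forall t, 0 <= t < eps -> a * t <= norm2 (alpha t) <= b * t).

Definition parameterizes (alpha gamma : R -> C2) : Prop :=
  exists eta, 0 < eta /\ forall eps1 eps2, 0 < eps1 < eta -> 0 < eps2 < eta ->
    same_germ (img alpha eps1) (img gamma eps2).

Definition ramified_analytic_unit (phi : R -> C) : Prop :=
  exists (p q : nat) (v : nat -> C) rho,
    (0 < p)%nat /\ (0 < q)%nat /\ Nat.gcd p q = 1%nat /\ 0 < rho /\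
    v 0%nat <> RtoC 0 /\
    forall t, 0 < t < rho -> ser1 v (RtoC (Rpower t (INR p / INR q))) (phi t).

Definition order_along (f : C2 -> C) (alpha : R -> C2) (nu : R) : Prop :=
  exists V, ramified_analytic_unit V /\
    exists eps, 0 < eps /\ forall t, 0 < t < eps ->
      f (alpha t) = Cmult (RtoC (Rpower t nu)) (V t).

Definition Xr (f : C2 -> C) (r : R) : C2 -> Prop :=
  fun p => f p = RtoC 0 /\ norm2 p = r.

(* distance from a point to a set (glb, +oo for the empty set) *)
Definition dist_set (p : C2) (S : C2 -> Prop) : Rbar :=
  Glb_Rbar (fun d => exists q, S q /\ d = norm2 (sub2 p q)).

(* c(alpha, X) = c with c a finite real:  log dist(alpha(t), X(|alpha(t)|)) / log t -> c
   as t -> 0+.  (A finite value forces the distance to be eventually positive,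
   which we make explicit so that log is meaningful.) *)
Definition contact_eq (f : C2 -> C) (alpha : R -> C2) (c : R) : Prop :=
  (exists eps, 0 < eps /\ forall t, 0 < t < eps ->
     Rbar_lt (Finite 0) (dist_set (alpha t) (Xr f (norm2 (alpha t)))) /\
     Rbar_lt (dist_set (alpha t) (Xr f (norm2 (alpha t)))) p_infty) /\
  filterlim (fun t => ln (real (dist_set (alpha t) (Xr f (norm2 (alpha t))))) / ln t)
            (at_right 0) (locally c).

Fixpoint rsum (g : nat -> R) (n : nat) : R :=
  match n with O => 0 | S n' => rsum g n' + g n' end.

(* Main.v *)
(* In the chart the curve is parameterized by [x |-> (x ^ m, Psi x)], so the slice of [f] over
   [w1 = x ^ m] vanishes at the [m] branches [Psi (zeta ^ i * x)]. Dividing the slice by these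
   zeros, with Cauchy estimates that are uniform in the slice, leaves a unit, because [f] has
   multiplicity [m]: hence [|f|] is comparable with the product of the [|w2 - Psi (zeta ^ i * x)|].
   The curve is nearly conical, so for the root [x] of [w1] closest to the curve the factor [i = 0]
   is comparable with the distance [d] to the curve on the sphere. Since
   [|Psi x - Psi (zeta ^ i * x)|] is comparable with [|x| ^ B i], where [B i] is the characteristic
   exponent that [zeta ^ i] detects, the other factors are comparable with [max (d, r ^ B i)], where
   [r ^ m] is the radius of the sphere. Along an arc with contact [c] the factors therefore have the
   exponents [c] and [min (c, B i / m)], and counting the [i] with a given [B i] yields the
   formula. *)
Require Import Defs.
From Stdlib Require Import Reals Arith Lra Lia Classical IndefiniteDescription Ranalysis5.
From Coquelicot Require Import Coquelicot.
Open Scope R_scope.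

Local Notation is_cseries := (@is_series C_AbsRing C_NormedModule).

(* [ring] does not see that the carriers of the algebraic structures on [C] are [C]. *)
Local Ltac ring_C := match goal with |- @eq _ ?x ?y => change (x = y :> C) end; ring.

(** * Elementary real analysis *)

Lemma pos_lower_bound2 (x y : R) : 0 < x -> 0 < y -> exists d, 0 < d /\ d <= x /\ d <= y.
Proof.
  intros Hx Hy. exists (Rmin x y). split; [now apply Rmin_glb_lt|].
  split; [apply Rmin_l|apply Rmin_r].
Qed.

Lemma pos_lower_bound3 (x y z : R) : 0 < x -> 0 < y -> 0 < z ->
  exists d, 0 < d /\ d <= x /\ d <= y /\ d <= z.
Proof.
  intros Hx Hy Hz. destruct (pos_lower_bound2 x y Hx Hy) as [e [He [Hex Hey]]].
  destruct (pos_lower_bound2 e z He Hz) as [d [Hd [Hde Hdz]]]. exists d. lra.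
Qed.

Lemma pos_lower_bound4 (x y z t : R) : 0 < x -> 0 < y -> 0 < z -> 0 < t ->
  exists d, 0 < d /\ d <= x /\ d <= y /\ d <= z /\ d <= t.
Proof.
  intros Hx Hy Hz Ht. destruct (pos_lower_bound3 x y z Hx Hy Hz) as [e [He Hexyz]].
  destruct (pos_lower_bound2 e t He Ht) as [d [Hd [Hde Hdt]]]. exists d. lra.
Qed.

Lemma guarded_choice {A B : Type} (P : A -> Prop) (Q : A -> B -> Prop) (b0 : B) :
  (forall x, P x -> exists y, Q x y) -> exists f, forall x, P x -> Q x (f x).
Proof.
  intros H. apply (functional_choice (fun x y => P x -> Q x y)). intros x.
  destruct (classic (P x)) as [Hx|Hx]; [|now exists b0]. destruct (H x Hx) as [y Hy]. now exists y.
Qed.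

Lemma bounded_on_prefix (g : nat -> nat) (n : nat) :
  exists N, forall i, (i < n)%nat -> (g i <= N)%nat.
Proof.
  induction n as [|n [N IH]]; [exists 0%nat; intros; lia|].
  exists (Nat.max N (g n)). intros i Hi. destruct (Nat.eq_dec i n) as [->|h]; [lia|].
  specialize (IH i ltac:(lia)). lia.
Qed.

Lemma uniform_constants (P : nat -> R -> R -> Prop) (n : nat) :
  (forall i d d' K K', 0 < d' <= d -> 0 < K <= K' -> P i d K -> P i d' K') ->
  (forall i, (i < n)%nat -> exists d K, 0 < d /\ 0 < K /\ P i d K) ->
  exists d K, 0 < d /\ 0 < K /\ forall i, (i < n)%nat -> P i d K.
Proof.
  intros Hmono. induction n as [|n IH]; intros H.
  - exists 1, 1. split; [lra|]. split; [lra|]. intros i Hi. lia.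
  - destruct IH as [d [K [Hd [HK IH]]]]; [intros i Hi; apply H; lia|].
    destruct (H n ltac:(lia)) as [d' [K' [Hd' [HK' Hn]]]].
    destruct (pos_lower_bound2 d d' Hd Hd') as [d0 [Hd0 [Hd0d Hd0d']]].
    exists d0, (K + K'). split; [exact Hd0|]. split; [lra|]. intros i Hi.
    destruct (Nat.eq_dec i n) as [->|Ei].
    + apply Hmono with d' K'; [lra|lra|exact Hn].
    + apply Hmono with d K; [lra|lra|]. apply IH. lia.
Qed.

Lemma le_of_le_add_small (A B K d : R) : 0 < d -> 0 <= K ->
  (forall t, 0 < t < d -> A <= B + K * t) -> A <= B.
Proof.
  intros Hd HK H. apply le_epsilon. intros eps Heps.
  destruct (pos_lower_bound2 (d / 2) (eps / (K + 1))) as [t [Ht [Htd Hteps]]];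
    [lra|apply Rdiv_lt_0_compat; lra|].
  specialize (H t ltac:(lra)). apply (Rmult_le_compat_l (K + 1)) in Hteps; [|lra].
  replace ((K + 1) * (eps / (K + 1))) with eps in Hteps by (field; lra). lra.
Qed.

Lemma pow_le_1_compat (x : R) (n : nat) : 0 <= x <= 1 -> 0 <= x ^ n <= 1.
Proof. intros H. split; [now apply pow_le|]. rewrite <- (pow1 n). now apply pow_incr. Qed.

Lemma pow_le_self (x : R) (n : nat) : (1 <= n)%nat -> 0 <= x <= 1 -> x ^ n <= x.
Proof.
  intros Hn Hx. destruct n as [|n]; [lia|]. assert (h := pow_le_1_compat x n Hx). simpl. nra.
Qed.

Lemma pow_lt_compat (x y : R) (n : nat) : (1 <= n)%nat -> 0 <= x < y -> x ^ n < y ^ n.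
Proof.
  intros Hn H. destruct n as [|n]; [lia|].
  assert (h1 : 0 < y ^ n) by (apply pow_lt; lra).
  assert (h2 : x ^ n <= y ^ n) by (apply pow_incr; lra). simpl. nra.
Qed.

Lemma pow_le_inv (x y : R) (n : nat) : (1 <= n)%nat -> 0 <= y -> x ^ n <= y ^ n -> x <= y.
Proof.
  intros Hn Hy H. apply Rnot_lt_le. intros Hlt.
  assert (h := pow_lt_compat y x n Hn ltac:(lra)). lra.
Qed.

Lemma pow_lt_inv (x y : R) (n : nat) : 0 <= y -> x ^ n < y ^ n -> x < y.
Proof.
  intros Hy H. apply Rnot_le_lt. intros Hle. assert (h := pow_incr y x n ltac:(lra)). lra.
Qed.

Lemma pow_le_exponent (x : R) (m n : nat) : 0 <= x <= 1 -> (m <= n)%nat -> x ^ n <= x ^ m.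
Proof.
  intros Hx Hmn. replace n with (m + (n - m))%nat by lia. rewrite pow_add.
  assert (h1 : 0 <= x ^ m) by (apply pow_le; lra). assert (h2 := pow_le_1_compat x (n - m) Hx). nra.
Qed.

Lemma root_bound_pow_le (A x y : R) (m b N : nat) : (1 <= m)%nat -> 1 <= A -> 0 <= x -> 0 <= y ->
  (b <= N)%nat -> x ^ m <= A * y ^ m -> x ^ b <= A ^ N * y ^ b.
Proof.
  intros Hm HA Hx Hy HN H. assert (hym : 0 <= y ^ m) by now apply pow_le.
  assert (hxy : x <= A * y).
  { apply pow_le_inv with m; [exact Hm|apply Rmult_le_pos; lra|]. rewrite Rpow_mult_distr.
    eapply Rle_trans; [exact H|]. apply Rmult_le_compat_r; [exact hym|].
    rewrite <- (pow_1 A) at 1. now apply Rle_pow. }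
  apply Rle_trans with ((A * y) ^ b); [apply pow_incr; lra|]. rewrite Rpow_mult_distr.
  apply Rmult_le_compat_r; [now apply pow_le|]. now apply Rle_pow.
Qed.

Lemma pow_minus_ge (p r : R) (n : nat) : 0 <= r <= p -> r ^ n * (p - r) <= p ^ S n - r ^ S n.
Proof.
  intros H. assert (h : r ^ n <= p ^ n) by now apply pow_incr.
  rewrite <- !tech_pow_Rmult. nra.
Qed.

Lemma Rabs_minus_1_le_pow (t : R) (n : nat) :
  (1 <= n)%nat -> 0 <= t -> Rabs (t - 1) <= Rabs (t ^ n - 1).
Proof.
  intros Hn Ht. destruct (Rle_dec 1 t) as [h|h].
  - assert (h1 : t <= t ^ n) by (rewrite <- (pow_1 t) at 1; now apply Rle_pow).
    rewrite !Rabs_pos_eq; lra.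
  - assert (h1 := pow_le_self t n Hn ltac:(lra)). rewrite !Rabs_left1; lra.
Qed.

Lemma pow_lipschitz (X : R) (n : nat) : 0 <= X -> exists L, 0 <= L /\ forall s t,
  0 <= s <= X -> 0 <= t <= X -> Rabs (s ^ n - t ^ n) <= L * Rabs (s - t).
Proof.
  intros HX. induction n as [|n [L [HL IH]]].
  - exists 0. split; [lra|]. intros s t _ _. simpl. rewrite Rminus_diag, Rabs_R0. lra.
  - exists (X * L + X ^ n). assert (hXn : 0 <= X ^ n) by now apply pow_le.
    split; [assert (h := Rmult_le_pos _ _ HX HL); lra|]. intros s t Hs Ht.
    replace (s ^ S n - t ^ S n) with (s * (s ^ n - t ^ n) + t ^ n * (s - t)) by (simpl; ring).
    eapply Rle_trans; [apply Rabs_triang|]. rewrite !Rabs_mult, Rmult_plus_distr_r.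
    rewrite (Rabs_pos_eq s), (Rabs_pos_eq (t ^ n)) by (try apply pow_le; lra).
    assert (htn : t ^ n <= X ^ n) by now apply pow_incr. assert (hd := Rabs_pos (s - t)).
    apply Rplus_le_compat; [|now apply Rmult_le_compat_r].
    rewrite Rmult_assoc. apply Rmult_le_compat; auto using Rabs_pos; lra.
Qed.

Lemma ivt_lipschitz (g : R -> R) (L lo hi a b v : R) : lo < a < b -> b < hi ->
  (forall s t, lo <= s <= hi -> lo <= t <= hi -> Rabs (g s - g t) <= L * Rabs (s - t)) ->
  g a < v < g b -> exists t, a <= t <= b /\ g t = v.
Proof.
  intros Ha Hb HL Hv.
  destruct (IVT_interv (fun t => g t - v) a b) as [t [Ht Et]]; try lra; [|exists t; split; lra].
  intros t Ht eps Heps.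
  assert (HL0 : 0 < Rabs L + 1) by (assert (h := Rabs_pos L); lra).
  destruct (pos_lower_bound3 (a - lo) (hi - b) (eps / (Rabs L + 1)))
    as [d [Hd [Hdlo [Hdhi Hdeps]]]]; [lra|lra|apply Rdiv_lt_0_compat; lra|].
  exists d. split; [exact Hd|]. intros s [_ Hs]. change (Rabs (s - t) < d) in Hs.
  assert (Hst := Rabs_def2 _ _ Hs). change (Rabs (g s - v - (g t - v)) < eps).
  replace (g s - v - (g t - v)) with (g s - g t) by ring.
  eapply Rle_lt_trans; [apply HL; lra|]. apply Rle_lt_trans with (Rabs L * Rabs (s - t)).
  - apply Rmult_le_compat_r; [apply Rabs_pos|apply Rle_abs].
  - apply Rle_lt_trans with (Rabs L * (eps / (Rabs L + 1))).
    + apply Rmult_le_compat_l; [apply Rabs_pos|lra].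
    + apply Rmult_lt_reg_r with (Rabs L + 1); [exact HL0|].
      replace (Rabs L * (eps / (Rabs L + 1)) * (Rabs L + 1)) with (Rabs L * eps) by (field; lra).
      nra.
Qed.

Lemma Rpower_pos (x y : R) : 0 < Rpower x y.
Proof. apply exp_pos. Qed.

Lemma Rpower_root_pow (x : R) (m n : nat) : Rpower x (/ INR m) ^ n = Rpower x (INR n / INR m).
Proof.
  rewrite <- Rpower_pow, Rpower_mult by apply Rpower_pos. f_equal. unfold Rdiv. ring.
Qed.

Lemma Rpower_root_pow_same (x : R) (m : nat) : (1 <= m)%nat -> 0 < x -> Rpower x (/ INR m) ^ m = x.
Proof.
  intros Hm Hx. rewrite Rpower_root_pow. unfold Rdiv. rewrite Rinv_r by (apply not_0_INR; lia).
  now apply Rpower_1.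
Qed.

Lemma nonneg_root_exists (n : nat) (x : R) :
  (1 <= n)%nat -> 0 <= x -> exists p, 0 <= p /\ p ^ n = x.
Proof.
  intros Hn Hx. destruct (Req_dec x 0) as [->|Hne]; [exists 0; split; [lra|apply pow_i; lia]|].
  exists (Rpower x (/ INR n)). split; [apply Rlt_le, Rpower_pos|].
  apply Rpower_root_pow_same; [exact Hn|lra].
Qed.

(** * Series in normed modules *)

Lemma sum_n_le_is_series (b : nat -> R) (L : R) (n : nat) :
  (forall k, 0 <= b k) -> is_series b L -> sum_n b n <= L.
Proof.
  intros Hb HL. apply (is_lim_seq_incr_compare (sum_n b) L); [exact HL|].
  intros k. rewrite sum_Sn. unfold plus; simpl. specialize (Hb (S k)). lra.
Qed.

Lemma term_le_is_series (b : nat -> R) (L : R) (n : nat) :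
  (forall k, 0 <= b k) -> is_series b L -> b n <= L.
Proof.
  intros Hb HL. apply Rle_trans with (sum_n b n); [|now apply sum_n_le_is_series].
  destruct n as [|n]; [rewrite sum_O; lra|]. rewrite sum_Sn. unfold plus; simpl.
  assert (Hn : 0 <= sum_n b n); [|lra].
  rewrite <- (Rmult_0_r (INR (S n))), <- (sum_n_const n 0), !sum_n_Reals.
  now apply sum_growing.
Qed.

Lemma is_series_tail {K : AbsRing} {V : NormedModule K} (a : nat -> V) (l : V) (n : nat) :
  is_series a l -> is_series (fun k => a (S n + k)%nat) (minus l (sum_n a n)).
Proof.
  intros H. apply is_series_incr_n; [lia|]. cbn [Init.Nat.pred].
  unfold minus. now rewrite <- plus_assoc, (@plus_opp_l (NormedModule.AbelianGroup K V)),
    plus_zero_r.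
Qed.

Lemma is_series_remainder_lt (b : nat -> R) (L eps : R) :
  is_series b L -> 0 < eps -> exists N, forall n, (N <= n)%nat -> L - sum_n b n < eps.
Proof.
  intros H He. destruct (proj2 (is_lim_seq_spec (sum_n b) L) H (mkposreal eps He)) as [N HN].
  exists N. intros n Hn. specialize (HN n Hn). simpl in HN. apply Rabs_def2 in HN. lra.
Qed.

Section NormedSeries.
Context {K : AbsRing} {V : NormedModule K}.

Lemma is_series_fun (a : nat -> V) (l l' : V) : is_series a l -> is_series a l' -> l = l'.
Proof. apply filterlim_locally_unique. Qed.

Lemma norm_sum_n_le (a : nat -> V) (b : nat -> R) (n : nat) :
  (forall k, norm (a k) <= b k) -> norm (sum_n a n) <= sum_n b n.
Proof.
  intros H. unfold sum_n. eapply Rle_trans; [apply norm_sum_n_m|].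
  now apply sum_n_m_le.
Qed.

Lemma norm_is_series_le (a : nat -> V) (b : nat -> R) (l : V) (L : R) :
  (forall n, norm (a n) <= b n) -> is_series a l -> is_series b L -> norm l <= L.
Proof.
  intros H Hl HL.
  apply (is_lim_seq_le (fun n => norm (sum_n a n)) (sum_n b) (norm l) L); [|  |exact HL].
  - intros n. now apply norm_sum_n_le.
  - exact (filterlim_comp _ _ _ _ _ _ _ _ Hl (filterlim_norm l)).
Qed.

Lemma is_series_shift_zero (a : nat -> V) (l : V) (n : nat) :
  (forall j, (j < n)%nat -> a j = zero) ->
  (is_series a l <-> is_series (fun j => a (n + j)%nat) l).
Proof.
  intros H. destruct n as [|n]; [split; apply is_series_ext; reflexivity|].
  assert (E : sum_n a n = zero).
  { rewrite (sum_n_ext_loc _ (fun _ => zero)) by (intros; apply H; lia).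
    unfold sum_n. apply sum_n_m_const_zero. }
  split; intros Hl.
  - apply is_series_tail with (n := n) in Hl.
    now rewrite E, (@minus_zero_r (NormedModule.AbelianGroup K V)) in Hl.
  - apply is_series_decr_n with (S n); [lia|]. cbn [Init.Nat.pred].
    rewrite E. rewrite <- (@minus_zero_r (NormedModule.AbelianGroup K V) l) in Hl. exact Hl.
Qed.

Lemma norm_series_tail_le (a : nat -> V) (b : nat -> R) (l : V) (L : R) (n : nat) :
  (forall k, norm (a k) <= b k) -> is_series a l -> is_series b L ->
  norm (minus l (sum_n a n)) <= L - sum_n b n.
Proof.
  intros H Hl HL.
  apply norm_is_series_le with (fun k => a (S n + k)%nat) (fun k => b (S n + k)%nat).
  - intros k. apply H.
  - now apply is_series_tail.
  - exact (is_series_tail (V := R_NormedModule) b L n HL).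
Qed.

Lemma filterlim_sum_n (F : (nat -> Prop) -> Prop) {FF : Filter F}
  (d : nat -> nat -> V) (e : nat -> V) (n : nat) :
  (forall i, filterlim (fun J => d J i) F (locally (e i))) ->
  filterlim (fun J => sum_n (d J) n) F (locally (sum_n e n)).
Proof.
  intros H. induction n as [|n IH].
  - rewrite sum_O. apply filterlim_ext with (fun J => d J 0%nat); [|apply H].
    intros J. now rewrite sum_O.
  - rewrite sum_Sn. apply filterlim_ext with (fun J => plus (sum_n (d J) n) (d J (S n))).
    + intros J. now rewrite sum_Sn.
    + exact (filterlim_comp_2 _ _ _ IH (H (S n)) (filterlim_plus _ _)).
Qed.

Lemma tannery (d : nat -> nat -> V) (e : nat -> V) (b : nat -> R) (L : nat -> V) (l : V) :
  (forall J i, norm (d J i) <= b i) -> ex_series b ->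
  (forall i, filterlim (fun J => d J i) eventually (locally (e i))) ->
  (forall J, is_series (d J) (L J)) -> is_series e l ->
  filterlim L eventually (locally l).
Proof.
  intros Hd [T HT] Hlim HL Hl.
  assert (He : forall i, norm (e i) <= b i).
  { intros i. apply (is_lim_seq_le (fun J => norm (d J i)) (fun _ => b i) (norm (e i)) (b i)).
    - intros J. apply Hd.
    - exact (filterlim_comp _ _ _ _ _ _ _ _ (Hlim i) (filterlim_norm (e i))).
    - apply is_lim_seq_const. }
  apply filterlim_locally_ball_norm. intros [eps Heps].
  destruct (is_series_remainder_lt b T (eps / 3) HT ltac:(lra)) as [n Hn].
  specialize (Hn n (le_n _)).
  generalize (proj1 (filterlim_locally_ball_norm _ _)
    (filterlim_sum_n eventually d e n Hlim) (mkposreal (eps / 3) ltac:(lra))).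
  apply filter_imp. intros J HJ. unfold ball_norm in *. simpl in *.
  assert (h1 := norm_series_tail_le (d J) b (L J) T n (Hd J) (HL J) HT).
  assert (h2 := norm_series_tail_le e b l T n He Hl HT).
  replace (minus (L J) l) with
    (plus (plus (minus (L J) (sum_n (d J) n)) (minus (sum_n (d J) n) (sum_n e n)))
       (opp (minus l (sum_n e n)))).
  - apply Rle_lt_trans with (T - sum_n b n + eps / 3 + (T - sum_n b n)); [|lra].
    eapply Rle_trans; [apply norm_triangle|]. rewrite norm_opp.
    apply Rplus_le_compat; [|exact h2]. eapply Rle_trans; [apply norm_triangle|].
    apply Rplus_le_compat; [exact h1|]. apply Rlt_le, HJ.
  - now rewrite (@opp_minus (NormedModule.AbelianGroup K V)),
      <- !(@minus_trans (NormedModule.AbelianGroup K V)).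
Qed.

Lemma is_series_sum_n (a : nat -> nat -> V) (q : nat -> V) (J : nat) :
  (forall j, is_series (fun i => a i j) (q j)) ->
  is_series (fun i => sum_n (a i) J) (sum_n q J).
Proof.
  intros H. induction J as [|J IH].
  - rewrite sum_O. apply is_series_ext with (fun i => a i 0%nat); [|apply H].
    intros n. now rewrite sum_O.
  - rewrite sum_Sn. apply is_series_ext with (fun i => plus (sum_n (a i) J) (a i (S J))).
    + intros n. now rewrite sum_Sn.
    + apply is_series_plus; [exact IH|apply H].
Qed.

End NormedSeries.

Lemma is_series_switch {K : AbsRing} {V : CompleteNormedModule K}
  (a : nat -> nat -> V) (b : nat -> nat -> R) (B : nat -> R)
  (r : nat -> V) (l : V) :
  (forall i j, norm (a i j) <= b i j) -> (forall i, is_series (b i) (B i)) -> ex_series B ->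
  (forall i, is_series (a i) (r i)) -> is_series r l ->
  exists q, (forall j, is_series (fun i => a i j) (q j)) /\ is_series q l.
Proof.
  intros Hab Hb HB Hr Hl.
  assert (Hb0 : forall i j, 0 <= b i j).
  { intros i j. exact (Rle_trans _ _ _ (norm_ge_0 (a i j)) (Hab i j)). }
  destruct (functional_choice (fun j q => is_series (fun i => a i j) q)) as [q Hq].
  { intros j. apply (ex_series_le _ B); [|exact HB]. intros i.
    eapply Rle_trans; [apply Hab|]. now apply (term_le_is_series (b i)). }
  exists q. split; [exact Hq|].
  apply (tannery (fun J i => sum_n (a i) J) r B (sum_n q)).
  - intros J i. exact (Rle_trans _ _ _ (norm_sum_n_le (a i) (b i) J (Hab i))
      (sum_n_le_is_series (b i) (B i) J (Hb0 i) (Hb i))).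
  - exact HB.
  - exact Hr.
  - intros J. exact (is_series_sum_n a q J Hq).
  - exact Hl.
Qed.

Lemma is_series_geom_scal (K q : R) : 0 <= q < 1 -> is_series (fun n => K * q ^ n) (K / (1 - q)).
Proof.
  intros Hq. apply (is_series_scal K (fun n => q ^ n)). apply is_series_geom.
  rewrite Rabs_pos_eq; lra.
Qed.

(** * Complex numbers and roots of unity *)

Lemma Cmod_le_0 (x : C) : Cmod x <= 0 -> x = RtoC 0.
Proof. intros H. apply Cmod_eq_0. assert (h := Cmod_ge_0 x). lra. Qed.

Lemma Cmod_minus_le (x y : C) : Cmod (x - y) <= Cmod x + Cmod y.
Proof. rewrite <- (Cmod_opp y). apply Cmod_triangle. Qed.

Lemma Cmod_minus_sym (x y : C) : Cmod (x - y) = Cmod (y - x).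
Proof. rewrite <- Cmod_opp. f_equal. ring. Qed.

Lemma Cmod_minus_ge (x y : C) : Cmod x - Cmod y <= Cmod (x - y).
Proof.
  assert (h := Cmod_triangle (x - y)%C y).
  replace (x - y + y)%C with x in h by ring. lra.
Qed.

Lemma Cmod_minus_triangle (x y z : C) :
  Cmod (x - z) <= Cmod (x - y) + Cmod (y - z).
Proof.
  replace (x - z)%C with (x - y + (y - z))%C by ring. apply Cmod_triangle.
Qed.

Lemma Cmod_scal_R (t : R) (x : C) : 0 <= t -> Cmod (RtoC t * x) = t * Cmod x.
Proof. intros Ht. now rewrite Cmod_mult, Cmod_R, Rabs_pos_eq. Qed.

Lemma Cpow_0_l (m : nat) : (1 <= m)%nat -> (0 ^ m)%C = RtoC 0.
Proof. intros H. destruct m; [lia|]. rewrite Cpow_S. ring. Qed.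

Definition cis (t : R) : C := (cos t, sin t).

Lemma cis_plus (s t : R) : cis (s + t) = (cis s * cis t)%C.
Proof. unfold cis, Cmult; simpl. rewrite cos_plus, sin_plus. f_equal; ring. Qed.

Lemma cis_0 : cis 0 = RtoC 1.
Proof. unfold cis. now rewrite cos_0, sin_0. Qed.

Lemma cis_pow (t : R) (n : nat) : (cis t ^ n)%C = cis (INR n * t).
Proof.
  induction n as [|n IH].
  - simpl. now rewrite Rmult_0_l, cis_0.
  - rewrite Cpow_S, IH, <- cis_plus. f_equal. rewrite S_INR. ring.
Qed.

Lemma Cmod_cis (t : R) : Cmod (cis t) = 1.
Proof.
  unfold Cmod, cis; cbn [fst snd]. rewrite Rplus_comm, <- !Rsqr_pow2, sin2_cos2.
  apply sqrt_1.
Qed.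

Lemma cis_eq_1 (t : R) : 0 <= t < 2 * PI -> cis t = RtoC 1 -> t = 0.
Proof.
  intros Ht E. assert (Ec : cos t = 1) by exact (f_equal fst E).
  destruct (Req_dec t 0) as [h|h]; [exact h|exfalso].
  assert (E2 := cos_2a_sin (t / 2)). replace (2 * (t / 2)) with t in E2 by field.
  assert (hs : 0 < sin (t / 2)) by (apply sin_gt_0; lra). nra.
Qed.

Definition zeta (m : nat) : C := cis (2 * PI / INR m).

Lemma Cmod_zeta_pow (m i : nat) : Cmod (zeta m ^ i) = 1.
Proof. unfold zeta. rewrite Cmod_pow, Cmod_cis. apply pow1. Qed.

Lemma zeta_pow_order (m : nat) : (1 <= m)%nat -> (zeta m ^ m)%C = RtoC 1.
Proof.
  intros Hm. unfold zeta. rewrite cis_pow.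
  replace (INR m * (2 * PI / INR m)) with (2 * PI) by (field; apply not_0_INR; lia).
  unfold cis. now rewrite cos_2PI, sin_2PI.
Qed.

Lemma zeta_pow_eq_1 (m i : nat) : (1 <= m)%nat -> (zeta m ^ i)%C = RtoC 1 <-> Nat.divide m i.
Proof.
  intros Hm. assert (Hm0 : 0 < INR m) by (apply lt_0_INR; lia). assert (hp := PI_RGT_0).
  split.
  - intros E. rewrite (Nat.div_mod_eq i m) in E.
    rewrite Cpow_add_r, Cpow_mult_r, zeta_pow_order, Cpow_1_l, Cmult_1_l in E by exact Hm.
    unfold zeta in E. rewrite cis_pow in E. apply cis_eq_1 in E.
    + apply Nat.Lcm0.mod_divide, INR_eq.
      apply Rmult_eq_reg_r with (2 * PI / INR m); [rewrite E; simpl; ring|].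
      apply Rgt_not_eq, Rdiv_lt_0_compat; lra.
    + assert (h : INR (i mod m) < INR m) by (apply lt_INR, Nat.mod_upper_bound; lia).
      split; [apply Rmult_le_pos; [apply pos_INR|apply Rlt_le, Rdiv_lt_0_compat; lra]|].
      apply Rlt_le_trans with (INR m * (2 * PI / INR m)); [|right; field; lra].
      apply Rmult_lt_compat_r; [apply Rdiv_lt_0_compat; lra|exact h].
  - intros [k ->]. now rewrite Nat.mul_comm, Cpow_mult_r, zeta_pow_order, Cpow_1_l.
Qed.

Lemma zeta_pow_pow_order (m i : nat) : (1 <= m)%nat -> ((zeta m ^ i) ^ m)%C = RtoC 1.
Proof.
  intros Hm. rewrite <- Cpow_mult_r. apply zeta_pow_eq_1; [exact Hm|]. now exists i.
Qed.

Lemma sum_n_geom (q : C) (n : nat) : ((1 - q) * sum_n (fun k => q ^ k) n)%C = (1 - q ^ S n)%C.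
Proof.
  induction n as [|n IH]; [rewrite sum_O; simpl; ring|].
  rewrite sum_Sn. change plus with Cplus. rewrite Cmult_plus_distr_l, IH, !Cpow_S. ring.
Qed.

Lemma sum_n_zeta_pow (n j : nat) : ~ Nat.divide (S n) j ->
  sum_n (fun k => ((zeta (S n) ^ j) ^ k)%C) n = RtoC 0.
Proof.
  intros Hj. assert (E := sum_n_geom (zeta (S n) ^ j)%C n).
  rewrite zeta_pow_pow_order in E by lia. unfold Cminus at 2 in E. rewrite Cplus_opp_r in E.
  apply NNPP. intros Hne. apply (Cmult_neq_0 _ _) in E; [exact E| |exact Hne].
  intros E1. apply Hj, zeta_pow_eq_1; [lia|]. symmetry. now apply Ceq_minus.
Qed.

Lemma sum_n_telescope (u : nat -> C) (n : nat) :
  sum_n (fun k => (u (S k) - u k)%C) n = (u (S n) - u 0%nat)%C :> C.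
Proof.
  induction n as [|n IH]; [now rewrite sum_O|]. rewrite sum_Sn, IH. change plus with Cplus. ring.
Qed.

Lemma sum_n_single {G : AbelianMonoid} (u : nat -> G) (n j : nat) :
  (j <= n)%nat -> (forall l, (l <= n)%nat -> l <> j -> u l = zero) -> sum_n u n = u j.
Proof.
  induction n as [|n IH]; intros Hj Hu.
  - rewrite sum_O. now replace j with 0%nat by lia.
  - rewrite sum_Sn. destruct (Nat.eq_dec j (S n)) as [->|Hne].
    + rewrite (sum_n_ext_loc u (fun _ => zero)) by (intros l Hl; apply Hu; lia).
      unfold sum_n. rewrite sum_n_m_const_zero. apply plus_zero_l.
    + rewrite IH, (Hu (S n)) by (try lia; intros l Hl; apply Hu; lia). apply plus_zero_r.
Qed.

(* Averaging [p z * z ^ - j] over the vertices [z] of a regular [S n]-gon isolates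
   the [j]-th term. *)
Lemma polynomial_coef_average (a : nat -> C) (x : C) (n j : nat) : (j <= n)%nat ->
  sum_n (fun k => (sum_n (fun l => a l * (zeta (S n) ^ k * x) ^ l) n
                   * (zeta (S n) ^ k) ^ (S n - j))%C) n
  = (RtoC (INR (S n)) * (a j * x ^ j))%C.
Proof.
  intros Hj.
  rewrite (sum_n_ext _ (fun k => sum_n (fun l =>
    (a l * x ^ l * (zeta (S n) ^ (l + (S n - j))%nat) ^ k)%C) n)).
  2:{ intros k. rewrite <- (sum_n_mult_r (K := C_Ring)). apply sum_n_ext. intros l.
      change mult with Cmult. rewrite Cpow_mult_l, <- !Cpow_mult_r, Nat.mul_add_distr_r, Cpow_add_r.
      rewrite (Nat.mul_comm l k), (Nat.mul_comm (S n - j) k). ring_C. }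
  rewrite sum_n_switch, (sum_n_single _ n j Hj).
  - replace (j + (S n - j))%nat with (S n) by lia. rewrite zeta_pow_order by lia.
    rewrite (sum_n_ext _ (fun _ => mult (RtoC 1) (a j * x ^ j)%C)).
    2:{ intros k. rewrite Cpow_1_l. apply Cmult_comm. }
    rewrite (sum_n_mult_r (K := C_Ring)). change mult with Cmult. f_equal.
    clear. induction n as [|n IH]; [now rewrite sum_O|].
    rewrite sum_Sn, IH, (S_INR (S n)), RtoC_plus. reflexivity.
  - intros l Hl Hlj. rewrite (sum_n_mult_l (K := C_Ring)), sum_n_zeta_pow; [apply Cmult_0_r|].
    intros [q Hq]. assert (q = 1%nat) by nia. lia.
Qed.

Lemma polynomial_cauchy_estimate (a : nat -> C) (r M : R) (n j : nat) : 0 <= r -> (j <= n)%nat ->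
  (forall z, Cmod z = r -> Cmod (sum_n (fun l => a l * z ^ l)%C n) <= M) ->
  Cmod (a j) * r ^ j <= M.
Proof.
  intros Hr Hj H. assert (hn : 0 < INR (S n)) by (apply lt_0_INR; lia).
  apply Rmult_le_reg_l with (INR (S n)); [exact hn|].
  apply Rle_trans with (Cmod (RtoC (INR (S n)) * (a j * RtoC r ^ j))).
  { right. rewrite Cmod_scal_R, Cmod_mult, Cmod_pow, Cmod_R, Rabs_pos_eq by lra. reflexivity. }
  rewrite <- polynomial_coef_average by exact Hj. rewrite <- sum_n_const.
  apply (norm_sum_n_le (K := C_AbsRing) (V := C_NormedModule)). intros k.
  eapply Rle_trans; [right; apply Cmod_mult|].
  rewrite Cmod_pow, Cmod_zeta_pow, pow1, Rmult_1_r.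
  apply H. rewrite Cmod_mult, Cmod_zeta_pow, Cmod_R, Rabs_pos_eq; lra.
Qed.

(** * Power series in one variable *)

Definition coef_bound (M r : R) (a : nat -> C) : Prop := forall n, Cmod (a n) * r ^ n <= M.

Lemma is_cseries_scal (k : C) (a : nat -> C) (l : C) :
  is_cseries a l -> is_cseries (fun n => (k * a n)%C) (k * l)%C.
Proof. exact (is_series_scal k a l). Qed.

Lemma is_cseries_minus (a b : nat -> C) (l l' : C) :
  is_cseries a l -> is_cseries b l' -> is_cseries (fun n => (a n - b n)%C) (l - l')%C.
Proof. exact (is_series_minus a b l l'). Qed.

Lemma is_cseries_eq0 (a : nat -> C) : (forall n, a n = RtoC 0) -> is_cseries a (RtoC 0).
Proof.
  intros H. apply filterlim_ext with (fun _ => RtoC 0); [|apply filterlim_const].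
  intros n. rewrite <- (H 0%nat). symmetry. apply (sum_n_single a n 0); [lia|]. intros k _ _.
  apply H.
Qed.

Lemma coef_bound_ge0 (M r : R) (a : nat -> C) : coef_bound M r a -> 0 <= M.
Proof.
  intros H. specialize (H 0%nat). rewrite pow_O, Rmult_1_r in H.
  exact (Rle_trans _ _ _ (Cmod_ge_0 _) H).
Qed.

Lemma coef_bound_le (M r x : R) (a : nat -> C) (n : nat) :
  0 < r -> 0 <= x -> coef_bound M r a -> Cmod (a n) * x ^ n <= M * (x / r) ^ n.
Proof.
  intros Hr Hx H. unfold Rdiv. rewrite Rpow_mult_distr, pow_inv.
  apply Rle_trans with (Cmod (a n) * r ^ n * (x ^ n * / r ^ n)).
  - right. field. apply pow_nonzero; lra.
  - apply Rmult_le_compat_r; [|apply H].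
    apply Rmult_le_pos; [now apply pow_le|]. apply Rlt_le, Rinv_0_lt_compat. now apply pow_lt.
Qed.

Lemma ser1_coef_bound (a : nat -> C) (z l : C) :
  ser1 a z l -> exists M, coef_bound M (Cmod z) a.
Proof.
  intros H. destruct (filterlim_bounded _ (ex_intro _ l H)) as [M HM].
  exists (2 * M). intros n. rewrite <- Cmod_pow, <- Cmod_mult.
  assert (HM0 : 0 <= M) by exact (Rle_trans _ _ _ (norm_ge_0 _) (HM 0%nat)).
  destruct n as [|n].
  - assert (h := HM 0%nat). rewrite sum_O in h. apply Rle_trans with M; [exact h|lra].
  - set (u := fun k => (a k * z ^ k)%C) in *. change (a (S n) * z ^ S n)%C with (u (S n)).
    assert (E : u (S n) = (sum_n u (S n) - sum_n u n)%C :> C).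
    { rewrite sum_Sn. change plus with Cplus. ring. }
    rewrite E. eapply Rle_trans; [apply Cmod_minus_le|].
    assert (h1 := HM (S n)). assert (h2 := HM n).
    change (Cmod (sum_n u (S n)) <= M) in h1. change (Cmod (sum_n u n) <= M) in h2. lra.
Qed.

Lemma coef_bound_ex_series (M R r : R) (a : nat -> C) :
  coef_bound M R a -> 0 <= r < R -> ex_series (fun n => Cmod (a n) * r ^ n).
Proof.
  intros H Hr. apply (ex_series_le (V := R_CompleteNormedModule) _ (fun n => M * (r / R) ^ n)).
  - intros n. eapply Rle_trans; [right; apply Rabs_pos_eq|apply coef_bound_le; try lra; exact H].
    apply Rmult_le_pos; [apply Cmod_ge_0|now apply pow_le].
  - eexists. apply is_series_geom_scal. split.
    + apply Rdiv_le_0_compat; lra.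
    + apply Rmult_lt_reg_r with R; [lra|]. unfold Rdiv. rewrite Rmult_assoc, Rinv_l; lra.
Qed.

Lemma ser1_exists (M r : R) (a : nat -> C) (x : C) :
  coef_bound M r a -> Cmod x < r -> exists l, ser1 a x l.
Proof.
  intros Ha Hx. apply (ex_series_le (V := C_CompleteNormedModule)
    _ (fun n => Cmod (a n) * Cmod x ^ n)).
  - intros n. right. rewrite <- Cmod_pow. apply Cmod_mult.
  - apply coef_bound_ex_series with M r; [exact Ha|]. split; [apply Cmod_ge_0|exact Hx].
Qed.

Lemma is_series_half (K : R) : is_series (fun n => K * (/ 2) ^ n) (2 * K).
Proof.
  replace (2 * K) with (K / (1 - / 2)) by field. apply is_series_geom_scal. lra.
Qed.

Lemma Cmod_is_cseries_half_le (a : nat -> C) (K : R) (l : C) :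
  (forall n, Cmod (a n) <= K * (/ 2) ^ n) -> is_cseries a l -> Cmod l <= 2 * K.
Proof.
  intros H Hl. exact (norm_is_series_le a _ l _ H Hl (is_series_half K)).
Qed.

Section Taylor.
Context (M r : R) (a : nat -> C) (x : C).
Hypothesis Hr : 0 < r.
Hypothesis Ha : coef_bound M r a.
Hypothesis Hx : Cmod x <= r / 2.

Lemma ser1_tail_le (n : nat) (l : C) :
  is_cseries (fun k => (a (n + k)%nat * x ^ (n + k))%C) l -> Cmod l <= 2 * M * (Cmod x / r) ^ n.
Proof.
  intros H. rewrite Rmult_assoc. eapply Cmod_is_cseries_half_le; [|exact H].
  intros k. cbv beta. rewrite Cmod_mult, Cmod_pow, Rmult_assoc.
  eapply Rle_trans; [apply (coef_bound_le M r); [exact Hr|apply Cmod_ge_0|exact Ha]|].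
  assert (h0 : 0 <= Cmod x / r).
  { apply Rdiv_le_0_compat; [apply Cmod_ge_0|exact Hr]. }
  rewrite pow_add. apply Rmult_le_compat_l; [now apply (coef_bound_ge0 M r a)|].
  apply Rmult_le_compat_l; [now apply pow_le|]. apply pow_incr. split; [exact h0|].
  apply Rmult_le_reg_r with r; [exact Hr|]. unfold Rdiv. rewrite Rmult_assoc, Rinv_l; lra.
Qed.

Lemma ser1_vanishing_le (n : nat) (l : C) :
  (forall j, (j < n)%nat -> a j = RtoC 0) -> ser1 a x l -> Cmod l <= 2 * M * (Cmod x / r) ^ n.
Proof.
  intros H0 Hl. apply ser1_tail_le.
  apply (is_series_shift_zero (fun k => (a k * x ^ k)%C) l n); [|exact Hl].
  intros j Hj. rewrite (H0 j Hj). apply Cmult_0_l.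
Qed.

Lemma ser1_taylor_le (n : nat) (l : C) : ser1 a x l ->
  Cmod (l - sum_n (fun k => a k * x ^ k)%C n) <= 2 * M * (Cmod x / r) ^ S n.
Proof. intros Hl. apply ser1_tail_le. exact (is_series_tail _ l n Hl). Qed.
End Taylor.

(** * Analytic functions on a disc *)

Definition power_series_on (r : R) (a : nat -> C) (h : C -> C) : Prop :=
  forall z, Cmod z < r -> ser1 a z (h z).

Definition analytic_on (r : R) (h : C -> C) : Prop := exists a, power_series_on r a h.

Lemma power_series_on_coef_bound (r : R) (a : nat -> C) (h : C -> C) (x : R) :
  power_series_on r a h -> 0 <= x < r -> exists M, coef_bound M x a.
Proof.
  intros H Hx. assert (Hm : Cmod (RtoC x) = x) by (rewrite Cmod_R; apply Rabs_pos_eq; lra).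
  rewrite <- Hm. apply ser1_coef_bound with (h (RtoC x)), H. lra.
Qed.

Lemma power_series_on_ex_series (r : R) (a : nat -> C) (h : C -> C) (x : R) :
  power_series_on r a h -> 0 <= x < r -> ex_series (fun n => Cmod (a n) * x ^ n).
Proof.
  intros H Hx. destruct (power_series_on_coef_bound r a h ((x + r) / 2) H ltac:(lra)) as [M HM].
  apply (coef_bound_ex_series M ((x + r) / 2)); [exact HM|lra].
Qed.

Lemma ser1_partial_sum_le (a : nat -> C) (z l : C) (T : R) (n : nat) :
  ser1 a z l -> is_series (fun k => Cmod (a k) * Cmod z ^ k) T ->
  Cmod (sum_n (fun k => a k * z ^ k)%C n)
  <= Cmod l + (T - sum_n (fun k => Cmod (a k) * Cmod z ^ k) n).
Proof.
  intros Hl HT. set (u := fun k => (a k * z ^ k)%C). set (b := fun k => Cmod (a k) * Cmod z ^ k).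
  assert (h1 : Cmod (l - sum_n u n) <= T - sum_n b n).
  { assert (hu : forall k, Cmod (u k) <= b k).
    { intros k. unfold u, b. rewrite Cmod_mult, Cmod_pow. apply Rle_refl. }
    exact (norm_series_tail_le (V := C_NormedModule) u b l T n hu Hl HT). }
  assert (h2 := Cmod_minus_ge (sum_n u n) l). rewrite Cmod_minus_sym in h2. lra.
Qed.

Lemma mult_pow_le_limit (A M r : R) (n : nat) :
  0 < r -> (forall x, 0 <= x < r -> A * x ^ n <= M) -> A * r ^ n <= M.
Proof.
  intros Hr H.
  apply (filterlim_le (F := at_left r) (fun x => A * x ^ n) (fun _ => M) (A * r ^ n) M).
  - exists (mkposreal r Hr). intros x Hxr Hlt. apply H.
    apply Rabs_def2 in Hxr. simpl in Hxr. unfold minus, plus, opp in Hxr. simpl in Hxr. lra.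
  - eapply filterlim_filter_le_1; [apply filter_le_within|].
    apply (continuity_pt_filterlim (fun x => A * x ^ n)).
    apply continuity_pt_mult; [apply continuity_pt_const; now intros ? ?|].
    apply derivable_continuous_pt, derivable_pt_pow.
  - apply filterlim_const.
Qed.

Lemma cauchy_estimate (r : R) (a : nat -> C) (h : C -> C) (M : R) :
  power_series_on r a h -> 0 < r -> (forall z, Cmod z < r -> Cmod (h z) <= M) -> coef_bound M r a.
Proof.
  intros Ha Hr HM j. apply mult_pow_le_limit; [exact Hr|]. intros x Hx.
  destruct (power_series_on_ex_series r a h x Ha Hx) as [T HT].
  apply le_epsilon. intros eps Heps.
  destruct (is_series_remainder_lt _ T eps HT Heps) as [N HN].
  specialize (HN (N + j)%nat ltac:(lia)).
  apply polynomial_cauchy_estimate with (N + j)%nat; [lra|lia|]. intros z Hz. subst x.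
  eapply Rle_trans; [apply ser1_partial_sum_le; [apply Ha; lra|exact HT]|].
  specialize (HM z ltac:(lra)). lra.
Qed.

Lemma power_series_on_unique (r : R) (a b : nat -> C) (h : C -> C) (n : nat) :
  0 < r -> power_series_on r a h -> power_series_on r b h -> a n = b n.
Proof.
  intros Hr Ha Hb. apply Ceq_minus, Cmod_le_0.
  assert (H : coef_bound 0 r (fun k => (a k - b k)%C)).
  { apply cauchy_estimate with (fun _ => RtoC 0); [|exact Hr|intros; rewrite Cmod_0; lra].
    intros z Hz. assert (h0 := is_cseries_minus _ _ _ _ (Ha z Hz) (Hb z Hz)).
    unfold Cminus at 2 in h0. rewrite Cplus_opp_r in h0.
    eapply is_series_ext; [|exact h0]. intros k. cbv beta. ring_C. }
  specialize (H n). cbv beta in H.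
  apply Rmult_le_reg_r with (r ^ n); [now apply pow_lt|]. lra.
Qed.

Lemma analytic_on_ext (r : R) (g h : C -> C) :
  (forall z, Cmod z < r -> g z = h z) -> analytic_on r g -> analytic_on r h.
Proof. intros E [a Ha]. exists a. intros z Hz. rewrite <- E by exact Hz. now apply Ha. Qed.

Lemma analytic_on_le (r r' : R) (h : C -> C) : r' <= r -> analytic_on r h -> analytic_on r' h.
Proof. intros Hr [a Ha]. exists a. intros z Hz. apply Ha. lra. Qed.

Lemma analytic_on_exhaust (r : R) (h : C -> C) :
  0 < r -> (forall r', 0 < r' < r -> analytic_on r' h) -> analytic_on r h.
Proof.
  intros Hr H. destruct (H (r / 2) ltac:(lra)) as [a Ha]. exists a. intros z Hz.
  set (r' := Rmax (r / 2) ((Cmod z + r) / 2)).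
  assert (h1 : r / 2 <= r') by apply Rmax_l. assert (h2 : (Cmod z + r) / 2 <= r') by apply Rmax_r.
  assert (h3 : r' < r) by (apply Rmax_lub_lt; lra).
  destruct (H r' ltac:(lra)) as [b Hb].
  apply (is_series_ext (fun n => (b n * z ^ n)%C)); [|apply Hb; lra].
  intros n. f_equal. apply (power_series_on_unique (r / 2) b a h n); [lra| |exact Ha].
  intros y Hy. apply Hb. lra.
Qed.

Lemma power_series_on_of_coef_bound (M r : R) (a : nat -> C) : coef_bound M r a ->
  exists h, power_series_on r a h.
Proof.
  intros Ha. apply (guarded_choice (fun x => Cmod x < r) (fun x l => ser1 a x l) (RtoC 0)).
  intros x. now apply ser1_exists with M.
Qed.

(* Weierstrass' M-test: the coefficients are summed separately, which Cauchy's estimate permits. *)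
Lemma analytic_on_series (r : R) (h : nat -> C -> C) (M : nat -> R) (H : C -> C) :
  0 < r -> (forall n, analytic_on r (h n)) -> (forall n z, Cmod z < r -> Cmod (h n z) <= M n) ->
  ex_series M -> (forall z, Cmod z < r -> is_cseries (fun n => h n z) (H z)) -> analytic_on r H.
Proof.
  intros Hr Hh HM HMs HH.
  destruct (functional_choice _ Hh) as [a Ha].
  assert (Hb : forall n, coef_bound (M n) r (a n)).
  { intros n. apply cauchy_estimate with (h n); [apply Ha|exact Hr|apply HM]. }
  assert (Hc : forall k, exists c, is_cseries (fun n => a n k) c).
  { intros k. apply (ex_series_le (V := C_CompleteNormedModule) _ (fun n => / r ^ k * M n)).
    - intros n. apply Rmult_le_reg_r with (r ^ k); [now apply pow_lt|].
      eapply Rle_trans; [apply Hb|]. right. field. apply pow_nonzero; lra.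
    - exact (ex_series_scal (/ r ^ k) M HMs). }
  destruct (functional_choice _ Hc) as [c Hcs]. exists c. intros z Hz.
  assert (Hq : 0 <= Cmod z / r < 1).
  { split; [apply Rdiv_le_0_compat; [apply Cmod_ge_0|exact Hr]|].
    apply Rmult_lt_reg_r with r; [exact Hr|]. unfold Rdiv. rewrite Rmult_assoc, Rinv_l; lra. }
  destruct (is_series_switch (V := C_CompleteNormedModule) (fun n k => (a n k * z ^ k)%C)
    (fun n k => M n * (Cmod z / r) ^ k) (fun n => M n / (1 - Cmod z / r)) (fun n => h n z) (H z))
    as [q [Hq1 Hq2]].
  - intros n k. eapply Rle_trans; [right; apply Cmod_mult|]. rewrite Cmod_pow.
    apply coef_bound_le; [exact Hr|apply Cmod_ge_0|apply Hb].
  - intros n. now apply is_series_geom_scal.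
  - eapply ex_series_ext; [|apply (ex_series_scal (/ (1 - Cmod z / r)) M HMs)].
    intros n. apply Rmult_comm.
  - intros n. now apply Ha.
  - now apply HH.
  - eapply is_series_ext; [|exact Hq2]. intros k.
    apply (is_series_fun (V := C_NormedModule) (fun n => (a n k * z ^ k)%C)); [apply Hq1|].
    rewrite Cmult_comm. eapply is_series_ext; [|apply is_cseries_scal, Hcs].
    intros n. apply Cmult_comm.
Qed.

Lemma is_cseries_single (a : nat -> C) (n : nat) :
  (forall k, k <> n -> a k = RtoC 0) -> is_cseries a (a n).
Proof.
  intros H. apply filterlim_ext_loc with (fun _ => a n); [|apply filterlim_const].
  exists n. intros k Hk. symmetry. apply (sum_n_single a k n Hk). intros l _. apply H.
Qed.

Lemma analytic_on_const (r : R) (c : C) : analytic_on r (fun _ => c).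
Proof.
  exists (fun n => if Nat.eqb n 0 then c else RtoC 0). intros z _.
  set (a := fun n => ((if Nat.eqb n 0 then c else RtoC 0) * z ^ n)%C).
  assert (Ea : a 0%nat = c) by (unfold a; simpl; ring).
  change (is_cseries a c). rewrite <- Ea. apply (is_cseries_single a).
  intros [|k] Hk; [contradiction|].
  unfold a. simpl Nat.eqb. cbv iota. ring.
Qed.

Lemma analytic_on_scal (r : R) (c : C) (h : C -> C) :
  analytic_on r h -> analytic_on r (fun z => (c * h z)%C).
Proof.
  intros [a Ha]. exists (fun n => (c * a n)%C). intros z Hz.
  eapply is_series_ext; [|apply is_cseries_scal, (Ha z Hz)]. intros n. cbv beta. ring_C.
Qed.

Lemma analytic_on_minus (r : R) (g h : C -> C) :
  analytic_on r g -> analytic_on r h -> analytic_on r (fun z => (g z - h z)%C).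
Proof.
  intros [a Ha] [b Hb]. exists (fun n => (a n - b n)%C). intros z Hz.
  eapply is_series_ext; [|apply (is_cseries_minus _ _ _ _ (Ha z Hz) (Hb z Hz))].
  intros n. cbv beta. ring_C.
Qed.

Lemma analytic_on_plus (r : R) (g h : C -> C) :
  analytic_on r g -> analytic_on r h -> analytic_on r (fun z => (g z + h z)%C).
Proof.
  intros Hg Hh. apply analytic_on_ext with (fun z => (g z - - 1 * h z)%C); [intros; ring|].
  apply analytic_on_minus; [exact Hg|]. now apply analytic_on_scal.
Qed.

Lemma analytic_on_id_pow_mult (r : R) (n : nat) (h : C -> C) :
  analytic_on r h -> analytic_on r (fun z => (z ^ n * h z)%C).
Proof.
  intros Hh. induction n as [|n [a Ha]].
  - apply analytic_on_ext with h; [|exact Hh]. intros z _. simpl. ring.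
  - exists (fun k => match k with O => RtoC 0 | S k => a k end). intros z Hz.
    apply (is_series_shift_zero (V := C_NormedModule) _ _ 1).
    + intros [|j] Hj; [apply Cmult_0_l|lia].
    + rewrite Cpow_S, <- Cmult_assoc.
      eapply is_series_ext; [|apply is_cseries_scal, (Ha z Hz)].
      intros k. cbn [Nat.add]. rewrite Cpow_S. ring_C.
Qed.

Lemma analytic_on_bounded (r r' : R) (h : C -> C) : 0 <= r' < r -> analytic_on r h ->
  exists M, forall z, Cmod z < r' -> Cmod (h z) <= M.
Proof.
  intros Hr [a Ha]. destruct (power_series_on_ex_series r a h r' Ha Hr) as [M HM].
  exists M. intros z Hz.
  apply (norm_is_series_le (V := C_NormedModule) (fun n => (a n * z ^ n)%C)
    (fun n => Cmod (a n) * r' ^ n) (h z) M); [|apply Ha; lra|exact HM].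
  intros n. eapply Rle_trans; [right; apply Cmod_mult|]. rewrite Cmod_pow.
  apply Rmult_le_compat_l; [apply Cmod_ge_0|]. apply pow_incr. split; [apply Cmod_ge_0|lra].
Qed.

Lemma analytic_on_mult (r : R) (g h : C -> C) :
  0 < r -> analytic_on r g -> analytic_on r h -> analytic_on r (fun z => (g z * h z)%C).
Proof.
  intros Hr [a Ha] Hh. apply analytic_on_exhaust; [exact Hr|]. intros r' Hr'.
  destruct (analytic_on_bounded r r' h ltac:(lra) Hh) as [M HM].
  apply analytic_on_series with (fun n z => (a n * (z ^ n * h z))%C)
    (fun n => M * (Cmod (a n) * r' ^ n)); [lra| | | |].
  - intros n. apply analytic_on_le with r; [lra|].
    now apply analytic_on_scal, analytic_on_id_pow_mult.
  - intros n z Hz. rewrite !Cmod_mult, Cmod_pow.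
    assert (h1 : Cmod z ^ n <= r' ^ n) by (apply pow_incr; split; [apply Cmod_ge_0|lra]).
    rewrite (Rmult_comm M), Rmult_assoc. apply Rmult_le_compat_l; [apply Cmod_ge_0|].
    apply Rmult_le_compat; auto using Cmod_ge_0. apply pow_le, Cmod_ge_0.
  - exact (ex_series_scal M _ (power_series_on_ex_series r a g r' Ha ltac:(lra))).
  - intros z Hz. rewrite (Cmult_comm (g z)).
    eapply is_series_ext; [|apply is_cseries_scal, (Ha z ltac:(lra))].
    intros n. cbv beta. ring_C.
Qed.

Lemma analytic_on_pow (r : R) (h : C -> C) (n : nat) :
  0 < r -> analytic_on r h -> analytic_on r (fun z => (h z ^ n)%C).
Proof.
  intros Hr Hh. induction n as [|n IH]; [exact (analytic_on_const r 1)|].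
  apply analytic_on_ext with (fun z => (h z * h z ^ n)%C); [intros; now rewrite Cpow_S|].
  now apply analytic_on_mult.
Qed.

Lemma analytic_on_id (r : R) : analytic_on r (fun z => z).
Proof.
  apply analytic_on_ext with (fun z => (z ^ 1 * RtoC 1)%C); [intros z _; simpl; ring|].
  apply analytic_on_id_pow_mult, analytic_on_const.
Qed.

Lemma pow_half_mult_le (x y r : R) (i j : nat) : 0 <= x <= r / 2 -> 0 <= y <= r / 2 ->
  x ^ i * y ^ j <= r ^ (i + j) * (/ 2) ^ i * (/ 2) ^ j.
Proof.
  intros Hx Hy. rewrite pow_add.
  replace (r ^ i * r ^ j * (/ 2) ^ i * (/ 2) ^ j) with ((r / 2) ^ i * (r / 2) ^ j)
    by (unfold Rdiv; rewrite !Rpow_mult_distr; ring).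
  apply Rmult_le_compat; try (apply pow_le; lra); now apply pow_incr.
Qed.

Lemma ser2_term_le (M r : R) (c : nat -> nat -> C) (x y : C) (i j : nat) :
  Cmod (c i j) * r ^ (i + j) <= M -> Cmod x <= r / 2 -> Cmod y <= r / 2 ->
  Cmod (c i j * (x ^ i * y ^ j)) <= M * (/ 2) ^ i * (/ 2) ^ j.
Proof.
  intros HM Hx Hy. rewrite !Cmod_mult, !Cmod_pow.
  apply Rle_trans with (Cmod (c i j) * (r ^ (i + j) * (/ 2) ^ i * (/ 2) ^ j)).
  - apply Rmult_le_compat_l; [apply Cmod_ge_0|].
    apply pow_half_mult_le; auto using Cmod_ge_0.
  - rewrite <- !Rmult_assoc.
    apply Rmult_le_compat_r; [apply pow_le; lra|].
    apply Rmult_le_compat_r; [apply pow_le; lra|exact HM].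
Qed.

Lemma analytic_on_comp (r s : R) (c : nat -> nat -> C) (f : C2 -> C) (h1 h2 : C -> C) :
  ser2_rep r c f -> 0 < s -> analytic_on s h1 -> analytic_on s h2 ->
  (forall z, Cmod z < s -> Cmod (h1 z) <= r / 2 /\ Cmod (h2 z) <= r / 2) ->
  analytic_on s (fun z => f (h1 z, h2 z)).
Proof.
  intros [Hr [[M HM] Hf]] Hs H1 H2 Hb.
  destruct (guarded_choice (fun z => Cmod z < s) (fun z g =>
    (forall i, is_cseries (fun j => (c i j * (h1 z ^ i * h2 z ^ j))%C) (g i)) /\
    is_cseries g (f (h1 z, h2 z))) (fun _ => RtoC 0)) as [g Hg].
  { intros z Hz. apply Hf; (apply Rle_lt_trans with (r / 2); [now apply Hb|lra]). }
  assert (Hterm : forall i j z, Cmod z < s ->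
    Cmod (c i j * (h1 z ^ i * h2 z ^ j)) <= M * (/ 2) ^ i * (/ 2) ^ j).
  { intros i j z Hz. apply ser2_term_le with r; [apply HM|now apply Hb..]. }
  apply analytic_on_series with (fun i z => g z i) (fun i => 2 * M * (/ 2) ^ i); [exact Hs| | | |].
  - intros i. apply analytic_on_series with (fun j z => (c i j * (h1 z ^ i * h2 z ^ j))%C)
      (fun j => M * (/ 2) ^ i * (/ 2) ^ j);
        [exact Hs| |now apply Hterm| |intros z Hz; apply (Hg z Hz)].
    + intros j. apply analytic_on_scal, analytic_on_mult; auto using analytic_on_pow.
    + eexists. apply is_series_half.
  - intros i z Hz. rewrite Rmult_assoc.
    apply Cmod_is_cseries_half_le with (fun j => (c i j * (h1 z ^ i * h2 z ^ j))%C);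
      [|apply (Hg z Hz)].
    intros j. now apply Hterm.
  - eexists. apply is_series_half.
  - intros z Hz. apply (Hg z Hz).
Qed.

(** * The Hermitian plane *)

Definition add2 (p q : C2) : C2 := ((fst p + fst q)%C, (snd p + snd q)%C).

Definition scal2 (z : C) (p : C2) : C2 := ((z * fst p)%C, (z * snd p)%C).

Lemma norm2_ge_0 (p : C2) : 0 <= norm2 p.
Proof. apply sqrt_pos. Qed.

Lemma norm2_add_le (p q : C2) : norm2 (add2 p q) <= norm2 p + norm2 q.
Proof.
  exact (@norm_triangle C_AbsRing (prod_NormedModule C_AbsRing C_NormedModule C_NormedModule) p q).
Qed.

Lemma norm2_scal (z : C) (p : C2) : norm2 (scal2 z p) = Cmod z * norm2 p.
Proof.
  unfold norm2, scal2; cbn [fst snd]. rewrite !Cmod_mult.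
  rewrite <- (sqrt_pow2 (Cmod z)) at 3 by apply Cmod_ge_0.
  rewrite <- sqrt_mult_alt by apply pow2_ge_0. f_equal. ring.
Qed.

Lemma norm2_sub_sym (p q : C2) : norm2 (sub2 p q) = norm2 (sub2 q p).
Proof.
  unfold norm2, sub2; simpl. now rewrite (Cmod_minus_sym (fst p)), (Cmod_minus_sym (snd p)).
Qed.

Lemma norm2_triangle (p q s : C2) : norm2 (sub2 p s) <= norm2 (sub2 p q) + norm2 (sub2 q s).
Proof.
  replace (sub2 p s) with (add2 (sub2 p q) (sub2 q s)); [apply norm2_add_le|].
  unfold sub2, add2; simpl. f_equal; ring.
Qed.

Lemma sub2_zero_r (p : C2) : sub2 p zero2 = p.
Proof. destruct p as [x y]. unfold sub2, zero2; simpl. f_equal; ring. Qed.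

Lemma norm2_sub_ge (p q : C2) : norm2 p - norm2 q <= norm2 (sub2 p q).
Proof.
  assert (h := norm2_triangle p q zero2). rewrite !sub2_zero_r in h. lra.
Qed.

Lemma norm2_sub_le (p q : C2) : norm2 (sub2 p q) <= norm2 p + norm2 q.
Proof.
  assert (h := norm2_triangle p zero2 q).
  rewrite (norm2_sub_sym zero2), !sub2_zero_r in h. exact h.
Qed.

Lemma Cmod_fst_le (p : C2) : Cmod (fst p) <= norm2 p.
Proof. exact (norm_le_prod_norm_1 (U := C_NormedModule) (V := C_NormedModule) p). Qed.

Lemma Cmod_snd_le (p : C2) : Cmod (snd p) <= norm2 p.
Proof. exact (norm_le_prod_norm_2 (U := C_NormedModule) (V := C_NormedModule) p). Qed.

Lemma norm2_le_sum (p : C2) : norm2 p <= Cmod (fst p) + Cmod (snd p).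
Proof.
  assert (h1 := Cmod_ge_0 (fst p)). assert (h2 := Cmod_ge_0 (snd p)).
  unfold norm2. rewrite <- (sqrt_pow2 (Cmod (fst p) + Cmod (snd p))) by lra.
  apply sqrt_le_1_alt. nra.
Qed.

Lemma norm2_zero : norm2 zero2 = 0.
Proof.
  apply Rle_antisym; [|apply norm2_ge_0].
  eapply Rle_trans; [apply norm2_le_sum|]. simpl. rewrite Cmod_0. lra.
Qed.

Lemma norm2_sub_le_0 (p q : C2) : norm2 (sub2 p q) <= 0 -> p = q.
Proof.
  intros H. assert (hfst := Cmod_fst_le (sub2 p q)). assert (hsnd := Cmod_snd_le (sub2 p q)).
  destruct p as [x y], q as [x' y']. simpl in hfst, hsnd. f_equal; apply Ceq_minus, Cmod_le_0; lra.
Qed.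

Lemma sub2_diag (p : C2) : sub2 p p = zero2.
Proof. unfold sub2, zero2. f_equal; ring. Qed.

(** * Analytic functions of two variables *)

Lemma ser2_coef_bound_row (r M : R) (c : nat -> nat -> C) (i : nat) :
  0 < r -> (forall i j, Cmod (c i j) * r ^ (i + j) <= M) -> coef_bound (M / r ^ i) r (c i).
Proof.
  intros Hr HM j. assert (hi : 0 < r ^ i) by now apply pow_lt.
  apply Rmult_le_reg_r with (r ^ i); [exact hi|]. specialize (HM i j). rewrite pow_add in HM.
  replace (M / r ^ i * r ^ i) with M by (field; lra). lra.
Qed.

Lemma ser2_rep_rows (r : R) (c : nat -> nat -> C) (f : C2 -> C) : ser2_rep r c f ->
  exists b : nat -> C -> C, (forall i, power_series_on r (c i) (b i)) /\
    forall x y, Cmod x < r -> Cmod y < r -> ser1 (fun i => b i y) x (f (x, y)).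
Proof.
  intros [Hr [[M HM] Hf]].
  destruct (functional_choice (fun i => power_series_on r (c i))) as [b Hbs].
  { intros i. apply power_series_on_of_coef_bound with (M / r ^ i). now apply ser2_coef_bound_row. }
  exists b. split; [exact Hbs|]. intros x y Hx Hy.
  destruct (Hf x y Hx Hy) as [g [Hg Hl]].
  eapply is_series_ext; [|exact Hl]. intros i.
  apply (is_series_fun (V := C_NormedModule) (fun j => (c i j * (x ^ i * y ^ j))%C)); [apply Hg|].
  rewrite Cmult_comm. eapply is_series_ext; [|apply is_cseries_scal, (Hbs i y Hy)].
  intros j. cbv beta. ring_C.
Qed.

Lemma ser2_cauchy_estimate (r s M : R) (c : nat -> nat -> C) (f : C2 -> C) (i j : nat) :
  ser2_rep r c f -> 0 < s <= r ->
  (forall x y, Cmod x < s -> Cmod y < s -> Cmod (f (x, y)) <= M) -> Cmod (c i j) * s ^ (i + j) <= M.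
Proof.
  intros Hrep Hs HM. destruct (ser2_rep_rows r c f Hrep) as [b [Hb Hf]].
  assert (hi : 0 < s ^ i) by now apply pow_lt.
  assert (Hrow : forall y, Cmod y < s -> Cmod (b i y) <= M / s ^ i).
  { intros y Hy. apply Rmult_le_reg_r with (s ^ i); [exact hi|].
    replace (M / s ^ i * s ^ i) with M by (field; lra).
    apply (cauchy_estimate s (fun i => b i y) (fun x => f (x, y))); [|lra|auto].
    intros x Hx. apply Hf; lra. }
  assert (h : coef_bound (M / s ^ i) s (c i)).
  { apply (cauchy_estimate s (c i) (b i)); [|lra|exact Hrow]. intros y Hy. apply Hb. lra. }
  specialize (h j). rewrite pow_add.
  apply Rle_trans with (s ^ i * (Cmod (c i j) * s ^ j)); [right; ring|].
  apply Rle_trans with (s ^ i * (M / s ^ i)); [apply Rmult_le_compat_l; lra|right; field; lra].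
Qed.

Lemma power_series_on_0 (r : R) (a : nat -> C) (h : C -> C) :
  0 < r -> power_series_on r a h -> h (RtoC 0) = a 0%nat.
Proof.
  intros Hr Ha. assert (h0 : ser1 a (RtoC 0) (h (RtoC 0))) by (apply Ha; rewrite Cmod_0; exact Hr).
  apply (is_series_fun (V := C_NormedModule) _ _ _ h0).
  assert (E : (a 0%nat * 0 ^ 0)%C = a 0%nat) by (simpl; ring). rewrite <- E.
  apply (is_cseries_single (fun n => (a n * 0 ^ n)%C) 0). intros k Hk. rewrite Cpow_0_l by lia.
  ring.
Qed.

Lemma ser2_rep_0 (r : R) (c : nat -> nat -> C) (f : C2 -> C) :
  ser2_rep r c f -> f zero2 = c 0%nat 0%nat.
Proof.
  intros Hrep. assert (Hr : 0 < r) by apply Hrep.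
  destruct (ser2_rep_rows r c f Hrep) as [b [Hb Hf]].
  rewrite <- (power_series_on_0 r (c 0%nat) (b 0%nat) Hr (Hb 0%nat)).
  apply (power_series_on_0 r (fun i => b i (RtoC 0)) (fun x => f (x, RtoC 0)) Hr).
  intros x Hx. apply Hf; [exact Hx|rewrite Cmod_0; exact Hr].
Qed.

Lemma schwarz_bound (s M : R) (h : C -> C) (z : C) :
  0 < s -> analytic_on s h -> (forall z, Cmod z < s -> Cmod (h z) <= M) -> Cmod z <= s / 2 ->
  Cmod (h z - h (RtoC 0)) <= 2 * M / s * Cmod z.
Proof.
  intros Hs [a Ha] HM Hz. assert (Hc := cauchy_estimate s a h M Ha Hs HM).
  assert (Htaylor := ser1_taylor_le M s a z Hs Hc Hz 0 (h z) (Ha z ltac:(lra))).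
  rewrite sum_O, (pow_1 (Cmod z / s)) in Htaylor. rewrite (power_series_on_0 s a h Hs Ha).
  replace (a 0%nat * z ^ 0)%C with (a 0%nat) in Htaylor by (simpl; ring).
  eapply Rle_trans; [exact Htaylor|]. right. unfold Rdiv. ring.
Qed.

Lemma ser2_rep_row_bound (r M : R) (c : nat -> nat -> C) (b : nat -> C -> C) (y : C) :
  0 < r -> (forall i j, Cmod (c i j) * r ^ (i + j) <= M) ->
  (forall i, power_series_on r (c i) (b i)) -> Cmod y <= r / 2 ->
  coef_bound (2 * M) r (fun i => b i y).
Proof.
  intros Hr HM Hb Hy i.
  assert (h := ser1_vanishing_le _ r (c i) y Hr (ser2_coef_bound_row r M c i Hr HM) Hy 0 (b i y)).
  rewrite pow_O, Rmult_1_r in h. specialize (h ltac:(intros; lia) (Hb i y ltac:(lra))).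
  apply Rle_trans with (2 * (M / r ^ i) * r ^ i); [|right; field; apply pow_nonzero; lra].
  apply Rmult_le_compat_r; [apply pow_le; lra|exact h].
Qed.

Lemma ser2_taylor_le (r M : R) (c : nat -> nat -> C) (f : C2 -> C) (p : C2) :
  ser2_rep r c f -> (forall i j, Cmod (c i j) * r ^ (i + j) <= M) -> norm2 p <= r / 2 ->
  Cmod (f p - c 0%nat 0%nat - (c 1%nat 0%nat * fst p + c 0%nat 1%nat * snd p))
  <= 8 * M * (norm2 p / r) ^ 2.
Proof.
  intros Hrep HM Hp. assert (Hr : 0 < r) by apply Hrep.
  destruct (ser2_rep_rows r c f Hrep) as [b [Hb Hf]].
  assert (hx := Cmod_fst_le p). assert (hy := Cmod_snd_le p). destruct p as [x y].
  cbn [fst snd] in *.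
  assert (Hrow := fun i => ser2_coef_bound_row r M c i Hr HM).
  assert (Hby := ser2_rep_row_bound r M c b y Hr HM Hb ltac:(lra)).
  assert (Hfx := ser1_taylor_le _ r _ x Hr Hby ltac:(lra) 1 _ (Hf x y ltac:(lra) ltac:(lra))).
  assert (Hb0y := ser1_taylor_le _ r _ y Hr (Hrow 0%nat) ltac:(lra) 1 _ (Hb 0%nat y ltac:(lra))).
  assert (Hb1y := ser1_taylor_le _ r _ y Hr (Hrow 1%nat) ltac:(lra) 0 _ (Hb 1%nat y ltac:(lra))).
  rewrite sum_Sn, sum_O in Hfx, Hb0y. rewrite sum_O in Hb1y. change plus with Cplus in Hfx, Hb0y.
  rewrite !Cpow_1_r in Hfx, Hb0y. simpl (_ ^ 0)%C in Hfx, Hb0y, Hb1y.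
  rewrite !Cmult_1_r in Hfx, Hb0y, Hb1y.
  apply (Rmult_le_compat_r (Cmod x)) in Hb1y; [|apply Cmod_ge_0]. rewrite <- Cmod_mult in Hb1y.
  set (n := norm2 (x, y)) in *. set (t := n / r).
  assert (Hi := Rinv_0_lt_compat r Hr). assert (HM0 := coef_bound_ge0 _ _ _ (fun j => HM 0%nat j)).
  assert (hle : forall z, Cmod z <= n -> 0 <= Cmod z / r <= t).
  { intros z Hz. split; [apply Rmult_le_pos; [apply Cmod_ge_0|lra]|apply Rmult_le_compat_r; lra]. }
  destruct (hle x hx) as [HX0 HXt]. destruct (hle y hy) as [HY0 HYt].
  replace (f (x, y) - c 0%nat 0%nat - (c 1%nat 0%nat * x + c 0%nat 1%nat * y))%C with
    (f (x, y) - (b 0%nat y + b 1%nat y * x) + (b 0%nat y - (c 0%nat 0%nat + c 0%nat 1%nat * y))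
     + (b 1%nat y - c 1%nat 0%nat) * x)%C by ring.
  eapply Rle_trans; [apply Cmod_triangle|].
  eapply Rle_trans; [apply Rplus_le_compat_r, Cmod_triangle|].
  replace (2 * (M / r ^ 1) * (Cmod y / r) ^ 1 * Cmod x)
    with (2 * M * (Cmod y / r * (Cmod x / r))) in Hb1y by (simpl; field; lra).
  replace (2 * (M / r ^ 0) * (Cmod y / r) ^ 2) with (2 * M * (Cmod y / r) ^ 2) in Hb0y
    by (simpl; field; lra).
  assert (hxx : M * (Cmod x / r) ^ 2 <= M * t ^ 2)
    by (apply Rmult_le_compat_l; [|apply pow_incr]; lra).
  assert (hyy : M * (Cmod y / r) ^ 2 <= M * t ^ 2)
    by (apply Rmult_le_compat_l; [|apply pow_incr]; lra).
  assert (hyx : M * (Cmod y / r * (Cmod x / r)) <= M * t ^ 2).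
  { apply Rmult_le_compat_l; [lra|]. simpl. rewrite Rmult_1_r. now apply Rmult_le_compat. }
  lra.
Qed.

Definition analytic_on_lines (rho : R) (g : C2 -> C) : Prop :=
  forall (s : R) (p v : C2), 0 < s ->
    (forall z, Cmod z < s -> norm2 (add2 p (scal2 z v)) <= rho) ->
    analytic_on s (fun z => g (add2 p (scal2 z v))).

Lemma analytic_on_affine (s : R) (x y : C) : analytic_on s (fun z => (x + z * y)%C).
Proof.
  apply analytic_on_plus; [apply analytic_on_const|].
  apply analytic_on_ext with (fun z => (y * z)%C); [intros; ring|].
  apply analytic_on_scal, analytic_on_id.
Qed.

Lemma ser2_rep_analytic_on_lines (r : R) (c : nat -> nat -> C) (f : C2 -> C) :
  ser2_rep r c f -> analytic_on_lines (r / 2) f.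
Proof.
  intros Hrep s p v Hs Hb.
  apply (analytic_on_comp r s c f _ _ Hrep Hs
    (analytic_on_affine s (fst p) (fst v)) (analytic_on_affine s (snd p) (snd v))).
  intros z Hz. specialize (Hb z Hz). split; (eapply Rle_trans; [|exact Hb]).
  - apply (Cmod_fst_le (add2 p (scal2 z v))).
  - apply (Cmod_snd_le (add2 p (scal2 z v))).
Qed.

Lemma lipschitz_of_bound (g : C2 -> C) (rho X M : R) (p q : C2) :
  analytic_on_lines rho g -> 5 * X <= rho ->
  (forall w, norm2 w <= 5 * X -> Cmod (g w) <= M) -> norm2 p <= X -> norm2 q <= X ->
  Cmod (g p - g q) <= M / (2 * X) * norm2 (sub2 p q).
Proof.
  intros Hg Hrho HM Hp Hq. set (v := sub2 p q). assert (hv := norm2_ge_0 v).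
  destruct (Req_dec (norm2 v) 0) as [E|E].
  { rewrite (norm2_sub_le_0 p q) by (fold v; lra). unfold Cminus. rewrite Cplus_opp_r, Cmod_0, E.
    lra. }
  assert (Hv2 : norm2 v <= 2 * X) by (assert (h := norm2_sub_le p q); fold v in h; lra).
  set (s := 4 * X / norm2 v).
  assert (Es : s * norm2 v = 4 * X) by (unfold s; field; lra).
  assert (Hs : 2 <= s) by (apply Rmult_le_reg_r with (norm2 v); lra).
  assert (Hline : forall z, Cmod z < s -> norm2 (add2 q (scal2 z v)) <= 5 * X).
  { intros z Hz. eapply Rle_trans; [apply norm2_add_le|]. rewrite norm2_scal.
    assert (h : Cmod z * norm2 v <= s * norm2 v) by (apply Rmult_le_compat_r; lra). lra. }
  assert (h := schwarz_bound s M (fun z => g (add2 q (scal2 z v))) (RtoC 1) ltac:(lra)).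
  rewrite Cmod_1 in h. cbv beta in h.
  replace (add2 q (scal2 1 v)) with p in h
    by (destruct p, q; unfold v, add2, scal2, sub2; simpl; f_equal; ring).
  replace (add2 q (scal2 0 v)) with q in h
    by (destruct q; unfold add2, scal2; simpl; f_equal; ring).
  eapply Rle_trans; [apply h; [|auto|lra]|].
  - apply Hg; [lra|]. intros z Hz. eapply Rle_trans; [now apply Hline|exact Hrho].
  - right. replace (2 * M / s * 1) with (2 * M * (norm2 v / (s * norm2 v))) by (field; lra).
    rewrite Es. field. lra.
Qed.

Definition strict_diff0 (f : C2 -> C) (a b : C) : Prop :=
  forall eps, 0 < eps -> exists delta, 0 < delta /\ forall p q,
    norm2 p < delta -> norm2 q < delta ->
    Cmod (f p - f q - (a * (fst p - fst q) + b * (snd p - snd q))) <= eps * norm2 (sub2 p q).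

(* Subtracting the linear part leaves a function that is O(X^2) on the ball of radius [5 * X],
   hence O(X)-Lipschitz on the ball of radius [X]. *)
Lemma ser2_rep_strict_diff0 (r : R) (c : nat -> nat -> C) (f : C2 -> C) :
  ser2_rep r c f -> strict_diff0 f (c 1%nat 0%nat) (c 0%nat 1%nat).
Proof.
  intros Hrep eps Heps. assert (Hr : 0 < r) by apply Hrep.
  destruct (proj1 (proj2 Hrep)) as [M HM].
  assert (HM0 := coef_bound_ge0 _ _ _ (fun j => HM 0%nat j)).
  set (g := fun p => (f p - c 0%nat 0%nat - (c 1%nat 0%nat * fst p + c 0%nat 1%nat * snd p))%C).
  assert (Hg : analytic_on_lines (r / 2) g).
  { intros s p v Hs Hb. apply analytic_on_minus; [apply analytic_on_minus|].
    - now apply (ser2_rep_analytic_on_lines r c f Hrep).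
    - apply analytic_on_const.
    - apply analytic_on_plus; apply analytic_on_scal, analytic_on_affine. }
  assert (Hr2 : 0 < r ^ 2) by now apply pow_lt.
  set (Y := eps * r ^ 2 / (100 * (M + 1))).
  assert (HY : 0 < Y) by (apply Rdiv_lt_0_compat; [now apply Rmult_lt_0_compat|lra]).
  destruct (pos_lower_bound2 (r / 10) Y ltac:(lra) HY) as [X [HX [HXr HXY]]].
  exists X. split; [exact HX|]. intros p q Hp Hq.
  replace (f p - f q - (c 1%nat 0%nat * (fst p - fst q) + c 0%nat 1%nat * (snd p - snd q)))%C
    with (g p - g q)%C by (unfold g; ring).
  eapply Rle_trans; [apply (lipschitz_of_bound g (r / 2) X (8 * M * (5 * X / r) ^ 2)); try lra;
    [exact Hg|]|].
  - intros w Hw. eapply Rle_trans; [apply (ser2_taylor_le r M c f w Hrep HM); lra|].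
    apply Rmult_le_compat_l; [lra|]. assert (hi := Rinv_0_lt_compat r Hr). apply pow_incr. split.
    + apply Rmult_le_pos; [apply norm2_ge_0|lra].
    + apply Rmult_le_compat_r; lra.
  - apply Rmult_le_compat_r; [apply norm2_ge_0|].
    replace (8 * M * (5 * X / r) ^ 2 / (2 * X)) with (100 * M * X / r ^ 2) by (field; lra).
    apply Rmult_le_reg_r with (r ^ 2); [exact Hr2|].
    replace (100 * M * X / r ^ 2 * r ^ 2) with (100 * M * X) by (field; lra).
    apply Rle_trans with (100 * (M + 1) * Y); [|right; unfold Y; field; lra].
    apply Rmult_le_compat; lra.
Qed.

(** * The local inverse of a chart *)

Definition contracts (rho : R) (T : C2 -> C2) : Prop :=
  norm2 (T zero2) <= rho / 2 /\
  forall p q, norm2 p <= rho -> norm2 q <= rho ->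
    norm2 (sub2 (T p) (T q)) <= / 2 * norm2 (sub2 p q).

Definition picard (T : C2 -> C2) (n : nat) : C2 := Nat.iter n T zero2.

Section Contraction.
Context (rho : R) (T : C2 -> C2).
Hypothesis Hrho : 0 < rho.
Hypothesis HT : contracts rho T.

Lemma picard_bound (n : nat) :
  norm2 (picard T n) <= rho * (1 - (/ 2) ^ n) /\
  norm2 (sub2 (picard T (S n)) (picard T n)) <= rho / 2 * (/ 2) ^ n.
Proof.
  destruct HT as [H0 H]. induction n as [|n [IH1 IH2]].
  - change (picard T 1) with (T zero2). change (picard T 0) with zero2.
    rewrite sub2_zero_r, norm2_zero. simpl. lra.
  - assert (hp : 0 < (/ 2) ^ n) by (apply pow_lt; lra).
    assert (h : norm2 (picard T (S n)) <= rho * (1 - (/ 2) ^ S n)).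
    { assert (h := norm2_sub_ge (picard T (S n)) (picard T n)). simpl pow. nra. }
    split; [exact h|].
    change (picard T (S (S n))) with (T (picard T (S n))).
    change (picard T (S n)) with (T (picard T n)) at 2.
    simpl pow in *. eapply Rle_trans; [apply H; nra|]. nra.
Qed.

Lemma picard_le (n : nat) : norm2 (picard T n) <= rho.
Proof.
  destruct (picard_bound n) as [h _]. assert (hp : 0 < (/ 2) ^ n) by (apply pow_lt; lra). nra.
Qed.

Lemma picard_component_converges (pr : C2 -> C) :
  (forall p, Cmod (pr p) <= norm2 p) -> (forall p q, pr (sub2 p q) = (pr p - pr q)%C) ->
  exists l, is_cseries (fun n => (pr (picard T (S n)) - pr (picard T n))%C) l /\
    forall n, Cmod (l - pr (picard T (S n))) <= rho * (/ 2) ^ S n.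
Proof.
  intros Hpr Hsub.
  assert (Hb : forall n, Cmod (pr (picard T (S n)) - pr (picard T n)) <= rho / 2 * (/ 2) ^ n).
  { intros n. rewrite <- Hsub. eapply Rle_trans; [apply Hpr|apply picard_bound]. }
  assert (Hp0 : pr zero2 = RtoC 0)
    by (rewrite <- (sub2_diag zero2), Hsub; unfold Cminus; apply Cplus_opp_r).
  destruct (ex_series_le (V := C_CompleteNormedModule) _ _ Hb) as [l Hl].
  { eexists. apply is_series_half. }
  exists l. split; [exact Hl|]. intros n.
  assert (h := norm_series_tail_le (V := C_NormedModule) _ _ l _ n Hb Hl (is_series_half _)).
  change minus with Cminus in h. rewrite (sum_n_telescope (fun n => pr (picard T n))) in h.
  cbv beta in h. change (picard T 0) with zero2 in h. rewrite Hp0 in h.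
  replace (pr (picard T (S n)) - 0)%C with (pr (picard T (S n))) in h by ring.
  eapply Rle_trans; [exact h|].
  assert (E : forall n, sum_n (fun k => rho / 2 * (/ 2) ^ k) n = rho * (1 - (/ 2) ^ S n)).
  { clear. induction n as [|n IH]; [rewrite sum_O; simpl; field|].
    rewrite sum_Sn, IH. unfold plus; simpl. field. }
  rewrite E. lra.
Qed.

Lemma contraction_fixpoint : exists g : C2,
  is_cseries (fun n => (fst (picard T (S n)) - fst (picard T n))%C) (fst g) /\
  is_cseries (fun n => (snd (picard T (S n)) - snd (picard T n))%C) (snd g) /\
  norm2 g <= rho /\ T g = g.
Proof.
  destruct (picard_component_converges fst Cmod_fst_le (fun _ _ => eq_refl)) as [g1 [Hg1 L1]].
  destruct (picard_component_converges snd Cmod_snd_le (fun _ _ => eq_refl)) as [g2 [Hg2 L2]].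
  exists (g1, g2). split; [exact Hg1|]. split; [exact Hg2|]. set (g := (g1, g2) : C2).
  assert (L : forall n, norm2 (sub2 g (picard T (S n))) <= 2 * rho * (/ 2) ^ S n).
  { intros n. eapply Rle_trans; [apply norm2_le_sum|]. specialize (L1 n). specialize (L2 n).
    simpl in *. lra. }
  assert (Hsmall : forall K x, (forall n, x <= K * (/ 2) ^ n) -> x <= 0).
  { intros K x Hx. apply (is_lim_seq_le (fun _ => x) (fun n => K * (/ 2) ^ n) x 0 Hx).
    - apply is_lim_seq_const.
    - replace (Finite 0) with (Rbar_mult K 0) by (simpl; f_equal; ring).
      apply is_lim_seq_scal_l, is_lim_seq_geom. rewrite Rabs_pos_eq; lra. }
  assert (Hg : norm2 g <= rho).
  { assert (h : norm2 g - rho <= 0); [|lra]. apply (Hsmall rho). intros n.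
    assert (Htri := norm2_sub_ge g (picard T (S n))). assert (Hbound := picard_le (S n)).
    specialize (L n).
    rewrite <- tech_pow_Rmult in L. lra. }
  split; [exact Hg|]. apply norm2_sub_le_0, (Hsmall rho). intros n.
  eapply Rle_trans; [apply (norm2_triangle _ (picard T (S (S n))))|].
  destruct HT as [_ H]. assert (Hstep := H g (picard T (S n)) Hg (picard_le (S n))).
  change (T (picard T (S n))) with (picard T (S (S n))) in Hstep.
  assert (Ln := L n). assert (LSn := L (S n)). rewrite norm2_sub_sym in LSn.
  rewrite <- !tech_pow_Rmult in *. lra.
Qed.
End Contraction.

Definition analytic2_on (s : R) (h : C -> C2) : Prop :=
  analytic_on s (fun v => fst (h v)) /\ analytic_on s (fun v => snd (h v)).

Lemma analytic_fixpoint (s rho : R) (T : C -> C2 -> C2) :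
  0 < s -> 0 < rho -> (forall v, Cmod v < s -> contracts rho (T v)) ->
  (forall h, analytic2_on s h -> (forall v, Cmod v < s -> norm2 (h v) <= rho) ->
     analytic2_on s (fun v => T v (h v))) ->
  exists g, analytic2_on s g /\ forall v, Cmod v < s -> norm2 (g v) <= rho /\ T v (g v) = g v.
Proof.
  intros Hs Hrho HT Han.
  destruct (guarded_choice (fun v => Cmod v < s) (fun v (g : C2) =>
    is_cseries (fun n => (fst (picard (T v) (S n)) - fst (picard (T v) n))%C) (fst g) /\
    is_cseries (fun n => (snd (picard (T v) (S n)) - snd (picard (T v) n))%C) (snd g) /\
    norm2 g <= rho /\ T v g = g) zero2) as [g Hg].
  { intros v Hv. exact (contraction_fixpoint rho (T v) Hrho (HT v Hv)). }
  exists g.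
  assert (Hz : forall n, analytic2_on s (fun v => picard (T v) n)).
  { induction n as [|n IH].
    - split; exact (analytic_on_const s 0).
    - apply (Han (fun v => picard (T v) n) IH). intros v Hv. now apply picard_le, HT. }
  assert (Hb : forall n v, Cmod v < s ->
    norm2 (sub2 (picard (T v) (S n)) (picard (T v) n)) <= rho / 2 * (/ 2) ^ n).
  { intros n v Hv. now apply picard_bound, HT. }
  split; [|intros v Hv; apply (Hg v Hv)].
  split; [apply analytic_on_series
    with (fun n v => (fst (picard (T v) (S n)) - fst (picard (T v) n))%C)
      (fun n => rho / 2 * (/ 2) ^ n)
    |apply analytic_on_series with (fun n v => (snd (picard (T v) (S n)) - snd (picard (T v) n))%C)
      (fun n => rho / 2 * (/ 2) ^ n)]; try exact Hs; try (eexists; apply is_series_half);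
    try (intros v Hv; apply (Hg v Hv)).
  - intros n. apply analytic_on_minus; apply Hz.
  - intros n v Hv. eapply Rle_trans; [apply (Cmod_fst_le (sub2 _ _))|now apply Hb].
  - intros n. apply analytic_on_minus; apply Hz.
  - intros n v Hv. eapply Rle_trans; [apply (Cmod_snd_le (sub2 _ _))|now apply Hb].
Qed.

Definition preserves_analytic (rho : R) (F : C2 -> C2) : Prop :=
  forall s h, 0 < s -> analytic2_on s h -> (forall v, Cmod v < s -> norm2 (h v) <= rho) ->
    analytic2_on s (fun v => F (h v)).

Definition tangent_to_id (F : C2 -> C2) : Prop :=
  forall eps, 0 < eps -> exists delta, 0 < delta /\ forall p q,
    norm2 p < delta -> norm2 q < delta ->
    norm2 (sub2 (sub2 p q) (sub2 (F p) (F q))) <= eps * norm2 (sub2 p q).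

Definition bounded_linear (K : R) (J : C2 -> C2) : Prop :=
  (forall p q, J (sub2 p q) = sub2 (J p) (J q)) /\
  (forall z p, J (scal2 z p) = scal2 z (J p)) /\
  (forall p, norm2 (J p) <= K * norm2 p).

(* [J] is the inverse of the differential of the chart [Phi] at the origin. *)
Definition chart_linearization (rho K : R) (Phi J : C2 -> C2) : Prop :=
  0 < rho /\ 1 <= K /\ bounded_linear K J /\ (forall p, norm2 p <= K * norm2 (J p)) /\
  Phi zero2 = zero2 /\ tangent_to_id (fun p => J (Phi p)) /\
  preserves_analytic rho Phi /\ forall s h, analytic2_on s h -> analytic2_on s (fun v => J (h v)).

Definition lin2 (a b c d : C) (p : C2) : C2 :=
  ((a * fst p + b * snd p)%C, (c * fst p + d * snd p)%C).

Lemma norm2_lin2_le (a b c d : C) (p : C2) :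
  norm2 (lin2 a b c d p) <= (Cmod a + Cmod b + Cmod c + Cmod d) * norm2 p.
Proof.
  assert (hfst := Cmod_fst_le p). assert (hsnd := Cmod_snd_le p).
  assert (hm : forall x y, Cmod y <= norm2 p -> Cmod (x * y) <= Cmod x * norm2 p).
  { intros x y Hy. rewrite Cmod_mult. apply Rmult_le_compat_l; [apply Cmod_ge_0|exact Hy]. }
  eapply Rle_trans; [apply norm2_le_sum|]. unfold lin2; cbn [fst snd].
  eapply Rle_trans; [apply Rplus_le_compat; apply Cmod_triangle|].
  assert (ha := hm a _ hfst). assert (hb := hm b _ hsnd).
  assert (hc := hm c _ hfst). assert (hd := hm d _ hsnd). lra.
Qed.

Lemma bounded_linear_lin2 (K : R) (a b c d : C) :
  Cmod a + Cmod b + Cmod c + Cmod d <= K -> bounded_linear K (lin2 a b c d).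
Proof.
  intros HK. split; [|split].
  - intros p q. unfold lin2, sub2; simpl. f_equal; ring.
  - intros z p. unfold lin2, scal2; simpl. f_equal; ring.
  - intros p. eapply Rle_trans; [apply norm2_lin2_le|].
    apply Rmult_le_compat_r; [apply norm2_ge_0|exact HK].
Qed.

Lemma analytic2_on_sub (s : R) (g h : C -> C2) :
  analytic2_on s g -> analytic2_on s h -> analytic2_on s (fun v => sub2 (g v) (h v)).
Proof. intros [G1 G2] [H1 H2]. split; now apply analytic_on_minus. Qed.

Lemma analytic2_on_lin2 (s : R) (a b c d : C) (h : C -> C2) :
  analytic2_on s h -> analytic2_on s (fun v => lin2 a b c d (h v)).
Proof.
  intros [H1 H2]. split; cbn [lin2 fst snd]; apply analytic_on_plus; now apply analytic_on_scal.
Qed.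

Lemma tangent_to_id_of_strict_diff0 (F J : C2 -> C2) (K : R) (a b c d : C) :
  0 < K -> bounded_linear K J -> (forall p, J (lin2 a b c d p) = p) ->
  strict_diff0 (fun p => fst (F p)) a b -> strict_diff0 (fun p => snd (F p)) c d ->
  tangent_to_id (fun p => J (F p)).
Proof.
  intros HK [Jsub [_ Jle]] JL H1 H2 eps Heps.
  destruct (H1 (eps / (2 * K))) as [d1 [Hd1 E1]]; [apply Rdiv_lt_0_compat; lra|].
  destruct (H2 (eps / (2 * K))) as [d2 [Hd2 E2]]; [apply Rdiv_lt_0_compat; lra|].
  destruct (pos_lower_bound2 d1 d2 Hd1 Hd2) as [delta [Hdelta [Hdelta1 Hdelta2]]].
  exists delta. split; [exact Hdelta|]. intros p q Hp Hq.
  specialize (E1 p q ltac:(lra) ltac:(lra)). specialize (E2 p q ltac:(lra) ltac:(lra)).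
  rewrite norm2_sub_sym, <- (JL (sub2 p q)), <- !Jsub at 1.
  eapply Rle_trans; [apply Jle|].
  apply Rle_trans with (K * (2 * (eps / (2 * K) * norm2 (sub2 p q)))); [|right; field; lra].
  apply Rmult_le_compat_l; [lra|]. eapply Rle_trans; [apply norm2_le_sum|].
  unfold lin2, sub2 in *. cbn [fst snd] in *. lra.
Qed.

Lemma ser2_rep_preserves_analytic (r : R) (c1 c2 : nat -> nat -> C) (F : C2 -> C2) :
  ser2_rep r c1 (fun p => fst (F p)) -> ser2_rep r c2 (fun p => snd (F p)) ->
  preserves_analytic (r / 2) F.
Proof.
  intros H1 H2 s h Hs [A1 A2] Hb.
  assert (Hb' : forall z, Cmod z < s -> Cmod (fst (h z)) <= r / 2 /\ Cmod (snd (h z)) <= r / 2).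
  { intros z Hz. specialize (Hb z Hz).
    assert (i1 := Cmod_fst_le (h z)). assert (i2 := Cmod_snd_le (h z)). lra. }
  split.
  - apply analytic_on_ext with (2 := analytic_on_comp r s _ _ _ _ H1 Hs A1 A2 Hb').
    intros z _. cbv beta. now destruct (h z).
  - apply analytic_on_ext with (2 := analytic_on_comp r s _ _ _ _ H2 Hs A1 A2 Hb').
    intros z _. cbv beta. now destruct (h z).
Qed.

Lemma local_coords_linearization (Phi : C2 -> C2) :
  local_coords Phi -> exists rho K J, chart_linearization rho K Phi J.
Proof.
  intros [r [c1 [c2 [H1 [H2 [H10 [H20 Hdet]]]]]]].
  set (a := c1 1%nat 0%nat) in *. set (b := c1 0%nat 1%nat) in *.
  set (c := c2 1%nat 0%nat) in *. set (d := c2 0%nat 1%nat) in *. set (D := (a * d - b * c)%C) in *.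
  set (J := lin2 (d / D) (- b / D) (- c / D) (a / D)).
  set (K := 1 + (Cmod a + Cmod b + Cmod c + Cmod d)
              + (Cmod (d / D) + Cmod (- b / D) + Cmod (- c / D) + Cmod (a / D))).
  assert (HK : Cmod a + Cmod b + Cmod c + Cmod d <= K /\ 1 <= K /\
    Cmod (d / D) + Cmod (- b / D) + Cmod (- c / D) + Cmod (a / D) <= K).
  { assert (Hsum : forall x y z t, 0 <= Cmod x + Cmod y + Cmod z + Cmod t).
    { intros x y z t. repeat apply Rplus_le_le_0_compat; apply Cmod_ge_0. }
    assert (HL0 := Hsum a b c d). assert (HJ0 := Hsum (d / D)%C (- b / D)%C (- c / D)%C (a / D)%C).
    unfold K. lra. }
  destruct HK as [HKL [HK HKJ]].
  assert (JL : forall p, J (lin2 a b c d p) = p).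
  { intros [x y]. unfold J, lin2; cbn [fst snd]. f_equal; unfold D; field; exact Hdet. }
  assert (LJ : forall p, lin2 a b c d (J p) = p).
  { intros [x y]. unfold J, lin2; cbn [fst snd]. f_equal; unfold D; field; exact Hdet. }
  assert (HJ : bounded_linear K J) by now apply bounded_linear_lin2.
  exists (r / 2), K, J. assert (Hr : 0 < r) by apply H1.
  split; [lra|]. split; [exact HK|]. split; [exact HJ|]. split; [|split; [|split; [|split]]].
  - intros p. rewrite <- (LJ p) at 1. now apply bounded_linear_lin2.
  - assert (E1 := ser2_rep_0 _ _ _ H1). assert (E2 := ser2_rep_0 _ _ _ H2). cbv beta in E1, E2.
    destruct (Phi zero2) as [x y]. cbn [fst snd] in E1, E2. unfold zero2. congruence.
  - apply (tangent_to_id_of_strict_diff0 Phi J K a b c d); try assumption; [lra| |];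
      now apply ser2_rep_strict_diff0 with r.
  - now apply ser2_rep_preserves_analytic with c1 c2.
  - intros s h Hh. now apply analytic2_on_lin2.
Qed.

Lemma sub2_eq_self (p q : C2) : sub2 p q = p -> q = zero2.
Proof.
  intros E. transitivity (sub2 p (sub2 p q)); [|now rewrite E, sub2_diag].
  destruct p, q. unfold sub2; simpl. f_equal; ring.
Qed.

Definition bilipschitz_on (eta K : R) (Phi : C2 -> C2) : Prop :=
  forall p q, norm2 p <= eta -> norm2 q <= eta ->
    norm2 (sub2 p q) <= K * norm2 (sub2 (Phi p) (Phi q)) /\
    norm2 (sub2 (Phi p) (Phi q)) <= K * norm2 (sub2 p q).

Lemma bilipschitz_on_le (eta eta' K : R) (Phi : C2 -> C2) :
  eta' <= eta -> bilipschitz_on eta K Phi -> bilipschitz_on eta' K Phi.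
Proof. intros Heta H p q Hp Hq. apply H; lra. Qed.

Lemma bilipschitz_norm (eta K : R) (Phi : C2 -> C2) (p : C2) :
  bilipschitz_on eta K Phi -> Phi zero2 = zero2 -> norm2 p <= eta ->
  norm2 p <= K * norm2 (Phi p) /\ norm2 (Phi p) <= K * norm2 p.
Proof.
  intros H H0 Hp. assert (h0 : norm2 zero2 <= eta).
  { rewrite norm2_zero. exact (Rle_trans _ _ _ (norm2_ge_0 p) Hp). }
  assert (h := H p zero2 Hp h0). now rewrite H0, !sub2_zero_r in h.
Qed.

Section LocalInverse.
Context (rho K : R) (Phi J : C2 -> C2).
Hypothesis HPhi : chart_linearization rho K Phi J.

Lemma chart_bilipschitz : exists eta, 0 < eta /\ bilipschitz_on eta (2 * K) Phi.
Proof.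
  destruct HPhi as [_ [HK [[Jsub [_ Jle]] [Jge [_ [Htan _]]]]]].
  destruct (Htan (/ 2) ltac:(lra)) as [delta [Hdelta H]]. exists (delta / 2). split; [lra|].
  intros p q Hp Hq. specialize (H p q ltac:(lra) ltac:(lra)). rewrite <- Jsub in H.
  assert (HJle := Jle (sub2 (Phi p) (Phi q))). assert (HJge := Jge (sub2 (Phi p) (Phi q))).
  set (N := norm2 (J (sub2 (Phi p) (Phi q)))) in *.
  assert (Hdp := norm2_sub_ge (sub2 p q) (J (sub2 (Phi p) (Phi q)))).
  assert (HdJ := norm2_sub_ge (J (sub2 (Phi p) (Phi q))) (sub2 p q)).
  rewrite (norm2_sub_sym (J _)) in HdJ. fold N in Hdp, HdJ. split; [lra|].
  eapply Rle_trans; [exact HJge|]. rewrite (Rmult_comm 2), Rmult_assoc.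
  apply Rmult_le_compat_l; lra.
Qed.

(* The Newton-like map whose fixed point is the preimage of [w]. *)
Definition newton_step (w p : C2) : C2 := sub2 p (J (sub2 (Phi p) w)).

Lemma newton_step_contracts (eta : R) : 0 < eta -> exists R0, 0 < R0 <= eta /\ R0 <= rho /\
  forall w, norm2 w <= R0 / (2 * K) -> contracts R0 (newton_step w).
Proof.
  intros Heta. destruct HPhi as [Hrho [HK [[Jsub [_ Jle]] [_ [Phi0 [Htan _]]]]]].
  destruct (Htan (/ 2) ltac:(lra)) as [delta [Hdelta H]].
  destruct (pos_lower_bound3 eta rho (delta / 2) Heta Hrho ltac:(lra))
    as [R0 [HR0 [Heta0 [Hrho0 Hdelta0]]]].
  exists R0. split; [lra|]. split; [lra|]. intros w Hw. split.
  - replace (newton_step w zero2) with (J w).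
    + eapply Rle_trans; [apply Jle|].
      apply Rle_trans with (K * (R0 / (2 * K))); [apply Rmult_le_compat_l; lra|right; field; lra].
    + unfold newton_step. rewrite Phi0, Jsub. rewrite <- (sub2_diag zero2) at 2.
      rewrite Jsub, sub2_diag. destruct (J w). unfold sub2, zero2; simpl. f_equal; ring.
  - intros p q Hp Hq. eapply Rle_trans; [|apply H; lra]. right. f_equal. unfold newton_step.
    rewrite !Jsub. destruct (J (Phi p)), (J (Phi q)), (J w). unfold sub2; simpl. f_equal; ring.
Qed.

Lemma local_inverse (eta : R) : 0 < eta -> exists s (G : C2 -> C2), 0 < s /\
  (forall u v, Cmod u < s -> Cmod v < s -> norm2 (G (u, v)) <= eta /\ Phi (G (u, v)) = (u, v)) /\
  (forall u, Cmod u < s -> analytic2_on s (fun v => G (u, v))).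
Proof.
  intros Heta. destruct (newton_step_contracts eta Heta) as [R0 [HR0 [HR0' HT]]].
  destruct HPhi as [_ [HK [_ [Jge [_ [_ [HanP HanJ]]]]]]].
  set (s := R0 / (4 * K)). assert (Hs : 0 < s) by (apply Rdiv_lt_0_compat; lra).
  assert (Hw : forall u v, Cmod u < s -> Cmod v < s -> contracts R0 (newton_step (u, v))).
  { intros u v Hu Hv. apply HT. eapply Rle_trans; [apply norm2_le_sum|]. cbn [fst snd].
    replace (R0 / (2 * K)) with (2 * s) by (unfold s; field; lra). lra. }
  destruct (guarded_choice (fun u => Cmod u < s) (fun u g => analytic2_on s g /\
    forall v, Cmod v < s -> norm2 (g v) <= R0 /\ newton_step (u, v) (g v) = g v) (fun _ => zero2))
      as [g HG].
  { intros u Hu.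
    apply (analytic_fixpoint s R0 (fun v => newton_step (u, v)) Hs (proj1 HR0)
      (fun v => Hw u v Hu)).
    intros h Hh Hb. apply analytic2_on_sub; [exact Hh|]. apply HanJ, analytic2_on_sub.
    - apply HanP; [exact Hs|exact Hh|]. intros v Hv. specialize (Hb v Hv). lra.
    - split; [exact (analytic_on_const s u)|exact (analytic_on_id s)]. }
  exists s, (fun w => g (fst w) (snd w)).
  split; [exact Hs|]. split; [|intros u Hu; apply (HG u Hu)].
  intros u v Hu Hv. destruct (HG u Hu) as [_ Hfix]. destruct (Hfix v Hv) as [h1 h2].
  cbn [fst snd]. split; [lra|].
  apply norm2_sub_le_0. eapply Rle_trans; [apply Jge|].
  rewrite (sub2_eq_self _ _ h2), norm2_zero. lra.
Qed.
End LocalInverse.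

(** * Factoring out zeros *)

(* The quotient of [h] by [v - z] is computed by Horner's scheme. *)
Lemma horner_tails (M r : R) (c : nat -> C) (z : C) :
  0 < r -> coef_bound M r c -> Cmod z <= r / 2 ->
  exists s : nat -> C, (forall k, ser1 (fun n => c (k + n)%nat) z (s k)) /\
    (forall k, Cmod (s k) <= 2 * M / r ^ k) /\ (forall k, s k = (c k + z * s (S k))%C).
Proof.
  intros Hr Hc Hz.
  assert (Hck : forall k, coef_bound (M / r ^ k) r (fun n => c (k + n)%nat)).
  { intros k n. assert (hk : 0 < r ^ k) by now apply pow_lt.
    apply Rmult_le_reg_r with (r ^ k); [exact hk|].
    replace (M / r ^ k * r ^ k) with M by (field; lra).
    rewrite Rmult_assoc, <- pow_add, Nat.add_comm. apply Hc. }
  destruct (functional_choice _ (fun k => ser1_exists _ r _ z (Hck k) ltac:(lra))) as [s Hs].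
  exists s. split; [exact Hs|]. split.
  - intros k. assert (h := ser1_vanishing_le _ r _ z Hr (Hck k) Hz 0 (s k) ltac:(intros; lia)
      (Hs k)).
    rewrite pow_O in h. unfold Rdiv in *. lra.
  - intros k. apply (is_series_fun (V := C_NormedModule) (fun n => (c (k + n)%nat * z ^ n)%C));
      [apply Hs|].
    apply (is_series_decr_1 (V := C_NormedModule) (fun n => (c (k + n)%nat * z ^ n)%C)).
    rewrite Nat.add_0_r. change plus with Cplus. change opp with Copp.
    replace (c k + z * s (S k) + - (c k * z ^ 0))%C with (z * s (S k))%C by (simpl; ring).
    eapply is_series_ext; [|apply is_cseries_scal, (Hs (S k))].
    intros n. cbv beta. rewrite Cpow_S. replace (S k + n)%nat with (k + S n)%nat by lia. ring_C.
Qed.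

Lemma factor_zero (M r : R) (c : nat -> C) (h : C -> C) (z : C) :
  0 < r -> power_series_on r c h -> coef_bound M r c -> Cmod z <= r / 2 -> h z = RtoC 0 ->
  exists c' h', power_series_on r c' h' /\ coef_bound (2 * M / r) r c' /\
    (forall k, Cmod (c' k - c (S k)) <= 2 * M / r ^ S (S k) * Cmod z) /\
    (forall v, Cmod v < r -> h v = ((v - z) * h' v)%C).
Proof.
  intros Hr Hh Hc Hz Hhz. destruct (horner_tails M r c z Hr Hc Hz) as [s [Hs [Hsb Hrec]]].
  assert (Hs0 : s 0%nat = RtoC 0).
  { rewrite <- Hhz. apply (is_series_fun (V := C_NormedModule) (fun n => (c n * z ^ n)%C)).
    - apply (Hs 0%nat).
    - apply Hh. lra. }
  assert (Hc' : coef_bound (2 * M / r) r (fun k => s (S k))).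
  { intros k. apply Rle_trans with (2 * M / r ^ S k * r ^ k).
    - apply Rmult_le_compat_r; [apply pow_le; lra|apply Hsb].
    - right. simpl. field. split; [lra|apply pow_nonzero; lra]. }
  destruct (power_series_on_of_coef_bound _ r _ Hc') as [h' Hh'].
  exists (fun k => s (S k)), h'. split; [exact Hh'|]. split; [exact Hc'|]. split.
  - intros k. rewrite (Hrec (S k)).
    replace (c (S k) + z * s (S (S k)) - c (S k))%C with (s (S (S k)) * z)%C by ring.
    rewrite Cmod_mult. apply Rmult_le_compat_r; [apply Cmod_ge_0|apply Hsb].
  - intros v Hv. specialize (Hh' v Hv).
    apply (is_series_fun (V := C_NormedModule) _ _ _ (Hh v Hv)).
    apply (is_series_decr_1 (V := C_NormedModule) (fun n => (c n * v ^ n)%C)).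
    change plus with Cplus. change opp with Copp.
    assert (E0 : c 0%nat = (- (z * s 1%nat))%C).
    { assert (E := Hrec 0%nat). rewrite Hs0 in E.
      replace (c 0%nat) with (c 0%nat + z * s 1%nat - z * s 1%nat)%C by ring. rewrite <- E. ring. }
    rewrite E0.
    replace ((v - z) * h' v + - (- (z * s 1%nat) * v ^ 0))%C
      with (v * h' v - z * (h' v - s 1%nat))%C
      by (simpl; ring).
    apply is_series_ext with (fun k => (v * (s (S k) * v ^ k) - z * (s (S (S k)) * v ^ S k))%C).
    + intros k. rewrite (Hrec (S k)), Cpow_S. ring_C.
    + apply is_cseries_minus; [now apply is_cseries_scal|]. apply is_cseries_scal.
      apply (is_series_incr_1 (V := C_NormedModule) (fun k => (s (S k) * v ^ k)%C)).
      change plus with Cplus. replace (h' v - s 1%nat + s 1%nat * v ^ 0)%C with (h' v)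
        by (simpl; ring).
      exact Hh'.
Qed.

Fixpoint cprod (g : nat -> C) (n : nat) : C :=
  match n with O => RtoC 1 | S n' => (cprod g n' * g n')%C end.

Lemma factor_zeros (n : nat) : forall M r, 0 < r -> 0 <= M ->
  exists K, 0 <= K /\ forall (c : nat -> C) (h : C -> C) (rho : R) (z : nat -> C),
    power_series_on r c h -> coef_bound M r c -> 0 <= rho <= r / 2 ->
    (forall i, (i < n)%nat -> Cmod (z i) <= rho /\ h (z i) = RtoC 0) ->
    (forall i j, (i < j < n)%nat -> z i <> z j) ->
    forall v, Cmod v <= rho ->
      exists U, h v = (cprod (fun i => (v - z i)%C) n * U)%C /\ Cmod (U - c n) <= K * rho.
Proof.
  induction n as [|n IH]; intros M r Hr HM.
  - exists (2 * M / r). split; [apply Rdiv_le_0_compat; lra|].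
    intros c h rho z Hh Hc Hrho _ _ v Hv. exists (h v). split; [simpl; ring|].
    assert (t := ser1_taylor_le M r c v Hr Hc ltac:(lra) 0 (h v) (Hh v ltac:(lra))).
    rewrite sum_O, (pow_1 (Cmod v / r)) in t.
    replace (c 0%nat * v ^ 0)%C with (c 0%nat) in t by (simpl; ring).
    eapply Rle_trans; [exact t|]. apply Rle_trans with (2 * M / r * Cmod v); [right; field; lra|].
    apply Rmult_le_compat_l; [|exact Hv].
    apply Rdiv_le_0_compat; lra.
  - assert (Hr2 : 0 < r ^ S (S n)) by now apply pow_lt.
    assert (HM1 : 0 <= 2 * M / r ^ S (S n)) by (apply Rdiv_le_0_compat; lra).
    destruct (IH (2 * M / r) r Hr) as [K [HK HIH]].
    { apply Rdiv_le_0_compat; lra. }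
    exists (K + 2 * M / r ^ S (S n)). split; [lra|].
    intros c h rho z Hh Hc Hrho Hz Hd v Hv. destruct (Hz n ltac:(lia)) as [Hzn Hhzn].
    destruct (factor_zero M r c h (z n) Hr Hh Hc ltac:(lra) Hhzn)
      as [c' [h' [Hh' [Hc' [Hnear Hfac]]]]].
    destruct (HIH c' h' rho z Hh' Hc' Hrho) with (v := v) as [U [EU HU]]; [| |exact Hv|].
    + intros i Hi. destruct (Hz i ltac:(lia)) as [Hzi Hhzi]. split; [exact Hzi|].
      rewrite (Hfac (z i)) in Hhzi by lra. apply NNPP. intros Hne.
      apply Cmult_neq_0 in Hhzi; [exact Hhzi| |exact Hne]. apply Cminus_eq_contra, Hd. lia.
    + intros i j Hij. apply Hd. lia.
    + exists U. split; [rewrite Hfac, EU by lra; simpl; ring|].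
      eapply Rle_trans; [apply (Cmod_minus_triangle _ (c' n))|].
      specialize (Hnear n). apply (Rmult_le_compat_l _ _ _ HM1) in Hzn. lra.
Qed.

(* [u0] is the coefficient of [v ^ n] in [F 0 v]. *)
Lemma slice_factorization (F : C -> C -> C) (s L : R) (n : nat) : 0 < s -> 0 <= L ->
  (forall u, Cmod u < s -> analytic_on s (F u)) ->
  (forall u v, Cmod u < s -> Cmod v < s -> Cmod (F u v) <= L) ->
  (forall u v, Cmod u < s -> Cmod v < s -> Cmod (F u v - F 0 v) <= L * Cmod u) ->
  exists (K : R) (u0 : C), 0 <= K /\ forall (u v : C) (rho : R) (z : nat -> C),
    rho <= s / 2 -> Cmod u <= rho -> Cmod v <= rho ->
    (forall i, (i < n)%nat -> Cmod (z i) <= rho /\ F u (z i) = RtoC 0) ->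
    (forall i j, (i < j < n)%nat -> z i <> z j) ->
    exists U, F u v = (cprod (fun i => (v - z i)%C) n * U)%C /\ Cmod (U - u0) <= K * rho.
Proof.
  intros Hs HL Han Hb Hlip.
  destruct (guarded_choice _ (fun u c => power_series_on s c (F u)) (fun _ => RtoC 0) Han)
    as [c Hc].
  assert (H0 : Cmod 0 < s) by now rewrite Cmod_0.
  assert (Hnear : forall u, Cmod u < s -> Cmod (c u n - c (RtoC 0) n) <= L / s ^ n * Cmod u).
  { intros u Hu. assert (hn : 0 < s ^ n) by now apply pow_lt.
    apply Rmult_le_reg_r with (s ^ n); [exact hn|].
    apply Rle_trans with (L * Cmod u); [|right; field; lra].
    apply (cauchy_estimate s (fun k => (c u k - c (RtoC 0) k)%C) (fun v => (F u v - F 0 v)%C));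
      [|exact Hs|auto].
    intros v Hv. eapply is_series_ext;
      [|apply (is_cseries_minus _ _ _ _ (Hc u Hu v Hv) (Hc _ H0 v Hv))].
    intros k. cbv beta. ring_C. }
  destruct (factor_zeros n L s Hs HL) as [K [HK Hfac]].
  assert (HLn : 0 <= L / s ^ n).
  { apply Rdiv_le_0_compat; [exact HL|now apply pow_lt]. }
  exists (K + L / s ^ n), (c (RtoC 0) n). split; [lra|].
  intros u v rho z Hrho Hu Hv Hz Hd. assert (hu := Cmod_ge_0 u).
  assert (Hus : Cmod u < s) by lra.
  destruct (Hfac (c u) (F u) rho z (Hc u Hus)) with (v := v) as [U [EU HU]]; try assumption;
    [|lra|].
  - apply (cauchy_estimate s (c u) (F u)); auto.
  - exists U. split; [exact EU|]. eapply Rle_trans; [apply (Cmod_minus_triangle _ (c u n))|].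
    specialize (Hnear u Hus). apply (Rmult_le_compat_l _ _ _ HLn) in Hu. lra.
Qed.

(** * Complex roots *)

Lemma polar_form (z : C) : exists t, - PI <= t <= PI /\ z = (RtoC (Cmod z) * cis t)%C.
Proof.
  assert (hp := PI_RGT_0).
  destruct (Ceq_dec z (RtoC 0)) as [->|Hz]; [exists 0; split; [lra|rewrite Cmod_0; ring]|].
  assert (Hr := proj1 (Cmod_gt_0 z) Hz). destruct z as [x y]. set (r := Cmod (x, y)) in *.
  assert (Hr2 : (y / r) ^ 2 = 1 - Rsqr (x / r)).
  { assert (E : r ^ 2 = x ^ 2 + y ^ 2) by (apply Cmod2_alt).
    replace ((y / r) ^ 2) with (y ^ 2 / r ^ 2) by (field; lra).
    replace (y ^ 2) with (r ^ 2 - x ^ 2) by lra. unfold Rsqr. field. lra. }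
  assert (Hc : -1 <= x / r <= 1).
  { assert (h := pow2_ge_0 (y / r)). rewrite Hr2 in h. unfold Rsqr in h. split; nra. }
  assert (hc := acos_bound (x / r)).
  assert (Hsin : sin (acos (x / r)) = Rabs (y / r)).
  { rewrite sin_acos, <- Hr2, <- Rsqr_pow2 by exact Hc. apply sqrt_Rsqr_abs. }
  destruct (Rle_dec 0 (y / r)) as [hy|hy].
  - exists (acos (x / r)). split; [lra|]. unfold cis, Cmult, RtoC; cbn [fst snd].
    rewrite cos_acos, Hsin, Rabs_pos_eq by assumption. f_equal; field; lra.
  - exists (- acos (x / r)). split; [lra|]. unfold cis, Cmult, RtoC; cbn [fst snd].
    rewrite cos_neg, sin_neg, cos_acos, Hsin, Rabs_left by lra. f_equal; field; lra.
Qed.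

Lemma Cmod_cis_minus_sq (p r t : R) :
  Cmod (RtoC p * cis t - RtoC r) ^ 2 = (p - r) ^ 2 + 4 * p * r * sin (t / 2) ^ 2.
Proof.
  rewrite Cmod2_alt. unfold cis, RtoC, Cminus, Cmult, Cplus, Copp, Re, Im; cbn [fst snd].
  assert (E1 := cos_2a_sin (t / 2)). replace (2 * (t / 2)) with t in E1 by field.
  assert (E2 := sin2_cos2 t).
  transitivity (p ^ 2 * (Rsqr (sin t) + Rsqr (cos t)) - 2 * p * r * cos t + r ^ 2);
    [unfold Rsqr; ring|]. rewrite E2, E1. ring.
Qed.

Lemma sin_sq_half_le (t : R) (n : nat) : (1 <= n)%nat -> - PI <= t <= PI ->
  sin (t / INR n / 2) ^ 2 <= sin (t / 2) ^ 2.
Proof.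
  intros Hn Ht. assert (hn : 1 <= INR n) by (change 1 with (INR 1); now apply le_INR).
  assert (Hpos : forall s, 0 <= s <= PI -> sin (s / INR n / 2) ^ 2 <= sin (s / 2) ^ 2).
  { intros s Hs. assert (hs : s / INR n <= s).
    { apply Rmult_le_reg_r with (INR n); [lra|]. unfold Rdiv. rewrite Rmult_assoc, Rinv_l; nra. }
    assert (hs0 : 0 <= s / INR n) by (apply Rdiv_le_0_compat; lra).
    apply pow_incr. split; [apply sin_ge_0; lra|]. apply sin_incr_1; lra. }
  destruct (Rle_dec 0 t) as [h|h]; [apply Hpos; lra|].
  replace (sin (t / INR n / 2) ^ 2) with (sin (- t / INR n / 2) ^ 2).
  - replace (sin (t / 2) ^ 2) with (sin (- t / 2) ^ 2); [apply Hpos; lra|].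
    unfold Rdiv. rewrite Ropp_mult_distr_l_reverse, sin_neg. ring.
  - unfold Rdiv. rewrite !Ropp_mult_distr_l_reverse, sin_neg. ring.
Qed.

Lemma cis_root_dist (n : nat) (p r t : R) : 0 <= p -> 0 <= r -> - PI <= t <= PI ->
  Rmin p r ^ n * Cmod (RtoC p * cis (t / INR (S n)) - RtoC r)
  <= Cmod (RtoC (p ^ S n)%R * cis t - RtoC (r ^ S n)%R).
Proof.
  intros Hp Hr Ht. set (mu := Rmin p r).
  assert (h1 : mu <= p) by apply Rmin_l. assert (h2 : mu <= r) by apply Rmin_r.
  assert (h0 : 0 <= mu) by now apply Rmin_glb.
  apply Rsqr_incr_0_var; [|apply Cmod_ge_0].
  rewrite !Rsqr_pow2, Rpow_mult_distr, !Cmod_cis_minus_sq, Rmult_plus_distr_l.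
  apply Rplus_le_compat.
  - rewrite <- Rpow_mult_distr, <- !Rsqr_pow2. apply Rsqr_le_abs_1.
    rewrite Rabs_mult, Rabs_pos_eq by now apply pow_le.
    unfold mu. destruct (Rle_dec p r) as [h|h].
    + rewrite Rmin_left, !(Rabs_minus_sym p), (Rabs_minus_sym (p ^ S n)) by exact h.
      rewrite (Rabs_pos_eq (r - p)) by lra.
      eapply Rle_trans; [apply pow_minus_ge; lra|apply Rle_abs].
    + rewrite Rmin_right, (Rabs_pos_eq (p - r)) by lra.
      eapply Rle_trans; [apply pow_minus_ge; lra|apply Rle_abs].
  - assert (hs := sin_sq_half_le t (S n) ltac:(lia) Ht).
    assert (hmu : (mu ^ n) ^ 2 <= p ^ n * r ^ n).
    { simpl. rewrite Rmult_1_r. apply Rmult_le_compat; try (now apply pow_le); now apply pow_incr. }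
    assert (hpr : 0 <= p * r) by now apply Rmult_le_pos.
    replace (4 * p ^ S n * r ^ S n * sin (t / 2) ^ 2)
      with (4 * (p * r) * ((p ^ n * r ^ n) * sin (t / 2) ^ 2))
      by (simpl; ring).
    replace ((mu ^ n) ^ 2 * (4 * p * r * sin (t / INR (S n) / 2) ^ 2))
      with (4 * (p * r) * ((mu ^ n) ^ 2 * sin (t / INR (S n) / 2) ^ 2)) by ring.
    apply Rmult_le_compat_l; [lra|]. apply Rmult_le_compat; try apply pow2_ge_0; assumption.
Qed.

(* The root of [b] whose argument is closest to that of [y]. *)
Lemma root_near (n : nat) (y b : C) : exists x, (x ^ S n)%C = b /\
  Rmin (Cmod x) (Cmod y) ^ n * Cmod (x - y) <= Cmod (b - y ^ S n).
Proof.
  destruct (polar_form y) as [s [_ Ey]]. set (r := Cmod y) in *.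
  destruct (polar_form (b * cis (- (INR (S n) * s)))) as [t [Ht Eb]].
  rewrite Cmod_mult, Cmod_cis, Rmult_1_r in Eb.
  destruct (nonneg_root_exists (S n) (Cmod b) ltac:(lia) (Cmod_ge_0 b)) as [p [Hp Ep]].
  assert (Hinv : forall x, (cis (- x) * cis x)%C = RtoC 1).
  { intros x. rewrite <- cis_plus, Rplus_opp_l. apply cis_0. }
  assert (Eb2 : b = (RtoC (p ^ S n) * cis t * cis s ^ S n)%C).
  { rewrite Ep, <- Eb, cis_pow, <- Cmult_assoc, Hinv. ring. }
  exists (RtoC p * cis (t / INR (S n)) * cis s)%C. split.
  - rewrite !Cpow_mult_l, cis_pow, <- RtoC_pow, Eb2. do 3 f_equal. field. apply not_0_INR. lia.
  - replace (RtoC p * cis (t / INR (S n)) * cis s - y)%C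
      with ((RtoC p * cis (t / INR (S n)) - RtoC r) * cis s)%C by (rewrite Ey; ring).
    replace (b - y ^ S n)%C with ((RtoC (p ^ S n) * cis t - RtoC (r ^ S n)) * cis s ^ S n)%C.
    + rewrite !Cmod_mult, Cmod_pow, !Cmod_cis, pow1, !Rmult_1_r, Cmod_R, Rabs_pos_eq by exact Hp.
      apply cis_root_dist; [exact Hp|apply Cmod_ge_0|exact Ht].
    + rewrite Eb2, Ey, Cpow_mult_l, <- RtoC_pow. ring.
Qed.

(** * Comparability *)

Definition comparable (K x y : R) : Prop := x <= K * y /\ y <= K * x.

Lemma comparable_le (K K' x y : R) :
  K <= K' -> 0 <= x -> 0 <= y -> comparable K x y -> comparable K' x y.
Proof. intros HK Hx Hy [h1 h2]. split; nra. Qed.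

Lemma comparable_sym (K x y : R) : comparable K x y -> comparable K y x.
Proof. intros [h1 h2]. now split. Qed.

Lemma comparable_trans (K L x y z : R) : 0 <= K -> 0 <= L ->
  comparable K x y -> comparable L y z -> comparable (K * L) x z.
Proof.
  intros HK HL [hxy hyx] [hyz hzy]. split.
  - rewrite Rmult_assoc. eapply Rle_trans; [exact hxy|]. now apply Rmult_le_compat_l.
  - rewrite (Rmult_comm K), Rmult_assoc. eapply Rle_trans; [exact hzy|].
    now apply Rmult_le_compat_l.
Qed.

Lemma comparable_of_near (y k z : C) : k <> RtoC 0 ->
  Cmod (y - k * z) <= Cmod k / 2 * Cmod z -> comparable (2 * Cmod k + 2 / Cmod k) (Cmod y) (Cmod z).
Proof.
  intros Hk H. apply Cmod_gt_0 in Hk. assert (hz := Cmod_ge_0 z).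
  assert (hyz := Cmod_minus_ge y (k * z)). assert (hzy := Cmod_minus_ge (k * z) y).
  rewrite (Cmod_minus_sym (k * z)) in hzy. rewrite Cmod_mult in hyz, hzy.
  assert (hi : 0 < 2 / Cmod k) by (apply Rdiv_lt_0_compat; lra).
  split; [nra|]. apply Rle_trans with (2 / Cmod k * (Cmod k / 2 * Cmod z)); [right; field; lra|].
  apply Rmult_le_compat; lra.
Qed.

Fixpoint rprod (g : nat -> R) (n : nat) : R :=
  match n with O => 1 | S n' => rprod g n' * g n' end.

Lemma rprod_ge_0 (g : nat -> R) (n : nat) : (forall i, (i < n)%nat -> 0 <= g i) -> 0 <= rprod g n.
Proof.
  induction n as [|n IH]; intros H; simpl; [lra|].
  apply Rmult_le_pos; [apply IH; intros i Hi; apply H; lia|apply H; lia].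
Qed.

Lemma comparable_rprod (K : R) (g h : nat -> R) (n : nat) :
  (forall i, (i < n)%nat -> 0 <= g i /\ 0 <= h i /\ comparable K (g i) (h i)) ->
  comparable (K ^ n) (rprod g n) (rprod h n).
Proof.
  induction n as [|n IH]; intros H; simpl; [split; lra|].
  destruct (H n ltac:(lia)) as [hg [hh [hgh hhg]]].
  destruct (IH ltac:(intros i Hi; apply H; lia)) as [IHgh IHhg].
  assert (rg : 0 <= rprod g n) by (apply rprod_ge_0; intros i Hi; apply H; lia).
  assert (rh : 0 <= rprod h n) by (apply rprod_ge_0; intros i Hi; apply H; lia).
  split.
  - replace (K * K ^ n * (rprod h n * h n)) with (K ^ n * rprod h n * (K * h n)) by ring.
    now apply Rmult_le_compat.
  - replace (K * K ^ n * (rprod g n * g n)) with (K ^ n * rprod g n * (K * g n)) by ring.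
    now apply Rmult_le_compat.
Qed.

Lemma Cmod_cprod (g : nat -> C) (n : nat) : Cmod (cprod g n) = rprod (fun i => Cmod (g i)) n.
Proof.
  induction n as [|n IH]; simpl; [apply Cmod_1|]. now rewrite Cmod_mult, IH.
Qed.

Lemma Cmod_cprod_le (g : nat -> C) (x : R) (n : nat) :
  (forall i, Cmod (g i) <= x) -> Cmod (cprod g n) <= x ^ n.
Proof.
  intros H. induction n as [|n IH]; simpl; [rewrite Cmod_1; lra|].
  rewrite Cmod_mult, Rmult_comm. apply Rmult_le_compat; auto using Cmod_ge_0.
Qed.

Lemma Cmod_cprod_minus_le (g h : nat -> C) (d : R) (n : nat) :
  (forall i, Cmod (g i) <= 1) -> (forall i, Cmod (h i) <= 1) ->
  (forall i, Cmod (g i - h i) <= d) -> Cmod (cprod g n - cprod h n) <= INR n * d.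
Proof.
  intros Hg Hh Hd. induction n as [|n IH].
  - simpl. unfold Cminus. rewrite Cplus_opp_r, Cmod_0. lra.
  - rewrite S_INR. simpl cprod.
    replace (cprod g n * g n - cprod h n * h n)%C
      with ((cprod g n - cprod h n) * g n + cprod h n * (g n - h n))%C by ring.
    eapply Rle_trans; [apply Cmod_triangle|]. rewrite !Cmod_mult.
    assert (hprod := Cmod_cprod_le h 1 n Hh). rewrite pow1 in hprod.
    assert (hgn := Hg n). assert (hdn := Hd n).
    assert (hdiff0 := Cmod_ge_0 (cprod g n - cprod h n)). assert (hstep0 := Cmod_ge_0 (g n - h n)).
    nra.
Qed.

(** * The branches of a Puiseux parameterization *)

Definition branch (m : nat) (Psi : C -> C) (i : nat) (x : C) : C := Psi (zeta m ^ i * x)%C.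

(* The Lipschitz bound says that [Psi] vanishes to order greater than [m] at [0]. *)
Definition puiseux_branches (m : nat) (Psi : C -> C) (B : nat -> nat) (rho K : R) : Prop :=
  (1 <= m)%nat /\ 0 < rho <= 1 /\ 1 <= K /\ Psi (RtoC 0) = RtoC 0 /\
  (forall X x y, Cmod x <= X -> Cmod y <= X -> X <= rho ->
     Cmod (Psi x - Psi y) <= K * X ^ m * Cmod (x - y)) /\
  (forall i, (0 < i < m)%nat -> (m <= B i)%nat) /\
  forall i x, (0 < i < m)%nat -> Cmod x <= rho ->
     comparable K (Cmod x ^ B i) (Cmod (Psi x - branch m Psi i x)).

Lemma max_pow_mult_dist_le (n : nat) (x y : C) : Cmod y <= Cmod x <= 1 ->
  Cmod y ^ n * Cmod (x - y) <= Cmod (x ^ S n - y ^ S n) ->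
  Cmod x ^ S n * Cmod (x - y) <= 4 * 2 ^ S n * Cmod (x ^ S n - y ^ S n).
Proof.
  intros Hxy H. assert (hy := Cmod_ge_0 y). assert (hd := Cmod_ge_0 (x - y)).
  assert (h2n : 1 <= 2 ^ S n) by (apply pow_R1_Rle; lra).
  set (Q := Cmod (x ^ S n - y ^ S n)) in *. assert (HQ : 0 <= Q) by apply Cmod_ge_0.
  destruct (Rle_dec (Cmod x) (2 * Cmod y)) as [h|h].
  - assert (hpow : Cmod x ^ S n <= 2 ^ S n * Cmod y ^ n).
    { apply Rle_trans with ((2 * Cmod y) ^ S n); [apply pow_incr; lra|].
      rewrite Rpow_mult_distr. apply Rmult_le_compat_l; [lra|].
      assert (hn : 0 <= Cmod y ^ n) by now apply pow_le. simpl. nra. }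
    apply Rle_trans with (2 ^ S n * Cmod y ^ n * Cmod (x - y)); [now apply Rmult_le_compat_r|]. nra.
  - assert (hpow := Cmod_minus_ge (x ^ S n) (y ^ S n)). rewrite !Cmod_pow in hpow. fold Q in hpow.
    assert (hhalf : Cmod y ^ S n <= / 2 * Cmod x ^ S n).
    { apply Rle_trans with ((/ 2 * Cmod x) ^ S n); [apply pow_incr; lra|].
      rewrite Rpow_mult_distr. apply Rmult_le_compat_r; [apply pow_le; lra|].
      apply pow_le_self; [lia|lra]. }
    assert (h4 := Cmod_minus_le x y). assert (hp : 0 <= Cmod x ^ S n) by (apply pow_le; lra).
    apply Rle_trans with (2 * Q * 2); [apply Rmult_le_compat; lra|nra].
Qed.

Section Branches.
Context (m : nat) (Psi : C -> C) (B : nat -> nat) (rho K : R).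
Hypothesis HPsi : puiseux_branches m Psi B rho K.

Lemma Psi_le (x : C) : Cmod x <= rho -> Cmod (Psi x) <= K * Cmod x ^ m * Cmod x.
Proof.
  destruct HPsi as [_ [_ [_ [Psi0 [Hlip _]]]]]. intros Hx.
  assert (h := Hlip (Cmod x) x (RtoC 0) ltac:(lra)). rewrite Cmod_0, Psi0 in h.
  specialize (h (Cmod_ge_0 _) Hx). unfold Cminus in h. rewrite Copp_0, !Cplus_0_r in h. exact h.
Qed.

Lemma Cmod_zeta_mult (i : nat) (x : C) : Cmod (zeta m ^ i * x) = Cmod x.
Proof. rewrite Cmod_mult, Cmod_zeta_pow. ring. Qed.

Lemma zeta_mult_pow (i : nat) (x : C) : ((zeta m ^ i * x) ^ m)%C = (x ^ m)%C.
Proof. rewrite Cpow_mult_l, zeta_pow_pow_order by apply HPsi. ring. Qed.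

Lemma branch_le (i : nat) (x : C) :
  Cmod x <= rho -> Cmod (branch m Psi i x) <= K * Cmod x ^ m * Cmod x.
Proof.
  intros Hx. unfold branch. eapply Rle_trans; [apply Psi_le|]; rewrite Cmod_zeta_mult; lra.
Qed.

Lemma branch_le_pow (i : nat) (x : C) : Cmod x <= rho / K -> Cmod (branch m Psi i x) <= Cmod x ^ m.
Proof.
  assert (hx := Cmod_ge_0 x). destruct HPsi as [_ [Hrho [HK _]]]. intros Hx.
  assert (hKx : K * Cmod x <= rho).
  { apply Rle_trans with (K * (rho / K)); [apply Rmult_le_compat_l; lra|right; field; lra]. }
  eapply Rle_trans; [apply branch_le; nra|].
  replace (K * Cmod x ^ m * Cmod x) with (Cmod x ^ m * (K * Cmod x)) by ring.
  assert (hp : 0 <= Cmod x ^ m) by now apply pow_le. nra.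
Qed.

Lemma branch_0 (x : C) : branch m Psi 0 x = Psi x.
Proof. unfold branch. simpl. now rewrite Cmult_1_l. Qed.

Lemma rho_div_K_le : rho / K <= rho /\ 0 < rho / K.
Proof.
  destruct HPsi as [_ [Hrho [HK _]]]. split; [|apply Rdiv_lt_0_compat; lra].
  apply Rmult_le_reg_r with K; [lra|]. replace (rho / K * K) with rho by (field; lra). nra.
Qed.

Lemma Psi_le_pow (x : C) : Cmod x <= rho / K -> Cmod (Psi x) <= Cmod x ^ m.
Proof. intros Hx. rewrite <- branch_0. now apply branch_le_pow. Qed.

Lemma branch_distinct (i j : nat) (x : C) : Cmod x <= rho -> x <> RtoC 0 -> (i < j < m)%nat ->
  branch m Psi i x <> branch m Psi j x.
Proof.
  destruct HPsi as [_ [_ [_ [_ [_ [_ Hsep]]]]]]. intros Hx Hx0 Hij E.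
  destruct (Hsep (j - i)%nat (zeta m ^ i * x)%C ltac:(lia)) as [h _].
  { now rewrite Cmod_zeta_mult. }
  unfold branch in *. rewrite Cmult_assoc, <- Cpow_add_r, Nat.sub_add in h by lia.
  rewrite E, Cmod_zeta_mult in h. unfold Cminus in h. rewrite Cplus_opp_r, Cmod_0, Rmult_0_r in h.
  assert (hp : 0 < Cmod x ^ B (j - i)) by now apply pow_lt, Cmod_gt_0. lra.
Qed.

Lemma Psi_multivalued_lipschitz (y b : C) : Cmod y <= rho -> Cmod b <= rho ^ m ->
  exists x, (x ^ m)%C = b /\ Cmod x <= rho /\
    Cmod (Psi x - Psi y) <= 4 * K * 2 ^ m * Cmod (b - y ^ m).
Proof.
  destruct HPsi as [Hm [Hrho [HK [_ [Hlip _]]]]]. intros Hy Hb.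
  destruct m as [|n]; [lia|].
  destruct (root_near n y b) as [x [Ex Hxy]]. exists x. split; [exact Ex|].
  assert (Hx : Cmod x <= rho).
  { apply pow_le_inv with (S n); [lia|lra|]. rewrite <- Cmod_pow, Ex. exact Hb. }
  split; [exact Hx|]. rewrite <- Ex in *.
  destruct (Rle_dec (Cmod y) (Cmod x)) as [h|h].
  - rewrite Rmin_right in Hxy by exact h.
    assert (Hdist := max_pow_mult_dist_le n x y ltac:(lra) Hxy).
    assert (HPsixy := Hlip (Cmod x) x y ltac:(lra) h Hx). rewrite Rmult_assoc in HPsixy. nra.
  - rewrite Rmin_left in Hxy by lra. rewrite !(Cmod_minus_sym x), (Cmod_minus_sym (x ^ S n)) in Hxy.
    assert (Hdist := max_pow_mult_dist_le n y x ltac:(lra) Hxy).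
    assert (HPsiyx := Hlip (Cmod y) y x ltac:(lra) ltac:(lra) Hy). rewrite Rmult_assoc in HPsiyx.
    rewrite (Cmod_minus_sym (Psi x)), (Cmod_minus_sym (x ^ S n)). nra.
Qed.
End Branches.

Definition branch_product (m : nat) (Psi : C -> C) (x v : C) : C :=
  cprod (fun i => (v - branch m Psi i x)%C) m.

Section BranchProduct.
Context (m : nat) (Psi : C -> C) (B : nat -> nat) (rho K : R) (F : C -> C -> C) (s L : R).
Hypothesis HPsi : puiseux_branches m Psi B rho K.
Hypothesis Hs : 0 < s.
Hypothesis HL : 0 <= L.
Hypothesis HFan : forall u, Cmod u < s -> analytic_on s (F u).
Hypothesis HFb : forall u v, Cmod u < s -> Cmod v < s -> Cmod (F u v) <= L.
Hypothesis HFlip : forall u v, Cmod u < s -> Cmod v < s -> Cmod (F u v - F 0 v) <= L * Cmod u.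
Hypothesis HFzero : forall x, Cmod x < s -> F (x ^ m)%C (Psi x) = RtoC 0.

Lemma branch_product_asymptotic_punctured : exists (d K1 : R) (u0 : C),
  0 < d <= rho / K /\ d < s /\ d <= / 2 /\ 0 <= K1 /\
  forall x v, x <> RtoC 0 -> Cmod x < d -> Cmod v < d ->
    Cmod (F (x ^ m)%C v - u0 * branch_product m Psi x v)
    <= K1 * (Cmod x ^ m + Cmod v) * Cmod (branch_product m Psi x v).
Proof.
  destruct HPsi as [Hm _].
  destruct (slice_factorization F s L m Hs HL HFan HFb HFlip) as [K1 [u0 [HK1 Hfac]]].
  destruct (rho_div_K_le m Psi B rho K HPsi) as [HrK HrK0].
  destruct (pos_lower_bound3 (rho / K) (s / 4) (/ 2)) as [d [Hd [HdrK [Hds Hd2]]]]; [lra..|].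
  exists d, K1, u0. split; [lra|]. split; [lra|]. split; [lra|]. split; [exact HK1|].
  intros x v Hx0 Hx Hv. assert (hx := Cmod_ge_0 x). assert (hv := Cmod_ge_0 v).
  assert (hxm := pow_le_self (Cmod x) m Hm ltac:(lra)).
  assert (hxm0 : 0 <= Cmod x ^ m) by now apply pow_le.
  destruct (Hfac (x ^ m)%C v (Cmod x ^ m + Cmod v) (fun i => branch m Psi i x)) as [U [EU HU]].
  - lra.
  - rewrite Cmod_pow. lra.
  - lra.
  - intros i _. split.
    + assert (h := branch_le_pow m Psi B rho K HPsi i x ltac:(lra)). lra.
    + rewrite <- (zeta_mult_pow m Psi B rho K HPsi i x). apply HFzero.
      rewrite Cmod_zeta_mult. lra.
  - intros i j Hij. apply (branch_distinct m Psi B rho K HPsi); [lra|exact Hx0|exact Hij].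
  - fold (branch_product m Psi x v) in EU. rewrite EU.
    replace (branch_product m Psi x v * U - u0 * branch_product m Psi x v)%C
      with ((U - u0) * branch_product m Psi x v)%C by ring.
    rewrite Cmod_mult. apply Rmult_le_compat_r; [apply Cmod_ge_0|exact HU].
Qed.

Lemma branch_product_0_near (x v : C) : Cmod x <= rho / K -> Cmod x <= / 2 -> Cmod v <= / 2 ->
  Cmod (branch_product m Psi x v) <= 1 /\
  Cmod (branch_product m Psi x v - branch_product m Psi 0 v) <= INR m * Cmod x.
Proof.
  destruct HPsi as [Hm [_ [_ [Psi0 _]]]]. intros Hx Hx2 Hv. assert (hx := Cmod_ge_0 x).
  assert (hxm := pow_le_self (Cmod x) m Hm ltac:(lra)).
  assert (E0 : forall i, branch m Psi i 0 = RtoC 0)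
    by (intros i; unfold branch; now rewrite Cmult_0_r).
  assert (hb : forall i, Cmod (branch m Psi i x) <= Cmod x).
  { intros i. eapply Rle_trans; [apply (branch_le_pow m Psi B rho K HPsi); exact Hx|exact hxm]. }
  assert (hfactor : forall i, Cmod (v - branch m Psi i x) <= 1).
  { intros i. eapply Rle_trans; [apply Cmod_minus_le|]. specialize (hb i). lra. }
  split; [rewrite <- (pow1 m); now apply Cmod_cprod_le|].
  apply Cmod_cprod_minus_le; [exact hfactor| |]; intros i; rewrite E0.
  - unfold Cminus. rewrite Copp_0, Cplus_0_r. lra.
  - replace (v - branch m Psi i x - (v - 0))%C with (- branch m Psi i x)%C by ring.
    rewrite Cmod_opp. apply hb.
Qed.

(* The roots of [F 0] are not distinct; this slice is reached as a limit of the others. *)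
Lemma branch_product_asymptotic : exists (d K1 : R) (u0 : C),
  0 < d <= rho / K /\ d <= / 2 /\ 0 <= K1 /\
  forall x v, Cmod x < d -> Cmod v < d ->
    Cmod (F (x ^ m)%C v - u0 * branch_product m Psi x v)
    <= K1 * (Cmod x ^ m + Cmod v) * Cmod (branch_product m Psi x v).
Proof.
  destruct branch_product_asymptotic_punctured as [d [K1 [u0 [Hd [Hds [Hd2 [HK1 H]]]]]]].
  assert (Hm := proj1 HPsi). exists d, K1, u0. split; [lra|]. split; [lra|]. split; [exact HK1|].
  intros x v Hx Hv. destruct (Ceq_dec x (RtoC 0)) as [->|Hx0]; [|now apply H].
  apply (le_of_le_add_small _ _ (L + K1 * (INR m + 1) + Cmod u0 * INR m) d); [lra| |].
  { assert (hm := pos_INR m). assert (hu := Cmod_ge_0 u0). assert (hum := Rmult_le_pos _ _ hu hm).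
    assert (0 <= K1 * (INR m + 1)) by (apply Rmult_le_pos; lra). lra. }
  intros t Ht. assert (Et : Cmod (RtoC t) = t) by (rewrite Cmod_R; apply Rabs_pos_eq; lra).
  rewrite Cmod_0, Cpow_0_l, pow_i by lia.
  destruct (branch_product_0_near (RtoC t) v ltac:(lra) ltac:(lra) ltac:(lra)) as [hN hN0].
  assert (ht := H (RtoC t) v ltac:(intros E; apply RtoC_inj in E; lra) ltac:(lra) Hv).
  rewrite Et in ht, hN0.
  assert (htm := pow_le_self t m Hm ltac:(lra)).
  assert (hF := HFlip (RtoC t ^ m)%C v). rewrite Cmod_pow, Et in hF.
  specialize (hF ltac:(lra) ltac:(lra)).
  set (N := branch_product m Psi (RtoC t) v) in *. set (N0 := branch_product m Psi 0 v) in *.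
  replace (F 0 v - u0 * N0)%C with
    (F (RtoC t ^ m) v - u0 * N - (F (RtoC t ^ m) v - F 0 v) + u0 * (N - N0))%C by ring.
  eapply Rle_trans; [apply Cmod_triangle|].
  eapply Rle_trans; [apply Rplus_le_compat_r, Cmod_minus_le|].
  rewrite Cmod_mult. assert (hv := Cmod_ge_0 v). assert (hu := Cmod_ge_0 u0).
  assert (hNN0 := Cmod_minus_ge N N0). assert (hm := pos_INR m).
  assert (Herr : (t ^ m + Cmod v) * Cmod N <= Cmod v * Cmod N0 + (INR m + 1) * t).
  { assert (t ^ m * Cmod N <= t) by (assert (h := Cmod_ge_0 N); nra).
    assert (0 <= INR m * t) by (apply Rmult_le_pos; lra). nra. }
  apply (Rmult_le_compat_l K1) in Herr; [|exact HK1].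
  apply (Rmult_le_compat_l _ _ _ hu) in hN0.
  assert (L * t ^ m <= L * t) by now apply Rmult_le_compat_l. lra.
Qed.

Definition vanishes_to_order (n : nat) : Prop :=
  exists A d, 0 < d /\ forall u v, Cmod u < d -> Cmod v < d ->
    Cmod (F u v) <= A * (Cmod u + Cmod v) ^ n.

Lemma branch_product_coefficient_neq_0 (d K1 : R) (u0 : C) :
  0 < d <= rho / K -> d <= / 2 -> 0 <= K1 ->
  (forall x v, Cmod x < d -> Cmod v < d ->
     Cmod (F (x ^ m)%C v - u0 * branch_product m Psi x v)
     <= K1 * (Cmod x ^ m + Cmod v) * Cmod (branch_product m Psi x v)) ->
  ~ vanishes_to_order (S m) -> u0 <> RtoC 0.
Proof.
  intros Hd Hd2 HK1 H Hnot ->. assert (Hm := proj1 HPsi). apply Hnot.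
  exists K1, (d ^ m). split; [apply pow_lt; lra|].
  intros u v Hu Hv. destruct (root_near (m - 1) 0 u) as [x [Ex _]].
  replace (S (m - 1)) with m in Ex by lia.
  assert (Hx : Cmod x < d) by (apply pow_lt_inv with m; [lra|rewrite <- Cmod_pow, Ex; exact Hu]).
  assert (hdm := pow_le_self d m Hm ltac:(lra)).
  specialize (H x v Hx ltac:(lra)). rewrite <- Cmod_pow, Ex in H.
  replace (F u v - 0 * branch_product m Psi x v)%C with (F u v) in H by ring.
  eapply Rle_trans; [exact H|]. rewrite <- tech_pow_Rmult, <- Rmult_assoc.
  assert (hu := Cmod_ge_0 u). assert (hv := Cmod_ge_0 v).
  apply Rmult_le_compat_l; [apply Rmult_le_pos; lra|]. apply Cmod_cprod_le. intros i.
  eapply Rle_trans; [apply Cmod_minus_le|].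
  assert (h := branch_le_pow m Psi B rho K HPsi i x ltac:(lra)). rewrite <- Cmod_pow, Ex in h. lra.
Qed.

Lemma comparable_branch_product : ~ vanishes_to_order (S m) ->
  exists d K2, 0 < d /\ 0 < K2 /\ forall x v, Cmod x < d -> Cmod v < d ->
    comparable K2 (Cmod (F (x ^ m)%C v)) (rprod (fun i => Cmod (v - branch m Psi i x)) m).
Proof.
  intros Hnot. assert (Hm := proj1 HPsi).
  destruct branch_product_asymptotic as [d [K1 [u0 [Hd [Hd2 [HK1 H]]]]]].
  assert (Hu0 := branch_product_coefficient_neq_0 d K1 u0 Hd Hd2 HK1 H Hnot).
  assert (hu := proj1 (Cmod_gt_0 u0) Hu0).
  destruct (pos_lower_bound2 d (Cmod u0 / (4 * (K1 + 1)))) as [d' [Hd' [Hdd Hdu]]];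
    [lra|apply Rdiv_lt_0_compat; lra|].
  assert (hc : 0 < 2 / Cmod u0) by (apply Rdiv_lt_0_compat; lra).
  exists d', (2 * Cmod u0 + 2 / Cmod u0). split; [exact Hd'|]. split; [lra|].
  intros x v Hx Hv. rewrite <- (Cmod_cprod (fun i => (v - branch m Psi i x)%C)).
  apply comparable_of_near; [exact Hu0|].
  eapply Rle_trans; [apply H; lra|]. apply Rmult_le_compat_r; [apply Cmod_ge_0|].
  assert (hx := Cmod_ge_0 x). assert (hv := Cmod_ge_0 v).
  assert (hxm := pow_le_self (Cmod x) m Hm ltac:(lra)).
  assert (hxm0 : 0 <= Cmod x ^ m) by now apply pow_le.
  apply Rle_trans with ((K1 + 1) * (2 * (Cmod u0 / (4 * (K1 + 1))))); [|right; field; lra].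
  apply Rmult_le_compat; lra.
Qed.
End BranchProduct.

(** * Distance to the curve on a sphere *)

Lemma dist_set_spec (p : C2) (S : C2 -> Prop) (d : R) :
  dist_set p S = Finite d ->
  (forall q, S q -> d <= norm2 (sub2 p q)) /\
  (forall eps, 0 < eps -> exists q, S q /\ norm2 (sub2 p q) < d + eps).
Proof.
  intros E. destruct (Glb_Rbar_correct (fun d => exists q, S q /\ d = norm2 (sub2 p q)))
    as [Hlb Hgr].
  unfold dist_set in E. rewrite E in Hlb, Hgr. split.
  - intros q Hq. apply (Hlb (norm2 (sub2 p q))). now exists q.
  - intros eps He. apply NNPP. intros Hn.
    assert (hle : Rbar_le (Finite (d + eps)) (Finite d)).
    { apply Hgr. intros _ [q [Hq ->]]. simpl. apply Rnot_lt_le. intros Hlt. apply Hn.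
      now exists q. }
    simpl in hle. lra.
Qed.

Lemma dist_sphere_le (f : C2 -> C) (p : C2) (dd : R) :
  dist_set p (Xr f (norm2 p)) = Finite dd -> dd <= 2 * norm2 p.
Proof.
  intros E. destruct (dist_set_spec _ _ _ E) as [hlb hnear].
  destruct (hnear 1 ltac:(lra)) as [s [Hs _]]. specialize (hlb s Hs).
  assert (htri := norm2_sub_le p s). rewrite (proj2 Hs) in htri. lra.
Qed.

Lemma norm2_sub_vertical_le (p : C2) (b : C) : norm2 (sub2 p (fst p, b)) <= Cmod (snd p - b).
Proof.
  eapply Rle_trans; [apply norm2_le_sum|]. unfold sub2; cbn [fst snd].
  unfold Cminus at 1. rewrite Cplus_opp_r, Cmod_0. lra.
Qed.

Lemma norm2_scal_R (t : R) (p : C2) : 0 <= t -> norm2 (scal2 (RtoC t) p) = t * norm2 p.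
Proof. intros Ht. now rewrite norm2_scal, Cmod_R, Rabs_pos_eq. Qed.

Lemma norm2_scal_minus (t : R) (p : C2) :
  norm2 (sub2 (scal2 (RtoC t) p) p) = Rabs (t - 1) * norm2 p.
Proof.
  rewrite <- Cmod_R, <- norm2_scal. f_equal. destruct p. unfold sub2, scal2; simpl.
  rewrite RtoC_minus. f_equal; ring.
Qed.

Lemma Rabs_norm2_minus_le (p q : C2) : Rabs (norm2 p - norm2 q) <= norm2 (sub2 p q).
Proof.
  assert (h1 := norm2_sub_ge p q). assert (h2 := norm2_sub_ge q p). rewrite norm2_sub_sym in h2.
  apply Rabs_le. lra.
Qed.

Lemma near_ray_meets_sphere (m : nat) (y : R -> C2) (q : C2) (L r : R) : (1 <= m)%nat ->
  (forall s t, 0 <= s <= 3 -> 0 <= t <= 3 -> norm2 (sub2 (y s) (y t)) <= L * Rabs (s - t)) ->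
  (forall t, 0 <= t <= 2 ->
     norm2 (sub2 (y t) (scal2 (RtoC (t ^ m)) q)) <= / 4 * (Rabs (t ^ m - 1) * norm2 q)) ->
  0 < norm2 q -> 7 / 10 * norm2 q <= r <= 3 / 2 * norm2 q ->
  exists t, 0 <= t <= 2 /\ norm2 (y t) = r /\ norm2 (sub2 (y t) q) <= 5 / 3 * Rabs (r - norm2 q).
Proof.
  intros Hm HL Hy HN Hr. set (N := norm2 q) in *.
  assert (Hn : forall t, 0 <= t <= 2 ->
    Rabs (norm2 (y t) - t ^ m * N) <= / 4 * (Rabs (t ^ m - 1) * N)).
  { intros t Ht. eapply Rle_trans; [|apply Hy, Ht].
    unfold N. rewrite <- norm2_scal_R by (apply pow_le; lra). apply Rabs_norm2_minus_le. }
  destruct (ivt_lipschitz (fun t => norm2 (y t)) L 0 3 (/ 2) 2 r) as [t [Ht Et]]; try lra.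
  - intros s t Hs Ht. eapply Rle_trans; [apply Rabs_norm2_minus_le|apply HL; lra].
  - assert (hNhalf := Hn (/ 2) ltac:(lra)). assert (hN2 := Hn 2 ltac:(lra)).
    assert (hp1 := pow_le_self (/ 2) m Hm ltac:(lra)).
    assert (hp2 : 2 <= 2 ^ m) by (rewrite <- (pow_1 2) at 1; apply Rle_pow; [lra|exact Hm]).
    rewrite (Rabs_left1 ((/ 2) ^ m - 1)) in hNhalf by lra.
    rewrite (Rabs_pos_eq (2 ^ m - 1)) in hN2 by lra.
    apply Rabs_le_between in hNhalf, hN2. split; nra.
  - exists t. split; [lra|]. split; [exact Et|].
    assert (hyt := Hy t ltac:(lra)). assert (hNt := Hn t ltac:(lra)). rewrite Et in hNt.
    assert (hyq := norm2_triangle (y t) (scal2 (RtoC (t ^ m)) q) q).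
    rewrite norm2_scal_minus in hyq. fold N in hyq.
    assert (EN : Rabs (t ^ m - 1) * N = Rabs (t ^ m * N - N)).
    { rewrite <- (Rabs_pos_eq N) at 1 by lra. rewrite <- Rabs_mult. f_equal. ring. }
    assert (htri := Rabs_triang (t ^ m * N - r) (r - N)).
    replace (t ^ m * N - r + (r - N)) with (t ^ m * N - N) in htri by ring.
    rewrite (Rabs_minus_sym (t ^ m * N) r) in htri. lra.
Qed.

Lemma bounded_linear_0 (K : R) (J : C2 -> C2) : bounded_linear K J -> J zero2 = zero2.
Proof. intros [Jsub _]. rewrite <- (sub2_diag zero2) at 1. now rewrite Jsub, sub2_diag. Qed.

Lemma dist_le_max (A dd r X E D0 D : R) (m b N : nat) : (1 <= m)%nat -> (b <= N)%nat ->
  1 <= A -> 0 <= r -> 0 <= X ->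
  D0 <= A * dd -> D <= D0 + E -> E <= A * X ^ b -> X ^ m <= A * r ^ m ->
  D <= (A + A * A ^ N) * Rmax dd (r ^ b).
Proof.
  intros Hm HbN HA Hr HX H0 HD HE HXr.
  assert (hXb := root_bound_pow_le A X r m b N Hm HA HX Hr HbN HXr).
  assert (hdd := Rmax_l dd (r ^ b)). assert (hrb := Rmax_r dd (r ^ b)).
  assert (hA : 0 <= A * A ^ N) by (apply Rmult_le_pos; [|apply pow_le]; lra).
  apply (Rmult_le_compat_l (A * A ^ N)) in hrb; [|exact hA].
  apply (Rmult_le_compat_l A) in hdd; [|lra]. apply (Rmult_le_compat_l A) in hXb; [|lra]. lra.
Qed.

Lemma max_le_dist (A dd r X E D0 D : R) (m b N : nat) : (1 <= m <= b)%nat -> (b <= N)%nat ->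
  1 <= A -> 0 <= r <= 1 -> 0 <= X -> 0 <= D ->
  D0 <= A * dd -> dd <= A * D -> E <= D0 + D -> X ^ b <= A * E -> r ^ m <= A * (X ^ m + dd) ->
  Rmax dd (r ^ b) <= (2 * A * A + (2 * A) ^ N * (A * (A * A + 1))) * D.
Proof.
  intros Hm HbN HA Hr HX HD H0 Hdd HE HXE HrX.
  assert (hAN : 0 <= (2 * A) ^ N) by (apply pow_le; lra).
  assert (hterm : A * D <= 2 * A * A * D) by (apply Rmult_le_compat_r; nra).
  assert (hterm0 : 0 <= (2 * A) ^ N * (A * (A * A + 1)) * D) by (repeat apply Rmult_le_pos; nra).
  rewrite Rmult_plus_distr_r. apply Rmax_lub; [lra|].
  destruct (Rle_dec (A * dd) (r ^ m / 2)) as [h|h].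
  - assert (hr := root_bound_pow_le (2 * A) r X m b N ltac:(lia) ltac:(lra) ltac:(lra)
      HX HbN ltac:(lra)).
    assert (hX : X ^ b <= A * (A * A + 1) * D) by nra.
    apply (Rmult_le_compat_l _ _ _ hAN) in hX. assert (0 <= 2 * A * A * D) by nra. lra.
  - assert (hr : r ^ b <= r ^ m) by (apply pow_le_exponent; [lra|lia]).
    nra.
Qed.

(* The sizes of the factors of [f] at distance [dd] from the curve on the sphere of radius
   [r ^ m]. *)
Definition dist_profile (B : nat -> nat) (r dd : R) (i : nat) : R :=
  match i with O => dd | S _ => Rmax dd (r ^ B i) end.

Definition order_profile (f : C2 -> C) (m : nat) (B : nat -> nat) : Prop :=
  exists A delta, 0 < A /\ 0 < delta /\ forall p r dd,
    norm2 p < delta -> 0 <= r -> r ^ m = norm2 p -> 0 < dd ->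
    dist_set p (Xr f (norm2 p)) = Finite dd ->
    comparable A (Cmod (f p)) (rprod (dist_profile B r dd) m).

Section Curve.
Context (rho0 K0 : R) (Phi J : C2 -> C2).
Hypothesis HPhi : chart_linearization rho0 K0 Phi J.
Context (m : nat) (Psi : C -> C) (B : nat -> nat) (rho K : R).
Hypothesis HPsi : puiseux_branches m Psi B rho K.
Context (f : C2 -> C) (q : C -> C2) (d eta : R).
Hypothesis Hd : 0 < d <= rho / K.
Hypothesis Hbil : bilipschitz_on eta (2 * K0) Phi.
Hypothesis Hq : forall x, Cmod x < d ->
  norm2 (q x) <= eta /\ Phi (q x) = ((x ^ m)%C, Psi x) /\ f (q x) = RtoC 0.

Lemma curve_dist_le (x y : C) : Cmod x < d -> Cmod y < d ->
  norm2 (sub2 (q x) (q y)) <= 2 * K0 * (Cmod (x ^ m - y ^ m) + Cmod (Psi x - Psi y)).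
Proof.
  intros Hx Hy. destruct HPhi as [_ [HK0 _]].
  destruct (Hq x Hx) as [hqx [Eqx _]]. destruct (Hq y Hy) as [hqy [Eqy _]].
  destruct (Hbil (q x) (q y) hqx hqy) as [hdist _]. eapply Rle_trans; [exact hdist|].
  apply Rmult_le_compat_l; [lra|]. rewrite Eqx, Eqy. apply norm2_le_sum.
Qed.

Lemma chart_norm (p : C2) : norm2 p <= eta ->
  norm2 p <= 2 * K0 * norm2 (Phi p) /\ norm2 (Phi p) <= 2 * K0 * norm2 p.
Proof. now apply bilipschitz_norm; [|apply HPhi]. Qed.

Lemma curve_norm (x : C) : Cmod x < d ->
  norm2 (q x) <= 4 * K0 * Cmod x ^ m /\ Cmod x ^ m <= 2 * K0 * norm2 (q x).
Proof.
  intros Hx. destruct (Hq x Hx) as [hqx [Eqx _]]. destruct HPhi as [_ [HK0 _]].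
  destruct (chart_norm (q x) hqx) as [hup hlow]. rewrite Eqx in hup, hlow.
  assert (hsum := norm2_le_sum ((x ^ m)%C, Psi x)). assert (hfst := Cmod_fst_le ((x ^ m)%C, Psi x)).
  cbn [fst snd] in hsum, hfst. rewrite Cmod_pow in hsum, hfst.
  assert (hPsi := Psi_le_pow m Psi B rho K HPsi x ltac:(lra)). split; [|lra].
  eapply Rle_trans; [exact hup|].
  replace (4 * K0 * Cmod x ^ m) with (2 * K0 * (Cmod x ^ m + Cmod x ^ m)) by ring.
  apply Rmult_le_compat_l; lra.
Qed.

Lemma Psi_ray_le (x : C) (t : R) : Cmod x <= rho / 2 -> 0 <= t <= 2 ->
  Cmod (Psi (RtoC t * x)%C - Psi x) <= K * 2 ^ m * Cmod x * (Rabs (t ^ m - 1) * Cmod x ^ m).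
Proof.
  destruct HPsi as [Hm [_ [HK [_ [Hlip _]]]]]. intros Hx Ht. assert (hx := Cmod_ge_0 x).
  eapply Rle_trans; [apply (Hlip (2 * Cmod x))|]; try lra.
  - rewrite Cmod_scal_R; nra.
  - replace (RtoC t * x - x)%C with (RtoC (t - 1) * x)%C by (rewrite RtoC_minus; ring).
    rewrite Cmod_mult, Cmod_R, Rpow_mult_distr.
    replace (K * 2 ^ m * Cmod x * (Rabs (t ^ m - 1) * Cmod x ^ m))
      with (K * (2 ^ m * Cmod x ^ m) * (Rabs (t ^ m - 1) * Cmod x)) by ring.
    assert (h2m : 0 < 2 ^ m) by (apply pow_lt; lra).
    assert (hxm : 0 <= Cmod x ^ m) by now apply pow_le.
    apply Rmult_le_compat_l; [apply Rmult_le_pos; [lra|apply Rmult_le_pos; lra]|].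
    apply Rmult_le_compat_r; [exact hx|]. apply Rabs_minus_1_le_pow; [exact Hm|lra].
Qed.

Lemma ray_deviation_le (eps : R) (P P' : C2) (t : R) :
  norm2 (sub2 (sub2 P' P) (sub2 (J (Phi P')) (J (Phi P)))) <= eps * norm2 (sub2 P' P) ->
  norm2 (sub2 P (J (Phi P))) <= eps * norm2 P ->
  norm2 (sub2 P' (scal2 (RtoC t) P)) <=
  eps * norm2 (sub2 P' P) + K0 * norm2 (sub2 (Phi P') (scal2 (RtoC t) (Phi P)))
  + Rabs (t - 1) * (eps * norm2 P).
Proof.
  destruct HPhi as [_ [_ [[Jsub [Jscal Jle]] _]]]. intros H1 H2.
  replace (sub2 P' (scal2 (RtoC t) P)) with
    (sub2 (add2 (sub2 (sub2 P' P) (sub2 (J (Phi P')) (J (Phi P))))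
       (J (sub2 (Phi P') (scal2 (RtoC t) (Phi P))))) (scal2 (RtoC (t - 1)) (sub2 P (J (Phi P))))).
  - eapply Rle_trans; [apply norm2_sub_le|]. rewrite norm2_scal, Cmod_R.
    apply Rplus_le_compat; [|apply Rmult_le_compat_l; [apply Rabs_pos|exact H2]].
    eapply Rle_trans; [apply norm2_add_le|]. apply Rplus_le_compat; [exact H1|apply Jle].
  - rewrite Jsub, Jscal, RtoC_minus. destruct P, P', (J (Phi _)), (J (Phi _)).
    unfold sub2, add2, scal2; simpl. f_equal; ring.
Qed.

Lemma curve_ray_dist_le (x : C) (t : R) :
  Cmod x < d / 2 -> K * 2 ^ m * Cmod x <= 1 -> 0 <= t <= 2 ->
  norm2 (sub2 (q (RtoC t * x)%C) (q x)) <= 4 * K0 * (Rabs (t ^ m - 1) * Cmod x ^ m).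
Proof.
  intros Hx HA Ht. destruct HPhi as [_ [HK0 _]].
  destruct (rho_div_K_le m Psi B rho K HPsi) as [HrK _]. assert (hx := Cmod_ge_0 x).
  eapply Rle_trans; [apply curve_dist_le; [rewrite Cmod_scal_R by lra; nra|lra]|].
  rewrite Cpow_mult_l.
  replace (RtoC t ^ m * x ^ m - x ^ m)%C with (RtoC (t ^ m - 1) * x ^ m)%C
    by (rewrite RtoC_minus, RtoC_pow; ring).
  rewrite Cmod_mult, Cmod_R, Cmod_pow. assert (h := Psi_ray_le x t ltac:(lra) Ht).
  assert (hTX : 0 <= Rabs (t ^ m - 1) * Cmod x ^ m)
    by (apply Rmult_le_pos; [apply Rabs_pos|now apply pow_le]).
  apply (Rmult_le_compat_r _ _ _ hTX) in HA.
  apply Rle_trans with (2 * K0 * (2 * (Rabs (t ^ m - 1) * Cmod x ^ m)));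
    [apply Rmult_le_compat_l|]; lra.
Qed.

Lemma curve_ray_slope_le (x : C) (t : R) : Cmod x < d / 2 -> 0 <= t <= 2 ->
  norm2 (sub2 (Phi (q (RtoC t * x)%C)) (scal2 (RtoC (t ^ m)) (Phi (q x))))
  <= 2 * (K * 2 ^ m) * Cmod x * (Rabs (t ^ m - 1) * Cmod x ^ m).
Proof.
  intros Hx Ht. destruct HPsi as [_ [_ [HK _]]].
  destruct (rho_div_K_le m Psi B rho K HPsi) as [HrK _].
  assert (hx := Cmod_ge_0 x). assert (hX : 0 <= Cmod x ^ m) by now apply pow_le.
  assert (hy : Cmod (RtoC t * x) < d) by (rewrite Cmod_scal_R by lra; nra).
  rewrite (proj1 (proj2 (Hq _ hy))), (proj1 (proj2 (Hq x ltac:(lra)))).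
  eapply Rle_trans; [apply norm2_le_sum|]. unfold sub2, scal2; cbn [fst snd].
  replace ((RtoC t * x) ^ m - RtoC (t ^ m) * x ^ m)%C with (RtoC 0)
    by (rewrite Cpow_mult_l, RtoC_pow; ring).
  replace (Psi (RtoC t * x)%C - RtoC (t ^ m) * Psi x)%C
    with (Psi (RtoC t * x)%C - Psi x - RtoC (t ^ m - 1) * Psi x)%C by (rewrite RtoC_minus; ring).
  rewrite Cmod_0, Rplus_0_l. eapply Rle_trans; [apply Cmod_minus_le|]. rewrite Cmod_mult, Cmod_R.
  assert (hray := Psi_ray_le x t ltac:(lra) Ht).
  assert (hPsi := Psi_le m Psi B rho K HPsi x ltac:(lra)).
  apply (Rmult_le_compat_l _ _ _ (Rabs_pos (t ^ m - 1))) in hPsi.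
  assert (H2m : 1 <= 2 ^ m) by (apply pow_R1_Rle; lra).
  assert (hpos : 0 <= K * Cmod x * (Rabs (t ^ m - 1) * Cmod x ^ m))
    by (repeat apply Rmult_le_pos; try apply Rabs_pos; lra).
  apply (Rmult_le_compat_r _ _ _ hpos) in H2m. lra.
Qed.

(* [J] makes the chart tangent to the identity, and in the chart the point of parameter [t * x] is
   close to [t ^ m] times the point of parameter [x]. *)
Lemma curve_near_ray (eps : R) : 0 < eps -> exists delta, 0 < delta <= d / 3 /\
  forall x t, Cmod x < delta -> 0 <= t <= 2 ->
    norm2 (sub2 (q (RtoC t * x)%C) (scal2 (RtoC (t ^ m)) (q x)))
      <= eps * (Rabs (t ^ m - 1) * Cmod x ^ m).
Proof.
  intros Heps. destruct HPhi as [_ [HK0 [HJlin [_ [Phi0 [Htan _]]]]]].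
  destruct HPsi as [Hm [Hrho [HK _]]]. destruct (rho_div_K_le m Psi B rho K HPsi) as [HrK _].
  set (e := eps / (16 * K0)). assert (He : 0 < e) by (apply Rdiv_lt_0_compat; lra).
  destruct (Htan e He) as [del [Hdel HJ]].
  assert (H2m : 1 <= 2 ^ m) by (apply pow_R1_Rle; lra).
  set (A := K * 2 ^ m). assert (HA : 1 <= A) by (unfold A; nra).
  assert (HAA : A <= A * K0) by nra.
  destruct (pos_lower_bound3 del 1 eps Hdel Rlt_0_1 Heps) as [mu [Hmu [Hmudel [Hmu1 Hmueps]]]].
  set (x0 := mu / (8 * (A * K0))). assert (Ex0 : 8 * (A * K0) * x0 = mu) by (unfold x0; field; lra).
  assert (Hx0 : 0 < x0) by (apply Rdiv_lt_0_compat; lra).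
  destruct (pos_lower_bound2 (d / 3) x0 ltac:(lra) Hx0) as [delta [Hdelta [Hdeltad Hdeltax0]]].
  exists delta. split; [lra|]. intros x t Hx Ht. assert (hx := Cmod_ge_0 x).
  assert (hx8 : 8 * (A * K0) * Cmod x <= mu) by (rewrite <- Ex0; apply Rmult_le_compat_l; lra).
  assert (hsmall : forall z, Cmod z <= 2 * Cmod x -> norm2 (q z) < del).
  { intros z Hz. eapply Rle_lt_trans; [apply curve_norm; lra|].
    assert (hz := pow_le_self (Cmod z) m Hm ltac:(split; [apply Cmod_ge_0|lra])). nra. }
  assert (HJq : norm2 (sub2 (q x) (J (Phi (q x)))) <= e * norm2 (q x)).
  { assert (h := HJ (q x) zero2 (hsmall x ltac:(lra)) ltac:(rewrite norm2_zero; lra)).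
    now rewrite Phi0, (bounded_linear_0 _ _ HJlin), !sub2_zero_r in h. }
  eapply Rle_trans; [apply (ray_deviation_le e); [apply HJ; apply hsmall|exact HJq]|];
    [rewrite Cmod_scal_R by lra; nra|lra|].
  assert (hslope := curve_ray_slope_le x t ltac:(lra) Ht).
  assert (hdist := curve_ray_dist_le x t ltac:(lra) ltac:(fold A; nra) Ht).
  assert (hqx := proj1 (curve_norm x ltac:(lra))).
  fold A in hslope. set (T := Rabs (t ^ m - 1)) in *. set (X := Cmod x ^ m) in *.
  assert (HT : 0 <= T) by apply Rabs_pos.
  assert (HTX : 0 <= T * X) by (apply Rmult_le_pos; [|apply pow_le]; lra).
  apply (Rmult_le_compat_l (e * T)) in hqx; [|apply Rmult_le_pos; lra].
  apply (Rmult_le_compat_l e) in hdist; [|lra]. apply (Rmult_le_compat_l K0) in hslope; [|lra].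
  assert (hfin : 8 * (A * K0) * Cmod x * (T * X) <= 16 * K0 * e * (T * X)).
  { apply Rmult_le_compat_r; [exact HTX|]. replace (16 * K0 * e) with eps by (unfold e; field; lra).
    lra. }
  replace (eps * (T * X)) with (16 * K0 * e * (T * X)) by (unfold e; field; lra).
  assert (0 <= K0 * e * (T * X)) by (apply Rmult_le_pos; [apply Rmult_le_pos; lra|exact HTX]). lra.
Qed.

Lemma curve_ray_lipschitz (x : C) :
  Cmod x < d / 3 -> exists L, forall u t, 0 <= u <= 3 -> 0 <= t <= 3 ->
  norm2 (sub2 (q (RtoC u * x)%C) (q (RtoC t * x)%C)) <= L * Rabs (u - t).
Proof.
  destruct HPhi as [_ [HK0 _]]. destruct HPsi as [_ [Hrho [HK [_ [Hlip _]]]]].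
  destruct (rho_div_K_le m Psi B rho K HPsi) as [HrK _]. intros Hx. assert (hx := Cmod_ge_0 x).
  destruct (pow_lipschitz 3 m ltac:(lra)) as [Lm [_ Hpow]].
  assert (hray : forall t, 0 <= t <= 3 -> Cmod (RtoC t * x) < d)
    by (intros t Ht; rewrite Cmod_scal_R; nra).
  exists (2 * K0 * (Lm + K)). intros u t Hu Ht.
  eapply Rle_trans; [apply curve_dist_le; now apply hray|].
  rewrite (Rmult_assoc (2 * K0)), Rmult_plus_distr_r. apply Rmult_le_compat_l; [lra|].
  apply Rplus_le_compat.
  - rewrite !Cpow_mult_l, <- !RtoC_pow.
    replace (RtoC (u ^ m) * x ^ m - RtoC (t ^ m) * x ^ m)%C with (RtoC (u ^ m - t ^ m) * x ^ m)%C
      by (rewrite RtoC_minus; ring).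
    rewrite Cmod_mult, Cmod_R, Cmod_pow, <- (Rmult_1_r (Lm * _)).
    apply Rmult_le_compat; auto using Rabs_pos; [now apply pow_le|].
    rewrite <- (pow1 m). apply pow_incr. lra.
  - assert (hut : Cmod (RtoC u * x - RtoC t * x) <= Rabs (u - t)).
    { replace (RtoC u * x - RtoC t * x)%C with (RtoC (u - t) * x)%C by (rewrite RtoC_minus; ring).
      rewrite Cmod_mult, Cmod_R. assert (h := Rabs_pos (u - t)). nra. }
    eapply Rle_trans; [apply (Hlip rho); [| |lra]; apply Rlt_le, Rlt_le_trans with d; auto; lra|].
    apply Rmult_le_compat; try exact hut; try apply Cmod_ge_0;
      [apply Rmult_le_pos; [|apply pow_le]; lra|].
    rewrite <- (Rmult_1_r K) at 2. apply Rmult_le_compat_l; [lra|].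
    rewrite <- (pow1 m). apply pow_incr. lra.
Qed.

Lemma dist_sphere_le_dist_curve :
  exists delta, 0 < delta <= d / 3 /\ forall x p dd, Cmod x < delta ->
  dist_set p (Xr f (norm2 p)) = Finite dd -> dd <= 7 * norm2 (sub2 p (q x)).
Proof.
  destruct HPhi as [_ [HK0 _]].
  destruct (curve_near_ray (/ (8 * K0))) as [delta [Hdel Hray]]; [apply Rinv_0_lt_compat; lra|].
  exists delta. split; [exact Hdel|]. intros x p dd Hx E.
  destruct (dist_set_spec _ _ _ E) as [Hlb _].
  assert (hpq := norm2_sub_ge p (q x)). assert (hqp := norm2_sub_ge (q x) p).
  rewrite (norm2_sub_sym (q x) p) in hqp.
  assert (hq := norm2_ge_0 (q x)).
  assert (h2p := dist_sphere_le f p dd E).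
  destruct (Rlt_dec (norm2 p) (7 / 10 * norm2 (q x))) as [Hlow|Hlow]; [lra|].
  destruct (Rlt_dec (3 / 2 * norm2 (q x)) (norm2 p)) as [Hhigh|Hhigh]; [lra|].
  destruct (Rle_lt_or_eq_dec 0 (norm2 (q x)) hq) as [Hpos|Hzero]; [|lra].
  destruct (curve_ray_lipschitz x ltac:(lra)) as [L HL].
  destruct (near_ray_meets_sphere m (fun t => q (RtoC t * x)%C) (q x) L (norm2 p) (proj1 HPsi) HL)
    as [t [Ht [Et Hnear]]]; try lra.
  - intros t Ht. eapply Rle_trans; [apply Hray; [exact Hx|exact Ht]|].
    assert (hN := proj2 (curve_norm x ltac:(lra))). assert (hT := Rabs_pos (t ^ m - 1)).
    apply (Rmult_le_compat_l (/ (8 * K0) * Rabs (t ^ m - 1))) in hN;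
      [|apply Rmult_le_pos; [apply Rlt_le, Rinv_0_lt_compat|]; lra].
    rewrite <- Rmult_assoc. eapply Rle_trans; [exact hN|]. right. field. lra.
  - assert (hty : Cmod (RtoC t * x) < d)
      by (rewrite Cmod_scal_R by lra; assert (hx := Cmod_ge_0 x); nra).
    specialize (Hlb _ (conj (proj2 (proj2 (Hq _ hty))) Et)).
    assert (htri := norm2_triangle p (q x) (q (RtoC t * x)%C)).
    rewrite (norm2_sub_sym (q x)) in htri. assert (hrad := Rabs_norm2_minus_le p (q x)). lra.
Qed.

Context (eta0 : R).
Hypothesis Heta : 0 < eta0 <= eta.
Hypothesis Hzero : forall p, norm2 p <= eta0 -> f p = RtoC 0 ->
  exists x, Cmod x < d /\ Phi p = ((x ^ m)%C, Psi x).

Lemma small_root_of_chart (delta : R) : 0 < delta -> exists delta', 0 < delta' <= eta0 /\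
  forall p x, norm2 p < delta' -> (x ^ m)%C = fst (Phi p) -> Cmod x < delta.
Proof.
  intros Hdel. destruct HPhi as [_ [HK0 _]]. assert (hm : 0 < delta ^ m) by now apply pow_lt.
  destruct (pos_lower_bound2 eta0 (delta ^ m / (2 * K0))) as [delta' [Hdel' [Hdeleta Hdelm]]];
    [lra|apply Rdiv_lt_0_compat; lra|].
  exists delta'. split; [lra|].
  intros p x Hp Ex. apply pow_lt_inv with m; [lra|]. rewrite <- Cmod_pow, Ex.
  eapply Rle_lt_trans; [apply Cmod_fst_le|]. eapply Rle_lt_trans; [apply chart_norm; lra|].
  replace (delta ^ m) with (2 * K0 * (delta ^ m / (2 * K0))) by (field; lra).
  apply Rmult_lt_compat_l; lra.
Qed.

Lemma dist_sphere_le_branch_dist :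
  exists delta, 0 < delta <= eta0 /\ forall p x i dd, norm2 p < delta ->
  dist_set p (Xr f (norm2 p)) = Finite dd -> (x ^ m)%C = fst (Phi p) ->
  dd <= 14 * K0 * Cmod (snd (Phi p) - branch m Psi i x).
Proof.
  destruct dist_sphere_le_dist_curve as [delta0 [Hdel0 Hdist]].
  destruct (small_root_of_chart delta0 ltac:(lra)) as [delta [Hdel Hsmall]].
  exists delta. split; [exact Hdel|]. intros p x i dd Hp E Ex.
  assert (Hx : Cmod (zeta m ^ i * x) < delta0).
  { rewrite Cmod_zeta_mult. now apply (Hsmall p). }
  eapply Rle_trans; [apply (Hdist _ _ _ Hx E)|].
  destruct (Hq (zeta m ^ i * x)%C ltac:(lra)) as [hqx [Eqx _]].
  destruct (Hbil p (q (zeta m ^ i * x)%C) ltac:(lra) hqx) as [hdist _]. rewrite Eqx in hdist.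
  rewrite (zeta_mult_pow m Psi B rho K HPsi), Ex in hdist.
  assert (hvert := norm2_sub_vertical_le (Phi p) (branch m Psi i x)). unfold branch in hvert at 1.
  destruct HPhi as [_ [HK0 _]]. apply (Rmult_le_compat_l (2 * K0)) in hvert; lra.
Qed.

Lemma nearest_branch_dist_le :
  exists delta, 0 < delta <= eta0 /\ forall p dd, norm2 p < delta -> 0 < dd ->
  dist_set p (Xr f (norm2 p)) = Finite dd ->
  exists x, (x ^ m)%C = fst (Phi p) /\
    Cmod (snd (Phi p) - Psi x) <= 4 * K0 * (1 + 4 * K * 2 ^ m) * dd.
Proof.
  destruct HPhi as [_ [HK0 _]]. assert (Hbr := HPsi). destruct Hbr as [_ [_ [HK _]]].
  destruct (rho_div_K_le m Psi B rho K HPsi) as [HrK _].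
  destruct (pos_lower_bound2 eta0 (rho ^ m / (2 * K0))) as [delta [Hdel [Hdeleta Hdelrho]]];
    [lra|apply Rdiv_lt_0_compat; [apply pow_lt|]; lra|].
  exists delta. split; [lra|].
  intros p dd Hp Hdd E. destruct (dist_set_spec _ _ _ E) as [_ Hnear].
  destruct (Hnear dd Hdd) as [s [[Hfs Hs] Hps]].
  destruct (Hzero s ltac:(lra) Hfs) as [y [Hy Ey]].
  destruct (Hbil p s ltac:(lra) ltac:(lra)) as [_ hbil]. rewrite Ey in hbil.
  assert (hfst := Cmod_fst_le (sub2 (Phi p) ((y ^ m)%C, Psi y))).
  assert (hsnd := Cmod_snd_le (sub2 (Phi p) ((y ^ m)%C, Psi y))). cbn [sub2 fst snd] in hfst, hsnd.
  assert (hps : 2 * K0 * norm2 (sub2 p s) <= 4 * K0 * dd).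
  { replace (4 * K0 * dd) with (2 * K0 * (dd + dd)) by ring. apply Rmult_le_compat_l; lra. }
  assert (Hw : Cmod (fst (Phi p)) <= rho ^ m).
  { eapply Rle_trans; [apply Cmod_fst_le|]. eapply Rle_trans; [apply chart_norm; lra|].
    replace (rho ^ m) with (2 * K0 * (rho ^ m / (2 * K0))) by (field; lra).
    apply Rmult_le_compat_l; lra. }
  destruct (Psi_multivalued_lipschitz m Psi B rho K HPsi y _ ltac:(lra) Hw) as [x [Ex [_ Hxy]]].
  exists x. split; [exact Ex|].
  replace (snd (Phi p) - Psi x)%C with (snd (Phi p) - Psi y - (Psi x - Psi y))%C by ring.
  eapply Rle_trans; [apply Cmod_minus_le|].
  assert (hslope : 0 <= 4 * K * 2 ^ m) by (repeat apply Rmult_le_pos; try lra; apply pow_le; lra).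
  assert (hw1 : Cmod (fst (Phi p) - y ^ m) <= 4 * K0 * dd) by lra.
  apply (Rmult_le_compat_l _ _ _ hslope) in hw1. lra.
Qed.

Definition branch_dist (p : C2) (x : C) (i : nat) : R := Cmod (snd (Phi p) - branch m Psi i x).

Lemma branch_dist_gap (p : C2) (x : C) (i : nat) :
  branch_dist p x i <= branch_dist p x 0 + Cmod (Psi x - branch m Psi i x) /\
  Cmod (Psi x - branch m Psi i x) <= branch_dist p x 0 + branch_dist p x i.
Proof.
  unfold branch_dist. rewrite branch_0. split; [apply Cmod_minus_triangle|].
  rewrite (Cmod_minus_sym (snd (Phi p)) (Psi x)). apply Cmod_minus_triangle.
Qed.

Lemma nearest_branch : exists A delta, K <= A /\ 0 < delta <= eta0 /\ forall p r dd,
  norm2 p < delta -> 0 <= r -> r ^ m = norm2 p -> 0 < dd ->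
  dist_set p (Xr f (norm2 p)) = Finite dd ->
  exists x, (x ^ m)%C = fst (Phi p) /\ Cmod x <= rho /\ r <= 1 /\ Cmod x ^ m <= A * r ^ m /\
    r ^ m <= A * (Cmod x ^ m + dd) /\ branch_dist p x 0 <= A * dd /\
    forall i, dd <= A * branch_dist p x i.
Proof.
  destruct HPhi as [_ [HK0 _]]. assert (Hbr := HPsi). destruct Hbr as [_ [_ [HK _]]].
  destruct (rho_div_K_le m Psi B rho K HPsi) as [HrK _].
  destruct dist_sphere_le_branch_dist as [delta1 [Hdel1 Hlow]].
  destruct nearest_branch_dist_le as [delta2 [Hdel2 Hnear]].
  destruct (small_root_of_chart (rho / K) ltac:(lra)) as [delta3 [Hdel3 Hsmall]].
  set (H := 4 * K0 * (1 + 4 * K * 2 ^ m)) in *.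
  assert (H2m : 1 <= 2 ^ m) by (apply pow_R1_Rle; lra).
  assert (HK2 : K <= K * 2 ^ m) by nra. assert (HKK : K * 2 ^ m <= K0 * (K * 2 ^ m)) by nra.
  assert (HH : 4 * K0 + 16 * K <= H) by (unfold H; lra). assert (HKH : H <= K0 * H) by nra.
  destruct (pos_lower_bound4 delta1 delta2 delta3 1) as [delta [Hdel [Hle1 [Hle2 [Hle3 Hle4]]]]];
    [lra..|].
  exists (4 * (K0 * H)), delta. split; [lra|]. split; [lra|].
  intros p r dd Hp Hr Er Hdd E.
  destruct (Hnear p dd ltac:(lra) Hdd E) as [x [Ex H0]]. exists x. split; [exact Ex|].
  assert (Hx := Hsmall p x ltac:(lra) Ex). split; [lra|].
  split; [apply Rlt_le, pow_lt_inv with m; [lra|rewrite pow1; lra]|].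
  assert (hX : 0 <= Cmod x ^ m) by apply pow_le, Cmod_ge_0.
  assert (hrm : 0 <= r ^ m) by now apply pow_le.
  assert (hPsi := Psi_le_pow m Psi B rho K HPsi x ltac:(lra)).
  unfold branch_dist. rewrite branch_0. split; [|split; [|split]].
  - rewrite <- Cmod_pow, Ex. eapply Rle_trans; [apply Cmod_fst_le|].
    eapply Rle_trans; [apply chart_norm; lra|]. rewrite <- Er. apply Rmult_le_compat_r; lra.
  - rewrite Er. eapply Rle_trans; [apply chart_norm; lra|].
    assert (hsum := norm2_le_sum (Phi p)). rewrite <- Ex, Cmod_pow in hsum.
    assert (hsnd := Cmod_minus_ge (snd (Phi p)) (Psi x)).
    apply Rle_trans with (2 * K0 * (2 * Cmod x ^ m + H * dd)); [apply Rmult_le_compat_l; lra|].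
    assert (K0 * Cmod x ^ m <= K0 * H * Cmod x ^ m) by (apply Rmult_le_compat_r; nra).
    assert (0 <= K0 * H * dd) by (repeat apply Rmult_le_pos; lra). lra.
  - eapply Rle_trans; [exact H0|]. apply Rmult_le_compat_r; lra.
  - intros i. eapply Rle_trans; [apply (Hlow p x i dd ltac:(lra) E Ex)|].
    apply Rmult_le_compat_r; [apply Cmod_ge_0|]. nra.
Qed.

Lemma branch_dist_comparable : exists A delta, 1 <= A /\ 0 < delta <= eta0 /\ forall p r dd,
  norm2 p < delta -> 0 <= r -> r ^ m = norm2 p -> 0 < dd ->
  dist_set p (Xr f (norm2 p)) = Finite dd ->
  exists x, (x ^ m)%C = fst (Phi p) /\ forall i, (i < m)%nat ->
    comparable A (branch_dist p x i) (dist_profile B r dd i).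
Proof.
  assert (Hbr := HPsi). destruct Hbr as [_ [_ [HK [_ [_ [HB Hsep]]]]]].
  destruct nearest_branch as [A [delta [HA [Hdel Hnear]]]].
  destruct (bounded_on_prefix B m) as [N HN].
  set (Kup := A + A * A ^ N). set (Klow := 2 * A * A + (2 * A) ^ N * (A * (A * A + 1))).
  assert (HKup : A <= Kup).
  { unfold Kup. assert (h : 0 <= A * A ^ N) by (apply Rmult_le_pos; [|apply pow_le]; lra). lra. }
  assert (HKlow : 0 <= Klow).
  { unfold Klow. assert (0 <= (2 * A) ^ N) by (apply pow_le; lra).
    apply Rplus_le_le_0_compat; repeat apply Rmult_le_pos; nra. }
  exists (Kup + Klow), delta. split; [lra|]. split; [exact Hdel|]. intros p r dd Hp Hr Er Hdd E.
  destruct (Hnear p r dd Hp Hr Er Hdd E) as [x [Ex [Hx [Hr1 [HXr [HrX [H0 Hlow]]]]]]].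
  exists x. split; [exact Ex|]. assert (hx := Cmod_ge_0 x).
  assert (hD : forall i, 0 <= branch_dist p x i) by (intros; apply Cmod_ge_0).
  intros [|i] Hi; unfold dist_profile;
    [specialize (Hlow 0%nat); specialize (hD 0%nat); split; nra|].
  assert (hmax := Rle_trans _ _ _ (Rlt_le _ _ Hdd) (Rmax_l dd (r ^ B (S i)))).
  destruct (Hsep (S i) x ltac:(lia) Hx) as [hXgap hgapX].
  destruct (branch_dist_gap p x (S i)) as [hup hlow].
  set (gap := Cmod (Psi x - branch m Psi (S i) x)) in *.
  assert (hgap : 0 <= gap) by apply Cmod_ge_0.
  specialize (HN (S i) Hi). specialize (HB (S i) ltac:(lia)). specialize (hD (S i)). split.
  - eapply Rle_trans; [apply (dist_le_max A dd r (Cmod x) gap (branch_dist p x 0)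
      (branch_dist p x (S i)) m (B (S i)) N); auto; try lia; nra|].
    apply Rmult_le_compat_r; [exact hmax|fold Kup; lra].
  - eapply Rle_trans; [apply (max_le_dist A dd r (Cmod x) gap (branch_dist p x 0)
      (branch_dist p x (S i)) m (B (S i)) N); auto; try lia; nra|].
    apply Rmult_le_compat_r; [exact hD|fold Klow; lra].
Qed.

Lemma order_profile_of_branch_dist (KF : R) : 0 <= KF ->
  (forall p x, norm2 p <= eta0 -> (x ^ m)%C = fst (Phi p) ->
     comparable KF (Cmod (f p)) (rprod (branch_dist p x) m)) ->
  order_profile f m B.
Proof.
  intros HKF Hf. destruct branch_dist_comparable as [A [delta [HC0 [Hdel H]]]].
  assert (hC : 0 < A ^ m) by (apply pow_lt; lra).
  exists ((KF + 1) * A ^ m), delta. split; [apply Rmult_lt_0_compat; lra|]. split; [lra|].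
  intros p r dd Hp Hr Er Hdd E. destruct (H p r dd Hp Hr Er Hdd E) as [x [Ex Hx]].
  assert (hD : forall i, 0 <= branch_dist p x i) by (intros; apply Cmod_ge_0).
  apply comparable_trans with (rprod (branch_dist p x) m); [lra|lra| |].
  - apply comparable_le with KF; [lra|apply Cmod_ge_0|now apply rprod_ge_0|].
    apply Hf; [lra|exact Ex].
  - apply comparable_rprod. intros i Hi. split; [apply hD|]. split; [|now apply Hx].
    destruct i as [|i]; simpl; [lra|]. eapply Rle_trans; [apply Rlt_le, Hdd|apply Rmax_l].
Qed.
End Curve.

(** * Branches of a power series *)

Lemma ser2_rep_fst (M r : R) (a : nat -> C) (h : C -> C) :
  0 < r -> coef_bound M r a -> power_series_on r a h ->
  ser2_rep r (fun i j => if Nat.eqb j 0 then a i else RtoC 0) (fun p => h (fst p)).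
Proof.
  intros Hr Ha Hh. split; [exact Hr|]. split.
  - exists M. intros i [|j]; simpl Nat.eqb; cbv iota; [rewrite Nat.add_0_r; apply Ha|].
    rewrite Cmod_0, Rmult_0_l. now apply (coef_bound_ge0 M r a).
  - intros x y Hx _. exists (fun i => (a i * x ^ i)%C). split; [|now apply Hh].
    intros i. set (u := fun j => ((if Nat.eqb j 0 then a i else 0) * (x ^ i * y ^ j))%C).
    replace (a i * x ^ i)%C with (u 0%nat) by (unfold u; simpl; ring).
    apply (is_cseries_single u). intros [|j] Hj; [contradiction|].
    unfold u. simpl Nat.eqb. cbv iota. ring.
Qed.

Lemma vanishing_series_lipschitz (M r : R) (a : nat -> C) (h : C -> C) (n : nat) (X : R) (x y : C) :
  0 < r -> coef_bound M r a -> power_series_on r a h -> (forall j, (j <= n)%nat -> a j = RtoC 0) ->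
  Cmod x <= X -> Cmod y <= X -> X <= r / 10 ->
  Cmod (h x - h y) <= M * (5 / r) ^ S n * X ^ n * Cmod (x - y).
Proof.
  intros Hr Ha Hh H0 Hx Hy HXr. assert (HM := coef_bound_ge0 M r a Ha).
  assert (E0 : forall z : C, norm2 (z, RtoC 0) <= Cmod z).
  { intros z. assert (h1 := norm2_le_sum (z, RtoC 0)). simpl in h1. rewrite Cmod_0 in h1. lra. }
  destruct (Rle_lt_or_eq_dec 0 X (Rle_trans _ _ _ (Cmod_ge_0 x) Hx)) as [HX|HX].
  - assert (Hlip := lipschitz_of_bound (fun p => h (fst p)) (r / 2) X (2 * M * (5 * X / r) ^ S n)
      (x, RtoC 0) (y, RtoC 0)).
    eapply Rle_trans; [apply Hlip|].
    + exact (ser2_rep_analytic_on_lines r _ _ (ser2_rep_fst M r a h Hr Ha Hh)).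
    + lra.
    + intros w Hw. assert (hw := Cmod_fst_le w). assert (hi := Rinv_0_lt_compat r Hr).
      eapply Rle_trans; [apply (ser1_vanishing_le M r a (fst w) Hr Ha ltac:(lra) (S n))|].
      * intros j Hj. apply H0. lia.
      * apply Hh. lra.
      * apply Rmult_le_compat_l; [lra|]. apply pow_incr. split.
        -- apply Rmult_le_pos; [apply Cmod_ge_0|lra].
        -- apply Rmult_le_compat_r; lra.
    + eapply Rle_trans; [apply E0|exact Hx].
    + eapply Rle_trans; [apply E0|exact Hy].
    + replace (2 * M * (5 * X / r) ^ S n / (2 * X)) with (M * (5 / r) ^ S n * X ^ n).
      * apply Rmult_le_compat_l.
        { assert (0 < 5 / r) by (apply Rdiv_lt_0_compat; lra).
          repeat apply Rmult_le_pos; try apply pow_le; lra. }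
        eapply Rle_trans; [|apply E0]. right. f_equal. unfold sub2; simpl. f_equal. ring.
      * replace (5 * X / r) with (5 / r * X) by (field; lra). rewrite Rpow_mult_distr.
        simpl. field. lra.
  - assert (Ez : forall z : C, Cmod z <= X -> z = RtoC 0).
    { intros z Hz. apply Cmod_le_0. lra. }
    rewrite (Ez x Hx), (Ez y Hy). unfold Cminus. rewrite !Cplus_opp_r, Cmod_0. lra.
Qed.

Lemma ser1_leading_term (M r : R) (b : nat -> C) (n : nat) :
  0 < r -> coef_bound M r b -> (forall j, (j < n)%nat -> b j = RtoC 0) -> b n <> RtoC 0 ->
  exists d K, 0 < d /\ 0 < K /\ forall x l, Cmod x <= d -> ser1 b x l ->
    comparable K (Cmod x ^ n) (Cmod l).
Proof.
  intros Hr Hb H0 Hn. assert (HM := coef_bound_ge0 M r b Hb).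
  assert (Hbn := proj1 (Cmod_gt_0 _) Hn).
  assert (hrn : 0 < r ^ S n) by now apply pow_lt. set (x0 := Cmod (b n) * r ^ S n / (4 * (M + 1))).
  assert (Hx0 : 0 < x0) by (apply Rdiv_lt_0_compat; [now apply Rmult_lt_0_compat|lra]).
  destruct (pos_lower_bound2 (r / 2) x0 ltac:(lra) Hx0) as [d [Hd [Hdr Hdx0]]].
  exists d, (2 * Cmod (b n) + 2 / Cmod (b n)). split; [exact Hd|].
  split; [assert (0 < 2 / Cmod (b n)) by (apply Rdiv_lt_0_compat; lra); lra|].
  intros x l Hx Hl. apply comparable_sym. rewrite <- Cmod_pow.
  apply comparable_of_near; [exact Hn|].
  assert (hx := Cmod_ge_0 x). assert (hxn : 0 <= Cmod x ^ n) by now apply pow_le.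
  assert (h := ser1_taylor_le M r b x Hr Hb ltac:(lra) n l Hl).
  rewrite (sum_n_single (fun k => b k * x ^ k)%C n n) in h by
    (try lia; intros j Hj Hjn; rewrite H0 by lia; apply Cmult_0_l).
  eapply Rle_trans; [exact h|]. rewrite Cmod_pow.
  replace (2 * M * (Cmod x / r) ^ S n) with (2 * M * Cmod x / r ^ S n * Cmod x ^ n)
    by (unfold Rdiv; rewrite Rpow_mult_distr, pow_inv; simpl; field;
        split; [apply pow_nonzero|]; lra).
  apply Rmult_le_compat_r; [exact hxn|]. apply Rmult_le_reg_r with (r ^ S n); [exact hrn|].
  replace (2 * M * Cmod x / r ^ S n * r ^ S n) with (2 * M * Cmod x) by (field; lra).
  apply Rle_trans with (2 * (M + 1) * x0);
    [apply Rmult_le_compat; lra|right; unfold x0; field; lra].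
Qed.

Lemma ser1_branch_gap (m i : nat) (a : nat -> C) (h : C -> C) (r : R) (x : C) :
  power_series_on r a h -> Cmod x < r ->
  ser1 (fun j => a j * (1 - zeta m ^ (i * j)))%C x (h x - branch m h i x)%C.
Proof.
  intros Hh Hx. assert (Hzx : Cmod (zeta m ^ i * x) < r) by now rewrite Cmod_zeta_mult.
  eapply is_series_ext; [|apply (is_cseries_minus _ _ _ _ (Hh x Hx) (Hh _ Hzx))].
  intros j. cbv beta. rewrite Cpow_mult_l, <- Cpow_mult_r. ring_C.
Qed.

Lemma coef_bound_branch_gap (m i : nat) (a : nat -> C) (M r : R) : 0 < r ->
  coef_bound M r a -> coef_bound (2 * M) r (fun j => a j * (1 - zeta m ^ (i * j)))%C.
Proof.
  intros Hr Ha j. rewrite Cmod_mult. assert (h1 := Cmod_minus_le 1 (zeta m ^ (i * j))).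
  rewrite Cmod_1, Cmod_zeta_pow in h1. assert (h2 := Ha j).
  assert (hr : 0 < r ^ j) by now apply pow_lt. assert (ha := Cmod_ge_0 (a j)).
  apply Rle_trans with (Cmod (a j) * 2 * r ^ j); [|lra].
  apply Rmult_le_compat_r; [lra|]. apply Rmult_le_compat_l; lra.
Qed.

(* [B i] is the order of [Psi x - Psi (zeta m ^ i * x)] in [x]. *)
Definition branch_orders (m : nat) (a : nat -> C) (B : nat -> nat) : Prop :=
  forall i, (0 < i < m)%nat -> (m <= B i)%nat /\
    (forall j, (j < B i)%nat -> (a j * (1 - zeta m ^ (i * j)))%C = RtoC 0) /\
    (a (B i) * (1 - zeta m ^ (i * B i)))%C <> RtoC 0.

Lemma branch_gap_comparable (m : nat) (a : nat -> C) (Psi : C -> C) (B : nat -> nat) (M r : R) :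
  0 < r -> coef_bound M r a -> power_series_on r a Psi -> branch_orders m a B ->
  exists d K, 0 < d /\ 0 < K /\ forall i x, (0 < i < m)%nat -> Cmod x <= d -> Cmod x < r ->
    comparable K (Cmod x ^ B i) (Cmod (Psi x - branch m Psi i x)).
Proof.
  intros Hr HM HPsi HB.
  destruct (uniform_constants (fun i d K => (0 < i)%nat -> forall x, Cmod x <= d -> Cmod x < r ->
    comparable K (Cmod x ^ B i) (Cmod (Psi x - branch m Psi i x))) m) as [d [K [Hd [HK Hsep]]]].
  - intros i d d' K K' Hdd HKK H Hi x Hx Hxr.
    apply comparable_le with K; [lra|apply pow_le, Cmod_ge_0|apply Cmod_ge_0|].
    apply H; [exact Hi| |]; lra.
  - intros i Hi. destruct i as [|i]; [exists 1, 1; split; [lra|]; split; [lra|]; lia|].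
    destruct (HB (S i) ltac:(lia)) as [_ [Hlow Hlead]].
    destruct (ser1_leading_term (2 * M) r _ (B (S i)) Hr
      (coef_bound_branch_gap m (S i) a M r Hr HM) Hlow Hlead) as [d [K [Hd [HK H]]]].
    exists d, K. split; [exact Hd|]. split; [exact HK|]. intros _ x Hx Hxr. apply H; [exact Hx|].
    now apply (ser1_branch_gap m (S i) a Psi r).
  - exists d, K. split; [exact Hd|]. split; [exact HK|]. intros i x Hi. apply Hsep; lia.
Qed.

Lemma puiseux_branches_of_series (m : nat) (a : nat -> C) (Psi : C -> C) (B : nat -> nat) (r : R) :
  (1 <= m)%nat -> 0 < r -> (forall j, (j <= m)%nat -> a j = RtoC 0) -> power_series_on r a Psi ->
  branch_orders m a B -> exists rho K, rho < r /\ puiseux_branches m Psi B rho K.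
Proof.
  intros Hm Hr H0 HPsi HB.
  destruct (power_series_on_coef_bound r a Psi (r / 2) HPsi ltac:(lra)) as [M HM].
  assert (HPsi2 : power_series_on (r / 2) a Psi) by (intros z Hz; apply HPsi; lra).
  destruct (branch_gap_comparable m a Psi B M (r / 2) ltac:(lra) HM HPsi2 HB)
    as [d [K [Hd [_ Hsep]]]].
  set (L := M * (5 / (r / 2)) ^ S m). set (K' := Rmax 1 (Rmax K L)).
  assert (HK1 : 1 <= K') by apply Rmax_l.
  assert (HKK' : K <= K') by (eapply Rle_trans; [apply Rmax_l|apply Rmax_r]).
  assert (HLK' : L <= K') by (eapply Rle_trans; [apply Rmax_r|apply Rmax_r]).
  destruct (pos_lower_bound3 1 d (r / 20) Rlt_0_1 Hd ltac:(lra))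
    as [rho [Hrho [Hrho1 [Hrhod Hrhor]]]].
  exists rho, K'. split; [lra|]. split; [exact Hm|]. split; [lra|]. split; [exact HK1|].
  split; [|split; [|split; [intros i Hi; now apply HB|]]].
  - rewrite (power_series_on_0 r a Psi Hr HPsi). apply H0. lia.
  - intros X x y Hx Hy HX. assert (hX := Rle_trans _ _ _ (Cmod_ge_0 x) Hx).
    eapply Rle_trans; [apply (vanishing_series_lipschitz M (r / 2) a Psi m X x y); auto; lra|].
    fold L. apply Rmult_le_compat_r; [apply Cmod_ge_0|].
    apply Rmult_le_compat_r; [now apply pow_le|exact HLK'].
  - intros i x Hi Hx. apply comparable_le with K;
      [exact HKK'|apply pow_le, Cmod_ge_0|apply Cmod_ge_0|].
    apply Hsep; [exact Hi| |]; lra.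
Qed.

(** * The germ in the chart *)

Lemma germ_mult_not_big_O (f : C2 -> C) (m : nat) : germ_mult f m ->
  ~ exists A eps, 0 < eps /\ forall p, norm2 p < eps -> Cmod (f p) <= A * norm2 p ^ S m.
Proof.
  intros [r [c [Hrep [[i [j [Hij Hc]]] _]]]] [A [eps [Heps HA]]]. apply Hc, Cmod_le_0.
  assert (Hr : 0 < r) by apply Hrep.
  destruct (pos_lower_bound2 r (eps / 2) Hr ltac:(lra)) as [d [Hd [Hdr Hdeps]]].
  apply (le_of_le_add_small _ _ (Rabs A * 2 ^ S m) d); [exact Hd| |].
  - apply Rmult_le_pos; [apply Rabs_pos|apply pow_le; lra].
  - intros s Hs. assert (hsm : 0 < s ^ m) by (apply pow_lt; lra).
    apply Rmult_le_reg_r with (s ^ m); [exact hsm|].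
    rewrite <- Hij at 1.
    apply Rle_trans with (Rabs A * (2 * s) ^ S m); [|right; rewrite Rpow_mult_distr; simpl; ring].
    apply (ser2_cauchy_estimate r s _ c f i j Hrep ltac:(lra)). intros x y Hx Hy.
    assert (h := norm2_le_sum (x, y)). simpl in h.
    eapply Rle_trans; [apply HA; lra|].
    apply Rle_trans with (Rabs A * norm2 (x, y) ^ S m).
    + apply Rmult_le_compat_r; [apply pow_le, norm2_ge_0|apply Rle_abs].
    + apply Rmult_le_compat_l; [apply Rabs_pos|]. apply pow_incr. split; [apply norm2_ge_0|lra].
Qed.

Lemma ser2_rep_lipschitz (r : R) (c : nat -> nat -> C) (f : C2 -> C) : ser2_rep r c f ->
  exists L delta, 0 <= L /\ 0 < delta /\ forall p q, norm2 p < delta -> norm2 q < delta ->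
    Cmod (f p - f q) <= L * norm2 (sub2 p q).
Proof.
  intros Hrep. destruct (ser2_rep_strict_diff0 r c f Hrep 1 ltac:(lra)) as [delta [Hdel H]].
  set (a := c 1%nat 0%nat) in *. set (b := c 0%nat 1%nat) in *.
  assert (ha := Cmod_ge_0 a). assert (hb := Cmod_ge_0 b).
  exists (Cmod a + Cmod b + 1), delta. split; [lra|]. split; [exact Hdel|]. intros p q Hp Hq.
  specialize (H p q Hp Hq).
  set (lin := (a * (fst p - fst q) + b * (snd p - snd q))%C) in *.
  assert (Hlin : Cmod lin <= (Cmod a + Cmod b) * norm2 (sub2 p q)).
  { unfold lin. eapply Rle_trans; [apply Cmod_triangle|]. rewrite !Cmod_mult, Rmult_plus_distr_r.
    apply Rplus_le_compat; apply Rmult_le_compat_l; try apply Cmod_ge_0.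
    - apply (Cmod_fst_le (sub2 p q)).
    - apply (Cmod_snd_le (sub2 p q)). }
  replace (f p - f q)%C with (f p - f q - lin + lin)%C by ring.
  eapply Rle_trans; [apply Cmod_triangle|]. lra.
Qed.

Section Slices.
Context (rho0 K0 : R) (Phi J : C2 -> C2).
Hypothesis HPhi : chart_linearization rho0 K0 Phi J.
Context (f : C2 -> C) (r L eta s : R) (c : nat -> nat -> C) (G : C2 -> C2).
Hypothesis Hrep : ser2_rep r c f.
Hypothesis Hf0 : f zero2 = RtoC 0.
Hypothesis Heta : 0 < eta <= r / 2.
Hypothesis HL : 0 <= L.
Hypothesis Hlip :
  forall p q, norm2 p <= eta -> norm2 q <= eta -> Cmod (f p - f q) <= L * norm2 (sub2 p q).
Hypothesis Hbil : bilipschitz_on eta (2 * K0) Phi.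
Hypothesis Hs : 0 < s.
Hypothesis HG : forall u v, Cmod u < s -> Cmod v < s ->
  norm2 (G (u, v)) <= eta /\ Phi (G (u, v)) = (u, v).
Hypothesis HGan : forall u, Cmod u < s -> analytic2_on s (fun v => G (u, v)).

Let F (u v : C) : C := f (G (u, v)).

Lemma slice_analytic (u : C) : Cmod u < s -> analytic_on s (F u).
Proof.
  intros Hu. destruct (HGan u Hu) as [hG1 hG2].
  apply analytic_on_ext with (fun v => f (fst (G (u, v)), snd (G (u, v)))).
  - intros v _. unfold F. now rewrite <- surjective_pairing.
  - apply (analytic_on_comp r s c f _ _ Hrep Hs hG1 hG2). intros v Hv.
    destruct (HG u v Hu Hv) as [hGle _].
    assert (hfst := Cmod_fst_le (G (u, v))). assert (hsnd := Cmod_snd_le (G (u, v))). lra.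
Qed.

Lemma slice_bounded (u v : C) : Cmod u < s -> Cmod v < s -> Cmod (F u v) <= L * eta.
Proof.
  intros Hu Hv. destruct (HG u v Hu Hv) as [hGle _].
  assert (hlip := Hlip (G (u, v)) zero2 hGle ltac:(rewrite norm2_zero; lra)).
  rewrite Hf0, sub2_zero_r in hlip. unfold Cminus in hlip. rewrite Copp_0, Cplus_0_r in hlip.
  eapply Rle_trans; [exact hlip|]. now apply Rmult_le_compat_l.
Qed.

Lemma slice_lipschitz (u v : C) :
  Cmod u < s -> Cmod v < s -> Cmod (F u v - F 0 v) <= L * (2 * K0) * Cmod u.
Proof.
  intros Hu Hv. destruct HPhi as [_ [HK0 _]].
  assert (H0 : Cmod 0 < s) by (rewrite Cmod_0; exact Hs).
  destruct (HG u v Hu Hv) as [hGu EGu]. destruct (HG 0 v H0 Hv) as [hG0 EG0].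
  eapply Rle_trans; [apply Hlip; assumption|]. rewrite Rmult_assoc.
  apply Rmult_le_compat_l; [exact HL|].
  eapply Rle_trans; [apply Hbil; assumption|]. rewrite EGu, EG0. apply Rmult_le_compat_l; [lra|].
  eapply Rle_trans; [apply norm2_le_sum|]. unfold sub2; cbn [fst snd].
  replace (u - 0)%C with u by ring. unfold Cminus. rewrite Cplus_opp_r, Cmod_0. lra.
Qed.

Lemma slice_at_chart (p : C2) :
  norm2 p <= eta -> Cmod (fst (Phi p)) < s -> Cmod (snd (Phi p)) < s ->
  F (fst (Phi p)) (snd (Phi p)) = f p.
Proof.
  intros Hp H1 H2. unfold F. f_equal. destruct (HG _ _ H1 H2) as [hGle EG].
  apply norm2_sub_le_0. eapply Rle_trans; [apply Hbil; [exact hGle|exact Hp]|].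
  rewrite EG, <- surjective_pairing, sub2_diag, norm2_zero. lra.
Qed.

Lemma chart_norm_le (p : C2) : norm2 p <= eta -> norm2 (Phi p) <= 2 * K0 * norm2 p.
Proof. intros Hp. apply (bilipschitz_norm eta); [exact Hbil|apply HPhi|exact Hp]. Qed.

Lemma slice_not_vanishing (m : nat) : germ_mult f m -> ~ vanishes_to_order F (S m).
Proof.
  intros Hmult [A [d [Hd H]]]. apply (germ_mult_not_big_O f m Hmult).
  destruct HPhi as [_ [HK0 _]].
  destruct (pos_lower_bound2 d s Hd Hs) as [d' [Hd' [Hdd Hds]]].
  set (t := d' / (2 * K0)). assert (Ht : 0 < t) by (apply Rdiv_lt_0_compat; lra).
  assert (Et : 2 * K0 * t = d') by (unfold t; field; lra).
  destruct (pos_lower_bound2 eta t ltac:(lra) Ht) as [eps [Heps [Hepseta Hepst]]].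
  exists (Rabs A * (4 * K0) ^ S m), eps. split; [exact Heps|]. intros p Hp.
  assert (hPhi := chart_norm_le p ltac:(lra)). assert (hfst := Cmod_fst_le (Phi p)).
  assert (hsnd := Cmod_snd_le (Phi p)).
  assert (hpt : 2 * K0 * norm2 p < d') by (rewrite <- Et; apply Rmult_lt_compat_l; lra).
  rewrite <- (slice_at_chart p) by lra. eapply Rle_trans; [apply H; lra|].
  assert (hu := Cmod_ge_0 (fst (Phi p))). assert (hv := Cmod_ge_0 (snd (Phi p))).
  rewrite Rmult_assoc, <- Rpow_mult_distr.
  apply Rle_trans with (Rabs A * (Cmod (fst (Phi p)) + Cmod (snd (Phi p))) ^ S m).
  - apply Rmult_le_compat_r; [apply pow_le; lra|apply Rle_abs].
  - apply Rmult_le_compat_l; [apply Rabs_pos|]. apply pow_incr. lra.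
Qed.
Context (m : nat) (Psi : C -> C) (B : nat -> nat) (rho K ra : R).
Hypothesis HPsi : puiseux_branches m Psi B rho K.
Hypothesis Hmult : germ_mult f m.
Hypothesis Hsrho : s <= rho / K.
Hypothesis Hsra : s <= ra.
Hypothesis Hzero : forall p, norm2 p <= eta ->
  (f p = RtoC 0 <-> exists x, Cmod x < ra /\ Phi p = ((x ^ m)%C, Psi x)).

Lemma s_le_1 : s <= 1.
Proof.
  destruct HPsi as [_ [Hrho _]]. destruct (rho_div_K_le m Psi B rho K HPsi) as [h _]. lra.
Qed.

Definition curve_point (x : C) : C2 := G ((x ^ m)%C, Psi x).

Lemma curve_point_spec (x : C) : Cmod x < s ->
  norm2 (curve_point x) <= eta /\ Phi (curve_point x) = ((x ^ m)%C, Psi x) /\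
  f (curve_point x) = RtoC 0.
Proof.
  intros Hx. assert (Hs1 := s_le_1).
  assert (hxm := pow_le_self (Cmod x) m (proj1 HPsi) ltac:(split; [apply Cmod_ge_0|lra])).
  assert (hPsi := Psi_le_pow m Psi B rho K HPsi x ltac:(lra)).
  destruct (HG (x ^ m)%C (Psi x)) as [hGle EG]; [rewrite Cmod_pow; lra|lra|].
  split; [exact hGle|]. split; [exact EG|]. apply Hzero; [exact hGle|]. exists x.
  split; [lra|exact EG].
Qed.

Lemma chart_small (t : R) : 0 < t -> exists eta0, 0 < eta0 <= eta /\
  forall p, norm2 p <= eta0 -> norm2 (Phi p) < t.
Proof.
  intros Ht. destruct HPhi as [_ [HK0 _]].
  assert (hq : 0 < t / (4 * K0)) by (apply Rdiv_lt_0_compat; lra).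
  destruct (pos_lower_bound2 eta (t / (4 * K0)) (proj1 Heta) hq) as [eta0 [Heta0 [Hle Hlt]]].
  exists eta0. split; [lra|]. intros p Hp.
  eapply Rle_lt_trans; [apply chart_norm_le; lra|].
  apply Rle_lt_trans with (2 * K0 * (t / (4 * K0))); [apply Rmult_le_compat_l; lra|].
  replace (2 * K0 * (t / (4 * K0))) with (t / 2) by (field; lra). lra.
Qed.

Lemma order_profile_in_chart : order_profile f m B.
Proof.
  assert (Hm := proj1 HPsi). destruct HPhi as [_ [HK0 _]]. assert (Hs1 := s_le_1).
  assert (hL1 : 0 <= L * eta) by (apply Rmult_le_pos; lra).
  assert (hL2 : 0 <= L * (2 * K0)) by (apply Rmult_le_pos; lra).
  destruct (comparable_branch_product m Psi B rho K F s (L * eta + L * (2 * K0)) HPsi Hs)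
    as [d [KF [Hd [HKF Hprod]]]].
  - lra.
  - exact slice_analytic.
  - intros u v Hu Hv. assert (h := slice_bounded u v Hu Hv). lra.
  - intros u v Hu Hv. eapply Rle_trans; [now apply slice_lipschitz|].
    apply Rmult_le_compat_r; [apply Cmod_ge_0|lra].
  - intros x Hx. apply curve_point_spec. exact Hx.
  - now apply slice_not_vanishing.
  - destruct (pos_lower_bound2 d s Hd Hs) as [t [Ht [Htd Hts]]].
    assert (htm := pow_le_self t m Hm ltac:(lra)).
    destruct (chart_small (t ^ m)) as [eta0 [Heta0 Hsmall]]; [now apply pow_lt|].
    assert (Hroot : forall p x, norm2 p <= eta0 -> (x ^ m)%C = fst (Phi p) -> Cmod x < t).
    { intros p x Hp Ex. apply pow_lt_inv with m; [lra|]. rewrite <- Cmod_pow, Ex.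
      eapply Rle_lt_trans; [apply Cmod_fst_le|now apply Hsmall]. }
    apply (order_profile_of_branch_dist rho0 K0 Phi J HPhi m Psi B rho K HPsi f curve_point s eta
      (conj Hs Hsrho) Hbil curve_point_spec eta0 Heta0) with KF; [|lra|].
    + intros p Hp Hfp. destruct (proj1 (Hzero p ltac:(lra)) Hfp) as [x [_ Ex]].
      exists x. split; [|exact Ex]. apply Rlt_le_trans with t; [|exact Hts].
      apply (Hroot p); [exact Hp|now rewrite Ex].
    + intros p x Hp Ex. assert (hfst := Cmod_fst_le (Phi p)). assert (hsnd := Cmod_snd_le (Phi p)).
      assert (hPhi := Hsmall p Hp). rewrite <- (slice_at_chart p) by lra. rewrite <- Ex.
      apply Hprod; [apply Rlt_le_trans with t; [now apply (Hroot p)|exact Htd]|lra].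
Qed.
End Slices.

Lemma puiseux_param_zero_set (f : C2 -> C) (m : nat) (Phi : C2 -> C2) (a : nat -> C) :
  puiseux_param f Phi m a -> exists (Psi : C -> C) (rho eps : R), 0 < rho /\ 0 < eps /\
    power_series_on rho a Psi /\ forall p, norm2 p < eps ->
      (f p = RtoC 0 <-> exists x, Cmod x < rho /\ Phi p = ((x ^ m)%C, Psi x)).
Proof.
  intros [_ [_ [rho [Hrho [Hser [eps [Heps Hzero]]]]]]].
  destruct (guarded_choice _ _ (RtoC 0) Hser) as [Psi HPsi].
  exists Psi, rho, eps. split; [exact Hrho|]. split; [exact Heps|]. split; [exact HPsi|].
  intros p Hp. rewrite (Hzero p Hp). split; intros [x Hx]; exists x.
  - destruct Hx as [Hx [Efst Hsnd]]. split; [exact Hx|]. rewrite (surjective_pairing (Phi p)), Efst.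
    f_equal. exact (is_series_fun (V := C_NormedModule) _ _ _ Hsnd (HPsi x Hx)).
  - destruct Hx as [Hx E]. rewrite E. split; [exact Hx|]. split; [reflexivity|now apply HPsi].
Qed.

Lemma order_profile_of_param (f : C2 -> C) (m : nat) (Phi : C2 -> C2) (a : nat -> C)
  (B : nat -> nat) :
  (1 <= m)%nat -> f zero2 = RtoC 0 -> germ_mult f m -> puiseux_param f Phi m a ->
  branch_orders m a B ->
  order_profile f m B.
Proof.
  intros Hm Hf0 Hmult Hparam HB.
  destruct (local_coords_linearization Phi (proj1 Hparam)) as [rho0 [K0 [J HPhi]]].
  destruct (puiseux_param_zero_set f m Phi a Hparam) as [Psi [ra [eps [Hra [Heps [HPsi Hzero]]]]]].
  destruct (puiseux_branches_of_series m a Psi B ra Hm Hra (proj1 (proj2 Hparam)) HPsi HB)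
    as [rho [K [Hrho HK]]].
  destruct (rho_div_K_le m Psi B rho K HK) as [HrK HrK0].
  assert (Hmult' := Hmult). destruct Hmult' as [r [c [Hrep _]]]. assert (Hr : 0 < r) by apply Hrep.
  destruct (ser2_rep_lipschitz r c f Hrep) as [L [delta1 [HL [Hdel1 Hlip]]]].
  destruct (chart_bilipschitz rho0 K0 Phi J HPhi) as [delta2 [Hdel2 Hbil]].
  destruct (pos_lower_bound4 (delta1 / 2) delta2 (r / 2) (eps / 2))
    as [eta [Heta [Heta1 [Heta2 [Hetar Hetaeps]]]]];
    [lra..|].
  destruct (local_inverse rho0 K0 Phi J HPhi eta Heta) as [s' [G [Hs' [HG HGan]]]].
  destruct (pos_lower_bound2 s' (rho / K) Hs' HrK0) as [s [Hs [Hss Hsrho]]].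
  apply (order_profile_in_chart rho0 K0 Phi J HPhi f r L eta s c G Hrep Hf0 (conj Heta Hetar) HL)
    with Psi rho K ra; try lra.
  - intros p q Hp Hq. apply Hlip; lra.
  - apply bilipschitz_on_le with delta2; [lra|exact Hbil].
  - intros u v Hu Hv. apply HG; lra.
  - intros u Hu. destruct (HGan u ltac:(lra)) as [hG1 hG2].
    now split; apply analytic_on_le with s'.
  - exact HK.
  - exact Hmult.
  - intros p Hp. apply Hzero. lra.
Qed.

(** * Puiseux pairs *)

Section PuiseuxPairs.
Context (m : nat) (a : nat -> C) (s : nat) (beta e : nat -> nat).
Hypothesis Hpairs : puiseux_pairs m a s beta e.

Lemma e_divides (l k : nat) : (l <= k <= s)%nat -> Nat.divide (e k) (e l).
Proof.
  intros [Hlk Hk]. induction Hlk as [|k _ IH]; [apply Nat.divide_refl|].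
  apply Nat.divide_trans with (e k); [|apply IH; lia].
  destruct Hpairs as [_ [_ [_ H]]]. destruct (H k ltac:(lia)) as [_ [_ [_ E]]].
  rewrite E. apply Nat.gcd_divide_l.
Qed.

Lemma e_divides_m (l : nat) : (l <= s)%nat -> Nat.divide (e l) m.
Proof. intros Hl. rewrite <- (proj1 Hpairs). apply e_divides. lia. Qed.

Lemma beta_mono (l k : nat) : (l <= k < s)%nat -> (beta (S l) <= beta (S k))%nat.
Proof.
  intros [Hlk Hk]. induction Hlk as [|k _ IH]; [lia|].
  eapply Nat.le_trans; [apply IH; lia|]. destruct Hpairs as [_ [_ [_ H]]].
  destruct (H k ltac:(lia)) as [_ [_ [Hmin _]]]. destruct (H (S k) Hk) as [Ha [Hnd _]].
  apply Hmin; [exact Ha|]. intros Hd. apply Hnd.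
  apply Nat.divide_trans with (e k); [apply e_divides; lia|exact Hd].
Qed.

(* [zeta m ^ i] fixes the exponents divisible by [e l], but not those divisible by [e (S l)]. *)
Definition at_level (i l : nat) : Prop :=
  (l < s)%nat /\ Nat.divide m (i * e l) /\ ~ Nat.divide m (i * e (S l)).

Lemma level_exists (i : nat) : (0 < i < m)%nat -> exists l, at_level i l.
Proof.
  intros Hi. apply NNPP. intros Hn. destruct Hpairs as [E0 [_ [Es _]]].
  assert (H : forall l, (l <= s)%nat -> Nat.divide m (i * e l)).
  { induction l as [|l IH]; intros Hl; [rewrite E0; now exists i|].
    apply NNPP. intros Hd. apply Hn. exists l. split; [lia|]. split; [apply IH; lia|exact Hd]. }
  specialize (H s (le_n _)). rewrite Es, Nat.mul_1_r in H. apply Nat.divide_pos_le in H; lia.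
Qed.

Lemma at_level_divides (i l k : nat) : at_level i l -> (k <= s)%nat ->
  (Nat.divide m (i * e k) <-> (k <= l)%nat).
Proof.
  intros [Hl [Hd Hnd]] Hk.
  assert (Hmul : forall l k, (l <= k <= s)%nat -> Nat.divide m (i * e k) -> Nat.divide m (i * e l)).
  { intros l' k' Hlk Hdk. apply Nat.divide_trans with (i * e k')%nat; [exact Hdk|].
    now apply Nat.mul_divide_mono_l, e_divides. }
  split; intros H.
  - apply Nat.nlt_ge. intros Hlt. apply Hnd. apply Hmul with k; [lia|exact H].
  - apply Hmul with l; [lia|exact Hd].
Qed.

Hypothesis Hm : (1 <= m)%nat.

Lemma level_coef_eq_0 (i l j : nat) : at_level i l -> (j < beta (S l))%nat ->
  (a j * (1 - zeta m ^ (i * j)))%C = RtoC 0.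
Proof.
  intros [Hl [Hd _]] Hj. destruct (Ceq_dec (a j) (RtoC 0)) as [->|Ha]; [ring|].
  destruct Hpairs as [_ [_ [_ H]]]. destruct (H l Hl) as [_ [_ [Hmin _]]].
  assert (Hej : Nat.divide (e l) j).
  { apply NNPP. intros Hn. specialize (Hmin j Ha Hn). lia. }
  rewrite (proj2 (zeta_pow_eq_1 m (i * j) Hm)); [ring|].
  apply Nat.divide_trans with (i * e l)%nat; [exact Hd|]. now apply Nat.mul_divide_mono_l.
Qed.

Lemma level_coef_neq_0 (i l : nat) : at_level i l ->
  (a (beta (S l)) * (1 - zeta m ^ (i * beta (S l))))%C <> RtoC 0.
Proof.
  intros [Hl [Hd Hnd]]. destruct Hpairs as [_ [_ [_ H]]]. destruct (H l Hl) as [Ha [_ [_ Eg]]].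
  apply Cmult_neq_0; [exact Ha|]. apply Cminus_eq_contra. intros E. symmetry in E.
  apply zeta_pow_eq_1 in E; [|exact Hm]. apply Hnd. rewrite Eg.
  rewrite <- Nat.gcd_mul_mono_l. now apply Nat.gcd_greatest.
Qed.

Definition branch_levels (B : nat -> nat) : Prop :=
  forall i, (0 < i < m)%nat -> exists l, at_level i l /\ B i = beta (S l).

Lemma branch_levels_exist : exists B, branch_levels B.
Proof.
  apply (guarded_choice _ (fun i b => exists l, at_level i l /\ b = beta (S l)) 0%nat).
  intros i Hi. destruct (level_exists i Hi) as [l Hl]. exists (beta (S l)). now exists l.
Qed.

Lemma branch_levels_orders (B : nat -> nat) :
  (forall j, (j <= m)%nat -> a j = RtoC 0) -> branch_levels B -> branch_orders m a B.
Proof.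
  intros Hlow HB i Hi. destruct (HB i Hi) as [l [Hl ->]]. split; [|split].
  - destruct Hpairs as [_ [_ [_ H]]]. destruct (H l (proj1 Hl)) as [Ha _].
    apply Nat.nlt_ge. intros Hlt. apply Ha, Hlow. lia.
  - intros j. now apply level_coef_eq_0.
  - now apply level_coef_neq_0.
Qed.
End PuiseuxPairs.

(** * The sum of the exponents of the branches *)

Lemma rsum_ext (g h : nat -> R) (n : nat) :
  (forall i, (i < n)%nat -> g i = h i) -> rsum g n = rsum h n.
Proof.
  induction n as [|n IH]; intros H; simpl; [reflexivity|].
  rewrite IH, H by (intros; try apply H; lia). reflexivity.
Qed.

Lemma rsum_plus (g h : nat -> R) (n : nat) : rsum (fun i => g i + h i) n = rsum g n + rsum h n.
Proof. induction n as [|n IH]; simpl; [ring|]. rewrite IH. ring. Qed.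

Lemma rsum_scal (x : R) (g : nat -> R) (n : nat) : rsum (fun i => g i * x) n = rsum g n * x.
Proof. induction n as [|n IH]; simpl; [ring|]. rewrite IH. ring. Qed.

Lemma rsum_swap (g : nat -> nat -> R) (n k : nat) :
  rsum (fun i => rsum (g i) k) n = rsum (fun l => rsum (fun i => g i l) n) k.
Proof.
  induction k as [|k IH]; simpl; [|now rewrite <- IH, <- rsum_plus].
  induction n as [|n IH]; simpl; [reflexivity|]. rewrite IH. ring.
Qed.

Lemma rsum_app (g : nat -> R) (n k : nat) :
  rsum g (n + k) = rsum g n + rsum (fun j => g (n + j)%nat) k.
Proof.
  induction k as [|k IH]; [rewrite Nat.add_0_r; simpl; ring|].
  rewrite Nat.add_succ_r. simpl. rewrite IH. ring.
Qed.

Definition divides_ind (m x : nat) : R := if Nat.eqb (x mod m) 0 then 1 else 0.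

Lemma divides_ind_true (m x : nat) : Nat.divide m x -> divides_ind m x = 1.
Proof. intros H. unfold divides_ind. apply Nat.Lcm0.mod_divide in H. now rewrite H. Qed.

Lemma divides_ind_false (m x : nat) : ~ Nat.divide m x -> divides_ind m x = 0.
Proof.
  intros H. unfold divides_ind. destruct (Nat.eqb_spec (x mod m) 0) as [E|_]; [|reflexivity].
  exfalso. apply H. now apply Nat.Lcm0.mod_divide.
Qed.

Lemma rsum_divides_ind_block (g n k : nat) : (k < g)%nat ->
  rsum (fun j => divides_ind g (n * g + j)) (S k) = 1.
Proof.
  intros Hk. induction k as [|k IH]; cbn [rsum].
  - rewrite Nat.add_0_r, divides_ind_true by (now exists n). ring.
  - cbn [rsum] in IH. rewrite IH by lia. rewrite divides_ind_false; [ring|].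
    intros [q Hq]. assert (S k = (q - n) * g)%nat by nia. destruct (q - n)%nat as [|z]; [lia|nia].
Qed.

Lemma count_multiples (g n : nat) : (1 <= g)%nat -> rsum (divides_ind g) (n * g) = INR n.
Proof.
  intros Hg. induction n as [|n IH]; [reflexivity|].
  replace (S n * g)%nat with (n * g + S (g - 1))%nat by lia.
  rewrite rsum_app, IH, S_INR, rsum_divides_ind_block by lia. reflexivity.
Qed.

Lemma count_divides_mult (m e : nat) : (1 <= m)%nat -> Nat.divide e m ->
  rsum (fun i => divides_ind m (i * e)) m = INR e.
Proof.
  intros Hm [g Eg]. assert (Hg : (1 <= g)%nat) by nia.
  rewrite <- (count_multiples g e Hg). replace (e * g)%nat with m by lia. apply rsum_ext.
  intros i _.
  destruct (classic (Nat.divide g i)) as [h|h].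
  - rewrite (divides_ind_true g i h). apply divides_ind_true. destruct h as [k ->]. exists k. nia.
  - rewrite (divides_ind_false g i h). apply divides_ind_false. intros [k Hk]. apply h.
    exists k. nia.
Qed.

Lemma rsum_by_parts_indicator (chi g : nat -> R) (x : R) (l0 k : nat) :
  (forall l, (l <= k)%nat -> chi l = if Nat.leb l l0 then 1 else 0) ->
  chi k * x + rsum (fun l => (chi l - chi (S l)) * g l) k = if Nat.leb k l0 then x else g l0.
Proof.
  induction k as [|k IH]; intros H; cbn [rsum]; [rewrite H by lia; simpl; ring|].
  assert (E := IH (fun l Hl => H l (Nat.le_trans _ _ _ Hl (Nat.le_succ_diag_r k)))).
  rewrite (H k ltac:(lia)) in *. rewrite (H (S k) ltac:(lia)).
  destruct (Nat.leb_spec k l0) as [h|h]; destruct (Nat.leb_spec (S k) l0) as [h'|h'];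
    try lia; try lra.
  replace l0 with k by lia. lra.
Qed.

Definition profile_exponent (m : nat) (B : nat -> nat) (c : R) (i : nat) : R :=
  match i with O => c | S _ => Rmin c (INR (B i) / INR m) end.

Section ExponentSum.
Context (m : nat) (a : nat -> C) (s : nat) (beta e : nat -> nat) (B : nat -> nat) (c : R) (k : nat).
Hypothesis Hm : (1 <= m)%nat.
Hypothesis Hpairs : puiseux_pairs m a s beta e.
Hypothesis HB : branch_levels m s beta e B.
Hypothesis Hk : (k <= s)%nat.
Hypothesis Hkc : INR (beta k) <= INR m * c.
Hypothesis Hck : (k < s)%nat -> INR m * c < INR (beta (S k)).

Lemma profile_exponent_eq (i : nat) : (i < m)%nat ->
  profile_exponent m B c i = divides_ind m (i * e k) * c +
    rsum (fun l => (divides_ind m (i * e l) - divides_ind m (i * e (S l)))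
      * (INR (beta (S l)) / INR m)) k.
Proof.
  intros Hi. assert (HmR : 0 < INR m) by (apply lt_0_INR; lia).
  destruct i as [|i]; cbn [profile_exponent].
  - rewrite (rsum_by_parts_indicator (fun l => divides_ind m (0 * e l)) _ c k), Nat.leb_refl;
      [reflexivity|].
    intros l Hl. rewrite (proj2 (Nat.leb_le l k) Hl). apply divides_ind_true, Nat.divide_0_r.
  - destruct (HB (S i) ltac:(lia)) as [l0 [Hl0 ->]].
    rewrite (rsum_by_parts_indicator (fun l => divides_ind m (S i * e l))
      (fun l => INR (beta (S l)) / INR m) c l0).
    + destruct (Nat.leb_spec k l0) as [h|h].
      * rewrite Rmin_left; [reflexivity|]. specialize (Hck (Nat.le_lt_trans _ _ _ h (proj1 Hl0))).
        assert (hb : INR (beta (S k)) <= INR (beta (S l0))).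
        { apply le_INR, (beta_mono m a s beta e Hpairs). split; [exact h|apply Hl0]. }
        apply Rmult_le_reg_l with (INR m); [exact HmR|].
        replace (INR m * (INR (beta (S l0)) / INR m)) with (INR (beta (S l0))) by (field; lra). lra.
      * rewrite Rmin_right; [reflexivity|]. destruct k as [|k']; [lia|].
        assert (hb : INR (beta (S l0)) <= INR (beta (S k'))).
        { apply le_INR, (beta_mono m a s beta e Hpairs). lia. }
        apply Rmult_le_reg_l with (INR m); [exact HmR|].
        replace (INR m * (INR (beta (S l0)) / INR m)) with (INR (beta (S l0))) by (field; lra). lra.
    + intros l Hl. assert (h := at_level_divides m a s beta e Hpairs (S i) l0 l Hl0 ltac:(lia)).
      destruct (Nat.leb_spec l l0) as [h'|h']; [apply divides_ind_true|apply divides_ind_false];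
        rewrite h; lia.
Qed.

Lemma rsum_profile_exponent : rsum (profile_exponent m B c) m =
  INR (e k) * c + rsum (fun i => (INR (e i) - INR (e (S i))) * (INR (beta (S i)) / INR m)) k.
Proof.
  assert (Hcount : forall l, (l <= s)%nat -> rsum (fun i => divides_ind m (i * e l)) m = INR (e l)).
  { intros l Hl. apply count_divides_mult; [exact Hm|].
    now apply (e_divides_m m a s beta e Hpairs). }
  rewrite (rsum_ext _ _ _ profile_exponent_eq), rsum_plus, rsum_scal, rsum_swap, Hcount by exact Hk.
  f_equal.
  apply rsum_ext. intros l Hl. rewrite rsum_scal. f_equal.
  rewrite (rsum_ext _ (fun i => divides_ind m (i * e l) + divides_ind m (i * e (S l)) * -1))
    by (intros; ring).
  rewrite rsum_plus, rsum_scal, !Hcount by lia. ring.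
Qed.
End ExponentSum.

(** * Asymptotic exponents *)

Definition has_exponent (F : R -> R) (nu : R) : Prop :=
  forall eps, 0 < eps -> at_right 0 (fun t => Rpower t (nu + eps) <= F t <= Rpower t (nu - eps)).

Lemma at_right_0_lt (d : R) : 0 < d -> at_right 0 (fun t => 0 < t < d).
Proof.
  intros Hd. exists (mkposreal d Hd). intros t Ht Hpos. split; [exact Hpos|].
  change (Rabs (t - 0) < d) in Ht. rewrite Rminus_0_r in Ht.
  exact (Rle_lt_trans _ _ _ (Rle_abs t) Ht).
Qed.

Lemma at_right_0_imp2 (P Q S : R -> Prop) : (forall t, 0 < t < 1 -> P t -> Q t -> S t) ->
  at_right 0 P -> at_right 0 Q -> at_right 0 S.
Proof.
  intros H HP HQ.
  generalize (filter_and (F := at_right 0) _ _ (at_right_0_lt 1 Rlt_0_1)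
    (filter_and (F := at_right 0) _ _ HP HQ)).
  apply filter_imp. intros t [Ht [p q]]. now apply H.
Qed.

Lemma Rpower_le_antitone (t x y : R) : 0 < t < 1 -> x <= y -> Rpower t y <= Rpower t x.
Proof.
  intros Ht Hxy. unfold Rpower.
  assert (hl : ln t < 0) by (rewrite <- ln_1; apply ln_increasing; lra).
  destruct (Req_dec x y) as [->|h]; [lra|]. apply Rlt_le, exp_increasing. nra.
Qed.

Lemma const_le_Rpower (K eps : R) : 0 < eps -> at_right 0 (fun t => K <= Rpower t (- eps)).
Proof.
  intros He. set (L := Rmax K 1). assert (h1 : K <= L) by apply Rmax_l.
  assert (h2 : 1 <= L) by apply Rmax_r.
  apply filter_imp with (2 := at_right_0_lt _ (exp_pos (- ln L / eps))). intros t Ht.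
  assert (hl : ln t < - ln L / eps)
    by (rewrite <- (ln_exp (- ln L / eps)); apply ln_increasing; lra).
  assert (hL : ln L < - eps * ln t).
  { apply (Rmult_lt_compat_l eps) in hl; [|exact He].
    replace (eps * (- ln L / eps)) with (- ln L) in hl by (field; lra). lra. }
  eapply Rle_trans; [exact h1|]. unfold Rpower. rewrite <- (exp_ln L) at 1 by lra.
  now apply Rlt_le, exp_increasing.
Qed.

Lemma has_exponent_ext (F G : R -> R) (nu : R) :
  (forall t, F t = G t) -> has_exponent F nu -> has_exponent G nu.
Proof.
  intros E HF eps He. generalize (HF eps He). apply filter_imp. intros t. now rewrite E.
Qed.

Lemma has_exponent_comparable (F G : R -> R) (nu K : R) : 0 < K -> has_exponent F nu ->
  at_right 0 (fun t => comparable K (F t) (G t)) -> has_exponent G nu.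
Proof.
  intros HK HF HFG eps He.
  apply at_right_0_imp2 with (3 := HFG)
    (2 := filter_and (F := at_right 0) _ _ (HF (eps / 2) ltac:(lra))
      (const_le_Rpower K (eps / 2) ltac:(lra))).
  intros t _ [[f1 f2] hK] [g1 g2].
  assert (p1 := Rpower_pos t (nu + eps)). split.
  - apply Rmult_le_reg_l with K; [exact HK|]. eapply Rle_trans; [|exact g1].
    eapply Rle_trans; [|exact f1].
    replace (nu + eps / 2) with (- (eps / 2) + (nu + eps)) by field.
    rewrite (Rpower_plus (- (eps / 2))).
    apply Rmult_le_compat_r; lra.
  - eapply Rle_trans; [exact g2|]. replace (nu - eps) with (- (eps / 2) + (nu - eps / 2)) by field.
    rewrite (Rpower_plus (- (eps / 2))). apply Rmult_le_compat; try lra.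
    eapply Rle_trans; [|exact f1]. apply Rlt_le, Rpower_pos.
Qed.

Lemma has_exponent_Rpower_id (x : R) : has_exponent (fun t => Rpower t x) x.
Proof.
  intros eps He. apply filter_imp with (2 := at_right_0_lt 1 ltac:(lra)).
  intros t Ht. split; apply Rpower_le_antitone; lra.
Qed.

Lemma has_exponent_mult (F G : R -> R) (nu mu : R) :
  has_exponent F nu -> has_exponent G mu -> has_exponent (fun t => F t * G t) (nu + mu).
Proof.
  intros HF HG eps He.
  apply at_right_0_imp2 with (2 := HF (eps / 2) ltac:(lra)) (3 := HG (eps / 2) ltac:(lra)).
  intros t _ [f1 f2] [g1 g2].
  replace (nu + mu + eps) with ((nu + eps / 2) + (mu + eps / 2)) by field.
  replace (nu + mu - eps) with ((nu - eps / 2) + (mu - eps / 2)) by field.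
  rewrite (Rpower_plus (nu + eps / 2)), (Rpower_plus (nu - eps / 2)).
  assert (p1 := Rpower_pos t (nu + eps / 2)). assert (p2 := Rpower_pos t (mu + eps / 2)).
  split; apply Rmult_le_compat; lra.
Qed.

Lemma has_exponent_rprod (D : R -> nat -> R) (E : nat -> R) (n : nat) :
  (forall i, (i < n)%nat -> has_exponent (fun t => D t i) (E i)) ->
  has_exponent (fun t => rprod (D t) n) (rsum E n).
Proof.
  induction n as [|n IH]; intros H; simpl.
  - intros eps He. apply filter_imp with (2 := at_right_0_lt 1 ltac:(lra)). intros t Ht.
    rewrite <- (Rpower_O t) by lra. split; apply Rpower_le_antitone; lra.
  - apply (has_exponent_mult (fun t => rprod (D t) n) (fun t => D t n));
      [apply IH; intros i Hi|]; apply H; lia.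
Qed.

Lemma has_exponent_max (F G : R -> R) (nu mu : R) :
  has_exponent F nu -> has_exponent G mu -> has_exponent (fun t => Rmax (F t) (G t)) (Rmin nu mu).
Proof.
  intros HF HG eps He. apply at_right_0_imp2 with (2 := HF eps He) (3 := HG eps He).
  intros t Ht [f1 f2] [g1 g2].
  assert (m1 := Rmin_l nu mu). assert (m2 := Rmin_r nu mu). split.
  - apply Rmin_case;
      [eapply Rle_trans; [exact f1|apply Rmax_l]|eapply Rle_trans; [exact g1|apply Rmax_r]].
  - apply Rmax_lub; (eapply Rle_trans; [eassumption|apply Rpower_le_antitone; lra]).
Qed.

Lemma has_exponent_Rpower (F : R -> R) (nu x : R) : 0 <= x ->
  has_exponent F nu -> has_exponent (fun t => Rpower (F t) x) (nu * x).
Proof.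
  intros Hx HF eps He. set (e := eps / (x + 1)).
  assert (He' : 0 < e) by (apply Rdiv_lt_0_compat; lra).
  assert (Ee : e * x <= eps).
  { apply Rle_trans with (e * (x + 1));
      [apply Rmult_le_compat_l; lra|right; unfold e; field; lra]. }
  apply at_right_0_imp2 with (2 := at_right_0_lt 1 Rlt_0_1) (3 := HF e He'). intros t Ht _ [f1 f2].
  assert (p := Rpower_pos t (nu + e)). split.
  - apply Rle_trans with (Rpower (Rpower t (nu + e)) x); [|apply Rle_Rpower_l; lra].
    rewrite Rpower_mult. apply Rpower_le_antitone; lra.
  - apply Rle_trans with (Rpower (Rpower t (nu - e)) x); [apply Rle_Rpower_l; lra|].
    rewrite Rpower_mult. apply Rpower_le_antitone; lra.
Qed.

Lemma has_exponent_unique (F : R -> R) (nu mu : R) :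
  has_exponent F nu -> has_exponent F mu -> nu = mu.
Proof.
  assert (H : forall nu mu, has_exponent F nu -> has_exponent F mu -> mu <= nu).
  { clear. intros nu mu H1 H2. apply Rnot_lt_le. intros Hlt.
    assert (He : 0 < (mu - nu) / 4) by lra.
    apply (filter_not_empty (F := at_right 0)).
    apply at_right_0_imp2 with (2 := H1 _ He) (3 := H2 _ He). intros t Ht [f1 _] [_ g2].
    assert (hl : ln t < 0) by (rewrite <- ln_1; apply ln_increasing; lra).
    assert (h : Rpower t (mu - (mu - nu) / 4) < Rpower t (nu + (mu - nu) / 4)).
    { unfold Rpower. apply exp_increasing. nra. }
    lra. }
  intros H1 H2. apply Rle_antisym; apply H; assumption.
Qed.

Definition sphere_dist (f : C2 -> C) (p : C2) : R := real (dist_set p (Xr f (norm2 p))).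

Lemma contact_dist_finite (f : C2 -> C) (alpha : R -> C2) (c : R) : contact_eq f alpha c ->
  at_right 0 (fun t =>
    dist_set (alpha t) (Xr f (norm2 (alpha t))) = Finite (sphere_dist f (alpha t)) /\
    0 < sphere_dist f (alpha t)).
Proof.
  intros [[eps [Heps Hfin]] _]. apply filter_imp with (2 := at_right_0_lt eps Heps). intros t Ht.
  destruct (Hfin t Ht) as [h1 h2]. unfold sphere_dist.
  now destruct (dist_set (alpha t) (Xr f (norm2 (alpha t)))).
Qed.

Lemma contact_has_exponent (f : C2 -> C) (alpha : R -> C2) (c : R) : contact_eq f alpha c ->
  has_exponent (fun t => sphere_dist f (alpha t)) c.
Proof.
  intros H eps He.
  assert (Hlim : at_right 0 (fun t => Rabs (ln (sphere_dist f (alpha t)) / ln t - c) < eps)).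
  { apply (proj2 H (fun y => Rabs (y - c) < eps)). now exists (mkposreal eps He). }
  apply at_right_0_imp2 with (2 := Hlim) (3 := contact_dist_finite f alpha c H).
  intros t Ht h [_ hp]. apply Rabs_def2 in h.
  set (d := sphere_dist f (alpha t)) in *.
  assert (hl : ln t < 0) by (rewrite <- ln_1; apply ln_increasing; lra).
  assert (E : d = exp (ln d / ln t * ln t)).
  { rewrite <- (exp_ln d) at 1 by exact hp. f_equal. field. lra. }
  rewrite E. unfold Rpower. split; apply Rlt_le, exp_increasing; nra.
Qed.

Lemma arc_norm_has_exponent (alpha : R -> C2) :
  (exists a b eps, 0 < a < b /\ 0 < eps /\ forall t, 0 <= t < eps ->
     a * t <= norm2 (alpha t) <= b * t) ->
  has_exponent (fun t => norm2 (alpha t)) 1.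
Proof.
  intros [a [b [eps [Hab [Heps H]]]]]. assert (ha := Rinv_0_lt_compat a ltac:(lra)).
  apply has_exponent_comparable with (fun t => Rpower t 1) (b + / a);
    [lra|apply has_exponent_Rpower_id|].
  apply filter_imp with (2 := at_right_0_lt eps Heps). intros t Ht. specialize (H t ltac:(lra)).
  rewrite Rpower_1 by lra.
  assert (0 <= / a * t) by (apply Rmult_le_pos; lra).
  split; [|lra]. apply Rle_trans with (/ a * norm2 (alpha t)); [|nra].
  apply Rle_trans with (/ a * (a * t)); [right; field; lra|apply Rmult_le_compat_l; lra].
Qed.

Lemma has_exponent_small (F : R -> R) (nu d : R) : 0 < nu -> 0 < d -> has_exponent F nu ->
  at_right 0 (fun t => 0 < F t < d).
Proof.
  intros Hnu Hd HF. apply at_right_0_imp2 with (2 := HF (nu / 2) ltac:(lra))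
    (3 := const_le_Rpower (2 / d) (nu / 2) ltac:(lra)).
  intros t _ [f1 f2] hK. assert (p := Rpower_pos t (nu + nu / 2)). split; [lra|].
  replace (nu - nu / 2) with (nu / 2) in f2 by field. eapply Rle_lt_trans; [exact f2|].
  rewrite Rpower_Ropp in hK.
  apply (Rmult_le_compat_l (d / 2 * Rpower t (nu / 2))) in hK; [|apply Rmult_le_pos; lra].
  replace (d / 2 * Rpower t (nu / 2) * (2 / d)) with (Rpower t (nu / 2)) in hK by (field; lra).
  replace (d / 2 * Rpower t (nu / 2) * / Rpower t (nu / 2)) with (d / 2) in hK by (field; lra). lra.
Qed.

Lemma order_exponent (f : C2 -> C) (m : nat) (B : nat -> nat) (alpha : R -> C2) (c : R) :
  (1 <= m)%nat -> order_profile f m B -> has_exponent (fun t => norm2 (alpha t)) 1 ->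
  contact_eq f alpha c -> has_exponent (fun t => Cmod (f (alpha t)))
    (rsum (profile_exponent m B c) m).
Proof.
  intros Hm [K [delta [HK [Hdelta Hprof]]]] Hnorm Hcont.
  set (r := fun t => Rpower (norm2 (alpha t)) (/ INR m)).
  apply has_exponent_comparable with
    (fun t => rprod (dist_profile B (r t) (sphere_dist f (alpha t))) m) K.
  - exact HK.
  - apply has_exponent_rprod. intros [|i] _; cbn [dist_profile profile_exponent].
    + now apply contact_has_exponent.
    + apply has_exponent_max; [now apply contact_has_exponent|].
      assert (hx : 0 <= INR (B (S i)) / INR m).
      { apply Rdiv_le_0_compat; [apply pos_INR|apply lt_0_INR; lia]. }
      assert (hr := has_exponent_Rpower _ 1 (INR (B (S i)) / INR m) hx Hnorm).
      rewrite Rmult_1_l in hr.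
      apply has_exponent_ext with (2 := hr). intros t. symmetry. apply Rpower_root_pow.
  - apply at_right_0_imp2 with (2 := contact_dist_finite f alpha c Hcont)
      (3 := has_exponent_small _ 1 delta Rlt_0_1 Hdelta Hnorm).
    intros t _ [E Hd] Hp. apply comparable_sym, Hprof; [lra| | |exact Hd|exact E].
    + apply Rlt_le, Rpower_pos.
    + apply Rpower_root_pow_same; [exact Hm|lra].
Qed.

(** * The order along an arc *)

Lemma analytic_on_small (M r : R) (a : nat -> C) (h : C -> C) (eps : R) :
  0 < r -> coef_bound M r a ->
  power_series_on r a h -> h (RtoC 0) = RtoC 0 -> 0 < eps ->
  exists s, 0 < s <= r /\ forall z, Cmod z < s -> Cmod (h z) <= eps.
Proof.
  intros Hr Ha Hh h0 Heps. assert (HM := coef_bound_ge0 M r a Ha).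
  set (t := eps * r / (2 * (M + 1))).
  assert (Ht : 0 < t) by (apply Rdiv_lt_0_compat; [now apply Rmult_lt_0_compat|lra]).
  destruct (pos_lower_bound2 (r / 2) t ltac:(lra) Ht) as [s [Hs [Hsr Hst]]].
  exists s. split; [lra|]. intros z Hz.
  eapply Rle_trans; [apply (ser1_vanishing_le M r a z Hr Ha ltac:(lra) 1)|].
  - intros j Hj. replace j with 0%nat by lia. now rewrite <- (power_series_on_0 r a h Hr Hh).
  - apply Hh. lra.
  - rewrite pow_1. apply Rmult_le_reg_r with r; [exact Hr|].
    replace (2 * M * (Cmod z / r) * r) with (2 * M * Cmod z) by (field; lra).
    apply Rle_trans with (2 * (M + 1) * t); [apply Rmult_le_compat; try lra; apply Cmod_ge_0|].
    right. unfold t. field. lra.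
Qed.

Lemma real_series_extends (rho : R) (d : nat -> C) (g : R -> C) : 0 < rho ->
  (forall t, 0 <= t < rho -> ser1 d (RtoC t) (g t)) -> exists M h, coef_bound M (rho / 2) d /\
    power_series_on (rho / 2) d h /\ forall t, 0 <= t < rho / 2 -> h (RtoC t) = g t.
Proof.
  intros Hrho Hd. assert (Em : forall t, 0 <= t -> Cmod (RtoC t) = t).
  { intros t Ht. rewrite Cmod_R. now apply Rabs_pos_eq. }
  destruct (ser1_coef_bound d _ _ (Hd (rho / 2) ltac:(lra))) as [M HM]. rewrite Em in HM by lra.
  destruct (power_series_on_of_coef_bound M (rho / 2) d HM) as [h Hh].
  exists M, h. split; [exact HM|]. split; [exact Hh|]. intros t Ht.
  apply (is_series_fun (V := C_NormedModule) (fun n => (d n * RtoC t ^ n)%C)).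
  - apply Hh. rewrite Em; lra.
  - apply Hd. lra.
Qed.

Lemma arc_pullback (f : C2 -> C) (alpha : R -> C2) : analytic0 f -> analytic_arc alpha ->
  exists (e : nat) (s : R) (b : nat -> C), (1 <= e)%nat /\ 0 < s /\
    forall t, 0 <= t < s -> ser1 b (RtoC t) (f (alpha (t ^ e))).
Proof.
  intros [r [c Hrep]] [Ha0 [_ [[e [d1 [d2 [rho [He [Hrho Hser]]]]]] _]]].
  assert (Hr : 0 < r) by apply Hrep.
  destruct (real_series_extends rho d1 _ Hrho (fun t Ht => proj1 (Hser t Ht)))
    as [M1 [h1 [HM1 [Hh1 E1]]]].
  destruct (real_series_extends rho d2 _ Hrho (fun t Ht => proj2 (Hser t Ht)))
    as [M2 [h2 [HM2 [Hh2 E2]]]].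
  assert (E0 : alpha (0 ^ e) = zero2) by (rewrite pow_i by lia; exact Ha0).
  assert (h10 : h1 (RtoC 0) = RtoC 0) by (rewrite E1, E0 by lra; reflexivity).
  assert (h20 : h2 (RtoC 0) = RtoC 0) by (rewrite E2, E0 by lra; reflexivity).
  destruct (analytic_on_small M1 (rho / 2) d1 h1 (r / 2) ltac:(lra) HM1 Hh1 h10 ltac:(lra))
    as [s1 [Hs1 Hb1]].
  destruct (analytic_on_small M2 (rho / 2) d2 h2 (r / 2) ltac:(lra) HM2 Hh2 h20 ltac:(lra))
    as [s2 [Hs2 Hb2]].
  destruct (pos_lower_bound2 s1 s2 ltac:(lra) ltac:(lra)) as [s [Hs [Hss1 Hss2]]].
  destruct (analytic_on_comp r s c f h1 h2 Hrep Hs) as [b Hb].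
  - apply analytic_on_le with (rho / 2); [lra|now exists d1].
  - apply analytic_on_le with (rho / 2); [lra|now exists d2].
  - intros z Hz. split; [apply Hb1|apply Hb2]; lra.
  - exists e, s, b. split; [exact He|]. split; [exact Hs|]. intros t Ht.
    rewrite (surjective_pairing (alpha (t ^ e))), <- E1, <- E2 by lra. apply Hb.
    rewrite Cmod_R, Rabs_pos_eq; lra.
Qed.

Lemma first_nonzero (b : nat -> C) : (exists n, b n <> RtoC 0) ->
  exists n, b n <> RtoC 0 /\ forall j, (j < n)%nat -> b j = RtoC 0.
Proof.
  intros H.
  destruct (dec_inh_nat_subset_has_unique_least_element _ (fun n => classic (b n <> RtoC 0)) H)
    as [n [[Hn Hmin] _]].
  exists n. split; [exact Hn|]. intros j Hj. apply NNPP. intros Hbj. specialize (Hmin j Hbj). lia.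
Qed.

Lemma ser1_factor (a : nat -> C) (n : nat) (x l : C) :
  (forall j, (j < n)%nat -> a j = RtoC 0) -> x <> RtoC 0 -> ser1 a x l ->
  ser1 (fun j => a (n + j)%nat) x (l / x ^ n)%C.
Proof.
  intros H0 Hx Hl. apply (is_series_shift_zero (V := C_NormedModule) _ _ n) in Hl.
  - apply (is_cseries_scal (/ x ^ n)%C) in Hl. rewrite Cmult_comm in Hl.
    eapply is_series_ext; [|exact Hl]. intros k. cbv beta. rewrite Cpow_add_r.
    match goal with |- @eq _ ?u ?v => change (u = v :> C) end. field. now apply Cpow_nz.
  - intros j Hj. rewrite H0 by exact Hj. apply Cmult_0_l.
Qed.

Section OrderOfSeries.
Context (g : R -> C) (e : nat) (s : R) (b : nat -> C).
Hypothesis He : (1 <= e)%nat.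
Hypothesis Hs : 0 < s.
Hypothesis Hg : forall t, 0 <= t < s -> ser1 b (RtoC t) (g (t ^ e)).

Lemma series_at_root (t : R) : 0 < t < s ^ e ->
  0 < Rpower t (/ INR e) < s /\ ser1 b (RtoC (Rpower t (/ INR e))) (g t).
Proof.
  intros Ht. assert (Eroot := Rpower_root_pow_same t e He ltac:(lra)).
  assert (hp := Rpower_pos t (/ INR e)).
  assert (hlt : Rpower t (/ INR e) < s) by (apply pow_lt_inv with e; [lra|rewrite Eroot; lra]).
  split; [lra|]. rewrite <- Eroot at 2. apply Hg. lra.
Qed.

Lemma series_nonzero (nu : R) : has_exponent (fun t => Cmod (g t)) nu -> exists n, b n <> RtoC 0.
Proof.
  intros Hexp. apply NNPP. intros Hno. apply (filter_not_empty (F := at_right 0)).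
  apply at_right_0_imp2 with (2 := at_right_0_lt (s ^ e) (pow_lt _ e Hs)) (3 := Hexp 1 Rlt_0_1).
  intros t _ Ht [h _]. destruct (series_at_root t Ht) as [_ hser].
  assert (E : g t = RtoC 0).
  { apply (is_series_fun (V := C_NormedModule) _ _ _ hser). apply is_cseries_eq0. intros n.
    replace (b n) with (RtoC 0); [apply Cmult_0_l|]. symmetry. apply NNPP. intros Hn. apply Hno.
    now exists n. }
  rewrite E, Cmod_0 in h. assert (hp := Rpower_pos t (nu + 1)). lra.
Qed.

Lemma series_has_exponent (n : nat) : b n <> RtoC 0 -> (forall j, (j < n)%nat -> b j = RtoC 0) ->
  has_exponent (fun t => Cmod (g t)) (INR n / INR e).
Proof.
  intros Hn Hlow. destruct (ser1_coef_bound b _ _ (Hg (s / 2) ltac:(lra))) as [M HM].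
  rewrite Cmod_R, Rabs_pos_eq in HM by lra.
  destruct (ser1_leading_term M (s / 2) b n ltac:(lra) HM Hlow Hn) as [d [K [Hd [HK Hlead]]]].
  apply has_exponent_comparable with (fun t => Rpower t (INR n / INR e)) K;
    [exact HK|apply has_exponent_Rpower_id|].
  apply at_right_0_imp2 with (2 := at_right_0_lt (s ^ e) (pow_lt _ e Hs))
    (3 := at_right_0_lt (d ^ e) (pow_lt _ e Hd)).
  intros t _ Ht Htd. destruct (series_at_root t Ht) as [hp hser].
  assert (Em : Cmod (RtoC (Rpower t (/ INR e))) = Rpower t (/ INR e))
    by (rewrite Cmod_R, Rabs_pos_eq; lra).
  rewrite <- Rpower_root_pow, <- Em. apply Hlead; [|exact hser]. rewrite Em.
  apply Rlt_le, pow_lt_inv with e; [lra|]. rewrite Rpower_root_pow_same; [lra|exact He|lra].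
Qed.

Lemma series_unit (n : nat) : b n <> RtoC 0 -> (forall j, (j < n)%nat -> b j = RtoC 0) ->
  ramified_analytic_unit (fun t => g t / RtoC (Rpower t (INR n / INR e)))%C.
Proof.
  intros Hn Hlow. exists 1%nat, e, (fun j => b (n + j)%nat), (s ^ e).
  split; [lia|]. split; [lia|]. split; [reflexivity|]. split; [now apply pow_lt|].
  split; [now rewrite Nat.add_0_r|]. intros t Ht. destruct (series_at_root t Ht) as [hp hser].
  replace (INR 1 / INR e) with (/ INR e) by (simpl; unfold Rdiv; ring).
  rewrite <- Rpower_root_pow, RtoC_pow.
  apply ser1_factor; [exact Hlow| |exact hser]. intros E. apply RtoC_inj in E. lra.
Qed.
End OrderOfSeries.

Lemma order_along_of_exponent (f : C2 -> C) (alpha : R -> C2) (nu : R) :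
  analytic0 f -> analytic_arc alpha -> has_exponent (fun t => Cmod (f (alpha t))) nu ->
  order_along f alpha nu.
Proof.
  intros Han Harc Hexp. destruct (arc_pullback f alpha Han Harc) as [e [s [b [He [Hs Hser]]]]].
  destruct (first_nonzero b) as [n [Hn Hlow]].
  { exact (series_nonzero (fun t => f (alpha t)) e s b He Hs Hser nu Hexp). }
  rewrite (has_exponent_unique _ _ _ Hexp (series_has_exponent (fun t => f (alpha t))
    e s b He Hs Hser n Hn Hlow)).
  exists (fun t => f (alpha t) / RtoC (Rpower t (INR n / INR e)))%C.
  split; [exact (series_unit (fun t => f (alpha t)) e s b He Hs Hser n Hn Hlow)|].
  exists 1. split; [lra|]. intros t _. field. intros E. apply RtoC_inj in E.
  assert (hp := Rpower_pos t (INR n / INR e)). lra.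
Qed.

Lemma germ_mult_ge_1 (f : C2 -> C) (m : nat) : germ_mult f m -> f zero2 = RtoC 0 -> (1 <= m)%nat.
Proof.
  intros [r [c [Hrep [[i [j [Hij Hne]]] _]]]] Hf0. destruct m as [|m]; [exfalso|lia].
  apply Hne. replace i with 0%nat by lia. replace j with 0%nat by lia.
  now rewrite <- (ser2_rep_0 r c f Hrep).
Qed.

Theorem mainTheorem2
  (f : C2 -> C) (m : nat) (Phi : C2 -> C2) (a : nat -> C)
  (s : nat) (beta e : nat -> nat)
  (gamma alpha : R -> C2) (c : R) (k : nat) :
  irreducible_germ f ->
  germ_mult f m ->
  puiseux_param f Phi m a ->
  puiseux_pairs m a s beta e ->
  real_analytic_halfbranch_map gamma ->
  analytic_arc alpha ->
  parameterizes alpha gamma ->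
  contact_eq f alpha c ->
  (k <= s)%nat ->
  INR (beta k) <= INR m * c ->
  ((k < s)%nat -> INR m * c < INR (beta (S k))) ->
  order_along f alpha
    (INR (e k) * c
     + rsum (fun i => (INR (e i) - INR (e (S i))) * (INR (beta (S i)) / INR m)) k).
Proof.
  intros [Han [Hf0 _]] Hmult Hparam Hpairs _ Harc _ Hcont Hk Hkc Hck.
  assert (Hm := germ_mult_ge_1 f m Hmult Hf0).
  destruct (branch_levels_exist m a s beta e Hpairs) as [B HB].
  assert (Horders := branch_levels_orders m a s beta e Hpairs Hm B (proj1 (proj2 Hparam)) HB).
  assert (Hprofile := order_profile_of_param f m Phi a B Hm Hf0 Hmult Hparam Horders).
  assert (Hnorm := arc_norm_has_exponent alpha (proj2 (proj2 (proj2 Harc)))).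
  apply order_along_of_exponent; [exact Han|exact Harc|].
  rewrite <- (rsum_profile_exponent m a s beta e B c k Hm Hpairs HB Hk Hkc Hck).
  exact (order_exponent f m B alpha c Hm Hprofile Hnorm Hcont).
Qed.
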